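(* If $d\ge3$ and $G$ is an almost smooth convex body in $\mathbb{R}^d$, then $\mathcal{N}_d(G)=d$.
   Context: A convex body in $\mathbb{R}^d$ is a compact convex subset with nonempty interior. For $d\ge3$, a convex body $G\subset\mathbb{R}^d$ is almost smooth if for each boundary point $x\in\partial G$ and any two outer unit normal vectors $u_1,u_2$ of the supporting hyperplane(s) of $G$ at $x$, the inequality $u_1\cdot u_2\ge (d-2)/(d-1)$ holds. $\mathcal{N}_d(G)$ is the smallest $n\in\mathbb{N}$ for which there exists a set $\mathcal{E}\subset\mathbb{S}^{d-1}$ of $n$ directions such that $\operatorname{span}(\mathcal{E})=\mathbb{R}^d$ and $w_r(G;\mathcal{E})_p<\infty$ for all $r\in\mathbb{N}$ and $0<p\le\infty$. Notation. $\|\cdot\|$ is the Euclidean norm, $\mathbb{S}^{d-1}=\{x\in\mathbb{R}^d:\|x\|=1\}$, $\mathbb{N}=\{1,2,\dots\}$. For $0<p<\infty$, $L^p(\Omega)$ is the usual Lebesgue space; $L^\infty(\Omega):=C(\overline{\Omega})$ with the uniform norm. For a nonempty bounded measurable set $\Omega\subset\mathbb{R}^d$, $h\in\mathbb{R}^d\setminus\{0\}$ and $r\in\mathbb{N}$ put $\Omega_{r,h}:=\{x\in\Omega: x,x+h,\dots,x+rh\in\Omega\}$ and $\triangle_h^r f(x):=\sum_{j=0}^r(-1)^{r+j}\binom{r}{j}f(x+jh)$ for $x\in\Omega_{r,h}$. For $\xi\in\mathbb{S}^{d-1}$, $t>0$, $0<p\le\infty$ let $\omega_\xi^r(f,t)_{L^p(\Omega)}:=\sup_{|u|\le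 t}\|\triangle_{u\xi}^rf\|_{L^p(\Omega_{r,u\xi})}$ (the norm over an empty set is $0$). For a nonempty $\mathcal{E}\subset\mathbb{S}^{d-1}$ let $\omega^r_{\mathcal{E}}(f;\Omega)_p:=\sup_{\xi\in\mathcal{E}}\omega^r_\xi(f,\operatorname{diam}(\Omega))_{L^p(\Omega)}$. $\Pi^d_{r-1}(\mathcal{E})$ is the set of all real continuous functions $Q$ on $\mathbb{R}^d$ such that for every fixed $x\in\mathbb{R}^d$ and $\xi\in\mathcal{E}$ the function $t\mapsto Q(x+t\xi)$ is an algebraic polynomial of degree $<r$ in $t\in\mathbb{R}$. Set $E_r(f;\mathcal{E})_{L^p(\Omega)}:=\inf\{\|f-Q\|_{L^p(\Omega)}:Q\in\Pi^d_{r-1}(\mathcal{E})\}$. The directional Whitney constant is $w_r(\Omega;\mathcal{E})_p:=\sup\{E_r(f;\mathcal{E})_{L^p(\Omega)}: f\in L^p(\Omega),\ \omega^r_{\mathcal{E}}(f;\Omega)_p\le 1\}\in[0,\infty]$. *)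

(* Defs.v *)
From HB Require Import structures.
From mathcomp Require Import all_boot all_order all_algebra finmap.
From mathcomp Require Import all_classical all_reals all_analysis.

Set Implicit Arguments.
Unset Strict Implicit.
Unset Printing Implicit Defensive.

Import Order.TTheory GRing.Theory Num.Theory.
Import numFieldNormedType.Exports.

Local Open Scope classical_set_scope.
Local Open Scope ring_scope.

(* The measurable sets of 'rV[R]_n are generated by the coordinate
   projections, i.e. they are the Borel sets of R^n.  Every class of the
   Lebesgue spaces below has a Borel measurable representative. *)
Section measurable_rV.
Context {R : realType} (n : nat).

Definition coord_rV (i : 'I_n) (v : 'rV[R]_n) : measurableTypeR R := v 0 i.

Let rV_measurable0 : g_sigma_preimage coord_rV set0.
Proof. exact: sigma_algebra0. Qed.

Let rV_measurableC A :
  g_sigma_preimage coord_rV A -> g_sigma_preimage coord_rV (~` A).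
Proof. exact: sigma_algebraC. Qed.

Let rV_measurable_bigcup (F : (set 'rV[R]_n)^nat) :
  (forall i, g_sigma_preimage coord_rV (F i)) ->
  g_sigma_preimage coord_rV (\bigcup_i (F i)).
Proof. exact: sigma_algebra_bigcup. Qed.

HB.instance Definition _ := @isMeasurable.Build default_measure_display
  'rV[R]_n (g_sigma_preimage coord_rV)
  rV_measurable0 rV_measurableC rV_measurable_bigcup.

End measurable_rV.

Section measurable_cons_rV.
Context {R : realType}.

Lemma measurable_coord_rV n (i : 'I_n) :
  measurable_fun [set: 'rV[R]_n] (@coord_rV R n i).
Proof.
move=> _ Y mY; rewrite setTI; apply: sub_sigma_algebra => /=.
rewrite -bigcup_seq/=; exists i => /=; first by rewrite mem_index_enum.
by exists Y => //; rewrite setTI.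
Qed.

Lemma measurable_fun_rVP d (T : measurableType d) n (f : T -> 'rV[R]_n) :
  (forall i, measurable_fun [set: T] (@coord_rV R n i \o f)) ->
  measurable_fun [set: T] f.
Proof.
move=> mf _ A mA; rewrite setTI.
have : preimage_set_system [set: T] f (g_sigma_preimage (@coord_rV R n))
    (f @^-1` A) by exists A => //; rewrite setTI.
rewrite -g_sigma_preimage_comp; apply: smallest_sub.
  exact: sigma_algebra_measurable.
rewrite -bigcup_seq; apply: bigcup_sub => i _ B [C mC <-].
exact: mf.
Qed.

Definition cons_rV n (p : measurableTypeR R * 'rV[R]_n) : 'rV[R]_n.+1 :=
  @row_mx R 1 1 n (const_mx p.1) p.2.

Definition uncons_rV n (v : 'rV[R]_n.+1) : measurableTypeR R * 'rV[R]_n :=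
  (v 0 0, rsubmx (v : 'rV_(1 + n))).

Lemma cons_rVK n : cancel (@cons_rV n) (@uncons_rV n).
Proof.
move=> [x v]; rewrite /cons_rV /uncons_rV row_mxKr /=; congr pair.
transitivity (@row_mx R 1 1 n (const_mx x) v 0 (lshift n 0)).
  by congr (row_mx _ _ _ _); apply: ord_inj.
by rewrite row_mxEl mxE.
Qed.

Lemma measurable_cons_rV n :
  measurable_fun [set: measurableTypeR R * 'rV[R]_n] (@cons_rV n).
Proof.
apply: measurable_fun_rVP => i.
case: (@split_ordP 1 n i) => j ->.
  rewrite (_ : _ \o _ = fst)//.
  by apply/funext => p; rewrite /= /coord_rV /cons_rV (@row_mxEl R 1 1 n) mxE.
rewrite (_ : _ \o _ = @coord_rV R n j \o snd).
  by apply: measurableT_comp => //; exact: measurable_coord_rV.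
by apply/funext => p; rewrite /= /coord_rV /cons_rV (@row_mxEr R 1 1 n).
Qed.

Lemma measurable_uncons_rV n : measurable_fun [set: 'rV[R]_n.+1] (@uncons_rV n).
Proof.
apply/measurable_fun_pairP; split; first exact: measurable_coord_rV.
apply: measurable_fun_rVP => i.
rewrite (_ : _ \o _ = @coord_rV R n.+1 (rshift 1 i)).
  exact: measurable_coord_rV.
by apply/funext => v; rewrite /= /coord_rV mxE.
Qed.

End measurable_cons_rV.

Section lebesgue_rV.
Context {R : realType}.
Local Open Scope ereal_scope.

Fixpoint lebesgue_rV n : set 'rV[R]_n -> \bar R :=
  if n isn't n'.+1 then dirac (0 : 'rV[R]_0)%R
  else pushforward (@lebesgue_measure R \x @lebesgue_rV n') (@cons_rV R n').
Arguments lebesgue_rV n A : clear implicits.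

Let product_sigma_finite d1 d2 (T1 : measurableType d1)
    (T2 : measurableType d2) (m1 : {sigma_finite_measure set T1 -> \bar R})
    (m2 : {sigma_finite_measure set T2 -> \bar R}) :
  sigma_finite setT (m1 \x m2).
Proof.
have /sigma_finiteP[F [TF ndF Foo]] := sigma_finiteT m1.
have /sigma_finiteP[G [TG ndG Goo]] := sigma_finiteT m2.
exists (fun n => F n `*` G n).
  rewrite -setXTT TF TG predeqE => -[x y]; split.
    move=> [/= [n _ Fnx] [k _ Gky]]; exists (maxn n k) => //; split.
    - by move: x Fnx; exact/subsetPset/ndF/leq_maxl.
    - by move: y Gky; exact/subsetPset/ndG/leq_maxr.
  by move=> [n _ []/= ? ?]; split; exists n.
move=> k; have [? ?] := Foo k; have [? ?] := Goo k.
split; first exact: measurableX.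
by rewrite product_measure1E// lte_mul_pinfty// ge0_fin_numE.
Qed.

Let lebesgue_rV_spec n :
  exists mu : {sigma_finite_measure set 'rV[R]_n -> \bar R},
    lebesgue_rV n = mu.
Proof.
elim: n => [|n [mu muE]]; first by exists (dirac (0 : 'rV[R]_0)%R).
have [F FT Foo] := product_sigma_finite (@lebesgue_measure R) mu.
pose m := @measure_function_pushforward__canonical__measure_function_Measure
  _ _ _ _ _ (@lebesgue_measure R \x mu) _ (@measurable_cons_rV R n).
have mE : lebesgue_rV n.+1 = m by rewrite /= muE.
have sf : sigma_finite setT m.
  exists (fun k => @uncons_rV R n @^-1` F k).
    by rewrite -preimage_bigcup -FT preimage_setT.
  move=> k; have [mF Fk] := Foo k; split.
    by rewrite -[X in measurable X]setTI; exact: measurable_uncons_rV.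
  rewrite /m /= /pushforward -comp_preimage.
  by rewrite (_ : _ \o _ = id)//; apply/funext => p /=; rewrite cons_rVK.
pose sm := Measure_isSigmaFinite.Build _ _ _ m sf.
pose M : {sigma_finite_measure set 'rV[R]_n.+1 -> \bar R} :=
  HB.pack (m : set _ -> \bar R) m sm.
by exists M.
Qed.

Let lebesgue_rV0 n : lebesgue_rV n set0 = 0.
Proof. by have [mu ->] := lebesgue_rV_spec n; exact: measure0. Qed.

Let lebesgue_rV_ge0 n A : 0 <= lebesgue_rV n A.
Proof. by have [mu ->] := lebesgue_rV_spec n; exact: measure_ge0. Qed.

Let lebesgue_rV_semi_sigma_additive n : semi_sigma_additive (lebesgue_rV n).
Proof.
by have [mu ->] := lebesgue_rV_spec n; exact: measure_semi_sigma_additive.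
Qed.

HB.instance Definition _ n := isMeasure.Build _ _ _ (lebesgue_rV n)
  (lebesgue_rV0 n) (@lebesgue_rV_ge0 n) (@lebesgue_rV_semi_sigma_additive n).

Let lebesgue_rV_sigma_finite n : sigma_finite setT (lebesgue_rV n).
Proof. by have [mu ->] := lebesgue_rV_spec n; exact: sigma_finiteT. Qed.

HB.instance Definition _ n :=
  Measure_isSigmaFinite.Build _ _ _ (lebesgue_rV n)
  (lebesgue_rV_sigma_finite n).

End lebesgue_rV.
Arguments lebesgue_rV {R} n A.

Section euclidean.
Context {R : realType} {d : nat}.
Implicit Types (x y u v : 'rV[R]_d) (G : set 'rV[R]_d).

Definition dotrV u v : R := \sum_(i < d) u 0 i * v 0 i.

(* The canonical norm on 'rV[R]_d is the sup norm, which induces the same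
   topology. *)
Definition enorm x : R := Num.sqrt (dotrV x x).

Definition diam G : R := sup [set enorm (x - y) | x in G & y in G].

Definition convex_body G :=
  [/\ compact G, convex_set (G : set (convex_lmodType 'rV[R]_d)) &
      interior G !=set0].

Definition outer_unit_normal G x u :=
  enorm u = 1 /\ forall y, G y -> dotrV u y <= dotrV u x.

Definition almost_smooth G :=
  convex_body G /\
  forall x, (closure G `\` interior G) x ->
  forall u1 u2, outer_unit_normal G x u1 -> outer_unit_normal G x u2 ->
  (d%:R - 2) / (d%:R - 1) <= dotrV u1 u2.

End euclidean.

Section whitney.
Context {R : realType} {d : nat}.
Implicit Types (O G E : set 'rV[R]_d) (f Q : 'rV[R]_d -> R) (p : \bar R).
Implicit Types (x h xi : 'rV[R]_d) (r n : nat).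

(* For p = +oo only continuous functions are considered and the norm is the
   uniform one; maxe 0 gives the norm 0 on the empty set. *)
Definition Lpnorm O p f : \bar R :=
  if p == +oo%E then maxe 0%E (ereal_sup [set (`|f x|)%:E | x in O])
  else Lnorm (lebesgue_rV d) p ((EFin \o f) \_ O).

Definition Lp_space O p : set ('rV[R]_d -> R) :=
  [set f : 'rV[R]_d -> R |
    if p == +oo%E then {within closure O, continuous f}
    else measurable_fun O f /\ (Lpnorm O p f < +oo)%E].

Definition diff_dom O r h : set 'rV[R]_d :=
  [set x | forall j, (j <= r)%N -> O (x + j%:R *: h)].

Definition fdiff r h f x : R :=
  \sum_(j < r.+1) (-1) ^+ (r + j) * 'C(r, j)%:R * f (x + j%:R *: h).

Definition dir_modulus r xi f (t : R) O p : \bar R :=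
  ereal_sup [set Lpnorm (diff_dom O r (u *: xi)) p (fdiff r (u *: xi) f)
            | u in [set u : R | `|u| <= t]].

Definition modulus r E f O p : \bar R :=
  ereal_sup [set dir_modulus r xi f (diam O) O p | xi in E].

(* Polynomials of degree < r have size <= r. *)
Definition dir_poly r E : set ('rV[R]_d -> R) :=
  [set Q | continuous Q /\
    forall x xi, E xi ->
    exists2 q : {poly R}, (size q <= r)%N & forall t, Q (x + t *: xi) = q.[t]].

Definition best_approx r f E O p : \bar R :=
  ereal_inf [set Lpnorm O p (f \- Q) | Q in dir_poly r E].

Definition whitney_const r O E p : \bar R :=
  ereal_sup [set best_approx r f E O p
            | f in [set f | Lp_space O p f /\ (modulus r E f O p <= 1)%E]].

Definition whitney_directions G (E : {fset 'rV[R]_d}) :=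
  [/\ forall xi, xi \in E -> enorm xi = 1,
      <<enum_fset E>>%VS = fullv &
      forall r p, (0 < r)%N -> (0 < p)%E ->
        (whitney_const r G [set` E] p < +oo)%E].

Definition whitney_direction_counts G : set nat :=
  [set n | (0 < n)%N /\ exists2 E, whitney_directions G E & #|` E| = n].

(* The value is 0 if and only if no finite set of directions is suitable. *)
Definition min_directions G : nat :=
  xget 0%N [set n | whitney_direction_counts G n /\
    forall m, whitney_direction_counts G m -> (n <= m)%N].

End whitney.

(* Main.v *)
(* The lower bound holds because d directions are needed to span R^d.  For the
   upper bound it suffices to find an orthonormal basis xi_1, ..., xi_d that
   X-rays G: every point of G lies on a line parallel to some xi_i that meets
   the interior of G.

   Such a basis gives the Whitney inequality.  Near an interior point, view
   t |-> f(. + sum_i t_i xi_i), with t in a cube, as a function with values in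
   L^p of a small ball K; its r-th differences along the axes are bounded by
   the modulus.  In one variable, a Marchaud argument bounds the first
   difference of g = f - (interpolant) by eta sup |g| + C omega for small
   steps; since g vanishes at the nodes, sup |g| <= C omega follows without
   any regularity of f, for all p > 0.  Interpolating coordinate by coordinate
   handles the cube, and a Fubini argument picks x in K at which the L^p-valued
   interpolant is a polynomial close to f.  The bound then propagates: f(x) is
   determined by the r-th difference and by f(x + j h), 1 <= j <= r, so it
   moves along lines parallel to the xi_i from the interior to all of G, and
   compactness concludes.

   For an almost smooth G, a basis fails to X-ray G only if at some y there are
   unit normals w_i orthogonal to xi_i.  The angle condition then forces
   w_i = sum_(k <> i) eps_k xi_k / sqrt (d - 1) with signs eps.  If this
   happened for two slightly rotated bases with the same signs, the points y
   would coincide and the angle condition would fail for normals taken from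
   the two bases.  There are finitely many sign patterns and infinitely many
   rotations. *)

Require Import Defs.
From mathcomp Require Import all_boot all_order all_algebra finmap.
From mathcomp Require Import all_classical all_reals all_analysis.
From mathcomp Require Import measurable_realfun ring lra.

Set Implicit Arguments.
Unset Strict Implicit.
Unset Printing Implicit Defensive.

Import Order.TTheory GRing.Theory Num.Theory.
Import numFieldNormedType.Exports.

Local Open Scope classical_set_scope.
Local Open Scope ring_scope.

(** * Whitney approximation in one variable *)

Section poly_action.
Context {R : realType} {V : lmodType R}.
Implicit Types (p q : {poly R}) (g : R -> V) (h t : R).

(* [q] acts as a polynomial in the shift by [h]: [('X - 1) ^+ r] is the r-th
   difference with step [h]. *)
Definition act q h g t : V := \sum_(i < size q) q`_i *: g (t + i%:R * h).

Lemma act_widen n q h g t : (size q <= n)%N ->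
  act q h g t = \sum_(i < n) q`_i *: g (t + i%:R * h).
Proof.
move=> qn; rewrite /act (big_ord_widen _ (fun i => q`_i *: g (t + i%:R * h)) qn).
rewrite big_mkcond; apply: eq_bigr => i _; case: ifPn => //.
by rewrite -leqNgt => /leq_sizeP/(_ i (leqnn _)) ->; rewrite scale0r.
Qed.

Lemma actD p q h g t : act (p + q) h g t = act p h g t + act q h g t.
Proof.
rewrite (act_widen _ _ _ (leq_trans (size_polyD p q) (leqnn _))).
rewrite (act_widen _ _ _ (leq_maxl (size p) (size q))).
rewrite (act_widen _ _ _ (leq_maxr (size p) (size q))) -big_split /=.
by apply: eq_bigr => i _; rewrite coefD scalerDl.
Qed.

Lemma actZ c q h g t : act (c *: q) h g t = c *: act q h g t.
Proof.
rewrite (act_widen _ _ _ (size_scale_leq c q)) scaler_sumr.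
by apply: eq_bigr => i _; rewrite coefZ scalerA.
Qed.

Lemma actC c h g t : act c%:P h g t = c *: g t.
Proof.
by rewrite (act_widen _ _ _ (size_polyC_leq1 c)) big_ord1 coefC mul0r addr0.
Qed.

Lemma act_mulXn n q h g t : act (q * 'X^n) h g t = act q h g (t + n%:R * h).
Proof.
elim: n t => [|n IHn] t; first by rewrite mulr1 mul0r addr0.
rewrite exprSr mulrA.
have sq : (size (q * 'X^n * 'X)%R <= (size (q * 'X^n)%R).+1)%N.
  by apply: leq_trans (size_polyMleq _ _) _; rewrite size_polyX addn2.
rewrite (act_widen _ _ _ sq) big_ord_recl coefMX eqxx scale0r add0r.
transitivity (act (q * 'X^n) h g (t + h)).
  apply: eq_bigr => i _; rewrite coefMX /=; congr (_ *: g _).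
  by rewrite /bump /= natrD; ring.
by rewrite IHn -addn1 natrD; congr act; ring.
Qed.

(** Polynomials in the shift act as a ring, so identities between polynomials become identities
    between difference operators. *)
Lemma act_mul p q h g t : act (p * q) h g t = act p h (act q h g) t.
Proof.
elim/poly_ind: p t => [|p c IHp] t; first by rewrite mul0r /act size_poly0 !big_ord0.
rewrite mulrDl -mulrA (mulrC 'X q) mulrA -(expr1 'X) !actD !act_mulXn IHp.
by rewrite mul_polyC actZ actC.
Qed.

(** Substituting ['X^n] multiplies the step by [n]; this is how differences with steps [h] and [n h]
    get compared. *)
Lemma act_comp_polyXn n p h g t :
  act (p \Po 'X^n) h g t = act p (n%:R * h) g t.
Proof.
elim/poly_ind: p t => [|p c IHp] t.
  by rewrite comp_poly0 /act size_poly0 !big_ord0.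
rewrite comp_polyD comp_polyM comp_polyX comp_polyC !actD act_mulXn IHp !actC.
by rewrite -(expr1 'X) act_mulXn mul1r.
Qed.

Lemma act_XsubC1 h g t : act ('X - 1) h g t = g (t + h) - g t.
Proof.
have -> : 'X - 1 = 1%:P * 'X^1 + (- 1)%:P :> {poly R} by rewrite polyCN polyC1 mul1r.
by rewrite actD act_mulXn !actC mul1r scale1r scaleN1r.
Qed.

Lemma act_funB q h g1 g2 t :
  act q h (fun s => g1 s - g2 s) t = act q h g1 t - act q h g2 t.
Proof.
by rewrite /act -sumrB; apply: eq_bigr => i _; rewrite scalerBr.
Qed.

Lemma act_fun_sum (I : finType) q h (G : I -> R -> V) t :
  act q h (fun s => \sum_j G j s) t = \sum_j act q h (G j) t.
Proof.
rewrite /act exchange_big; apply: eq_bigr => i _.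
by rewrite scaler_sumr.
Qed.

Lemma eq_act q h g1 g2 t : g1 =1 g2 -> act q h g1 t = act q h g2 t.
Proof. by move=> g12; apply: eq_bigr => i _; rewrite g12. Qed.

(** The increment of [q * 'X + c] is the increment of [q] times ['X], covered by induction, plus [h]
    times the shifted [q]. *)
Lemma size_fwd_diff q h r : (size q <= r.+1)%N ->
  (size (q \Po ('X + h%:P) - q)%R <= r)%N.
Proof.
elim/poly_ind: q r => [|q c IHq] r; first by rewrite comp_poly0 subr0 size_poly0.
have [->|q0] := eqVneq q 0.
  by move=> _; rewrite mul0r add0r comp_polyC subrr size_poly0.
rewrite size_MXaddC (negbTE q0) /= ltnS => qr.
have qE : (q * 'X + c%:P) \Po ('X + h%:P) - (q * 'X + c%:P) =
  (q \Po ('X + h%:P) - q) * 'X + h *: (q \Po ('X + h%:P)).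
  rewrite comp_polyD comp_polyM comp_polyX comp_polyC -mul_polyC.
  by ring.
have sh : size ('X + h%:P : {poly R}) = 2%N by exact: size_XaddC.
rewrite qE; apply: leq_trans (size_polyD _ _) _; rewrite geq_max; apply/andP; split.
  case: r qr => [|r] qr; first by move: qr; rewrite leqn0 size_poly_eq0 (negbTE q0).
  by apply: leq_trans (size_polyMleq _ _) _; rewrite size_polyX addn2 /= ltnS IHq.
by apply: leq_trans (size_scale_leq _ _) _; rewrite size_comp_poly2.
Qed.

(** The coefficient [v] is there for interpolants with values in [V]: subtracting one leaves the
    r-th differences unchanged. *)
Lemma act_diff_poly r q h v t : (size q <= r)%N ->
  act (('X - 1) ^+ r) h (fun s => q.[s] *: v) t = 0.
Proof.
elim: r q t => [|r IHr] q t qr.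
  by move: qr; rewrite leqn0 size_poly_eq0 => /eqP ->; rewrite expr0 -polyC1 actC horner0 scale0r scaler0.
rewrite exprSr act_mul.
rewrite (@eq_act _ _ _ (fun s => (q \Po ('X + h%:P) - q).[s] *: v)).
  exact/IHr/size_fwd_diff.
move=> s; rewrite act_XsubC1 -scalerBl !hornerE horner_comp; congr (_ *: _).
by rewrite !hornerE.
Qed.

End poly_action.

(* [B v m] reads "v has size at most m".  In L^p the size is the p-th power of
   the quasi-norm if [p] is finite, with [kappa] = 2^p and [sg c] = |c|^p, and
   the uniform norm if [p] is infinite. *)
Record gauge {R : realType} {V : lmodType R} (B : V -> R -> Prop)
    (kappa : R) (sg : R -> R) : Prop := Gauge {
  gauge_le : forall v m n, m <= n -> B v m -> B v n ;
  gauge0 : B 0 0 ;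
  gaugeD : forall v w m n, 0 <= m -> 0 <= n -> B v m -> B w n ->
    B (v + w) (kappa * (m + n)) ;
  gaugeZ : forall c v m, 0 <= m -> B v m -> B (c *: v) (sg c * m) ;
  gauge_kappa : 1 <= kappa ;
  gauge_sg_ge0 : forall c, 0 <= sg c ;
  gauge_sg_homo : forall c c', `|c| <= `|c'| -> sg c <= sg c' ;
  gauge_sg_small : forall e, 0 < e ->
    exists2 a, 0 < a & forall c, `|c| <= a -> sg c <= e }.

Lemma size_index_enum (T : finType) : size (index_enum T) = #|T|.
Proof. by rewrite cardT enumT [index_enum _]unlock. Qed.

Section gauge_theory.
Context {R : realType} {V : lmodType R} {B : V -> R -> Prop}.
Context {kappa : R} {sg : R -> R} (gB : gauge B kappa sg).

Let kappa_gt0 : 0 < kappa.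
Proof. exact: lt_le_trans ltr01 (gauge_kappa gB). Qed.

(** Without a triangle inequality the constant comes from iterating [gaugeD], so it depends on the
    number of terms alone. *)
Lemma gauge_sum n : exists2 C, 0 <= C &
  forall (I : Type) (s : seq I) (v : I -> V) m, size s = n -> 0 <= m ->
  (forall i, B (v i) m) -> B (\sum_(i <- s) v i) (C * m).
Proof.
elim: n => [|n [C C0 IHn]].
  exists 0 => // I s v m /size0nil -> m0 _; rewrite big_nil mul0r.
  exact: gauge0 gB.
exists (kappa * (1 + C)); first by rewrite mulr_ge0 ?addr_ge0// ltW.
move=> I [//|i s] v m [sn] m0 vm; rewrite big_cons -mulrA mulrDl mul1r.
by apply: (gaugeD gB) => //; [exact: mulr_ge0 | exact: IHn].
Qed.

Lemma gauge_comb n (a : R) : exists2 C, 0 <= C &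
  forall (I : Type) (s : seq I) (c : I -> R) (v : I -> V) m,
  size s = n -> 0 <= m -> (forall i, `|c i| <= `|a|) ->
  (forall i, B (v i) m) -> B (\sum_(i <- s) c i *: v i) (C * m).
Proof.
have [C C0 HC] := gauge_sum n.
exists (C * sg a); first by rewrite mulr_ge0 // (gauge_sg_ge0 gB).
move=> I s c v m sn m0 ca vm; rewrite -mulrA; apply: HC => // [|i].
  by rewrite mulr_ge0 // (gauge_sg_ge0 gB).
apply: (gauge_le gB) (gaugeZ gB (c i) m0 (vm i)).
by rewrite ler_wpM2r // (gauge_sg_homo gB).
Qed.

Lemma gauge_act (q : {poly R}) : exists2 C, 0 <= C &
  forall g h t m, 0 <= m ->
  (forall i, (i < size q)%N -> B (g (t + i%:R * h)) m) ->
  B (act q h g t) (C * m).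
Proof.
pose a := \sum_(i < size q) `|q`_i|.
have [C C0 HC] := gauge_comb (size q) a.
exists C => // g h t m m0 gm; apply: HC => //.
- by rewrite size_index_enum card_ord.
- move=> i; rewrite [leRHS]ger0_norm ?sumr_ge0//.
  by rewrite /a (bigD1 i) //= lerDl sumr_ge0.
- by move=> i; exact: gm.
Qed.

End gauge_theory.

(** * Marchaud's inequality *)

Section marchaud.
Context {R : realType} {V : lmodType R} {B : V -> R -> Prop}.
Context {kappa : R} {sg : R -> R} (gB : gauge B kappa sg).

Let kappa_gt0 : 0 < kappa.
Proof. exact: lt_le_trans ltr01 (gauge_kappa gB). Qed.

Definition bounded_on01 (g : R -> V) m := forall t, 0 <= t <= 1 -> B (g t) m.

Definition diff_bounded_on01 r (g : R -> V) w := forall t h, 0 <= h -> 0 <= t ->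
  t + r%:R * h <= 1 -> B (act (('X - 1) ^+ r) h g t) w.

(** ['X^n - 1] is [('X - 1) * S] where [S] takes the value [n] at 1, so [S ^+ k - n ^+ k] has the
    factor ['X - 1]. *)
Lemma power_diff_factor (n k : nat) : exists P : {poly R},
  ('X^n - 1) ^+ k = n%:R ^+ k *: ('X - 1) ^+ k + P * ('X - 1) ^+ k.+1.
Proof.
pose S : {poly R} := \sum_(i < n) 'X^i.
have XnE : 'X^n - 1 = ('X - 1) * S by rewrite subrX1.
have /factor_theorem[P HP] : root (S ^+ k - (n%:R ^+ k)%:P) 1.
  rewrite rootE !hornerE horner_sum.
  under eq_bigr do rewrite hornerXn expr1n.
  by rewrite sumr_const card_ord subrr.
exists P; rewrite XnE exprMn exprS.
have -> : S ^+ k = P * ('X - 1%:P) + (n%:R ^+ k)%:P by rewrite -HP subrK.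
by rewrite polyC1 -mul_polyC; ring.
Qed.

Lemma size_XsubC1_exp k : size (('X - 1 : {poly R}) ^+ k) = k.+1.
Proof. by rewrite -polyC1 size_exp_XsubC. Qed.

Lemma ler_step (i k : nat) (h e : R) : (i <= k)%N -> 0 <= h -> h * k.+1%:R <= e ->
  0 <= i%:R * h <= e.
Proof.
move=> ik h0 he; rewrite mulr_ge0 //=; apply: le_trans he.
by rewrite mulrC ler_wpM2l // ler_nat ltnW.
Qed.


(* Downward induction on [k]: by [power_diff_factor] a k-th difference with step
   [h] is [n ^- k] times one with step [n h], up to (k+1)-st differences. *)
Lemma marchaud r k : (0 < k <= r)%N -> forall e T : R, 0 < e -> 0 <= T < 1 ->
  exists2 a, 0 < a & exists2 C, 0 <= C & forall g (m w : R), 0 <= m -> 0 <= w ->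
    bounded_on01 g m -> diff_bounded_on01 r g w ->
    forall h t : R, 0 <= h <= a -> 0 <= t <= T ->
    B (act (('X - 1) ^+ k) h g t) (e * m + C * w).
Proof.
move=> /andP[k0 kr]; rewrite -(subKn kr).
have : (r - k < r)%N by rewrite ltn_subrL k0 (leq_trans k0).
elim: (r - k)%N => {k k0 kr} [_|j IHj jr].
  (* Case [k = r]: for [h] below this bound, [t + r h] stays at most 1 and the hypothesis on [g]
     applies directly. *)
  move=> e T e0 T01; rewrite subn0; exists ((1 - T) / r.+1%:R).
    by rewrite divr_gt0 ?ltr0n//; lra.
  exists 1 => // g m w m0 w0 gm gw h t /andP[h0 ha] /andP[t0 tT].
  apply: (gauge_le gB) (gw t h h0 t0 _); first by rewrite mul1r lerDr mulr_ge0 // ltW.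
  move: ha; rewrite ler_pdivlMr ?ltr0n// => ha.
  have /andP[_ ?] := ler_step (leqnn r) h0 ha; lra.
move=> e T e0 T01; have kE : (r - j)%N = (r - j.+1).+1 by rewrite subnSK// ltnW.
have := IHj (ltnW jr); rewrite {}kE; have := subn_gt0 j.+1 r; rewrite jr.
move: (r - j.+1)%N => k k0 {}IHj.
have [C1 C10 HC1] := gauge_act gB (('X - 1 : {poly R}) ^+ k).
pose e1 := e / (2 * kappa).
have e10 : 0 < e1 by rewrite divr_gt0 // mulr_gt0.
have C1p : 0 < C1 + 1 by lra.
have [a1 a10 Ha1] := gauge_sg_small gB (divr_gt0 e10 C1p).
(* Since [n >= a1^-1] and [k > 0], the factor [c = n ^- k] is at most [a1], whence
   [sg c * C1 <= e1]. *)
pose n := (Num.truncn a1^-1).+1.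
have n0 : 0 < n%:R :> R by rewrite ltr0n.
pose c := (n%:R ^+ k)^-1 : R.
have c_small : `|c| <= a1.
  rewrite ger0_norm ?invr_ge0 ?exprn_ge0 ?ler0n// /c invf_ple ?posrE ?exprn_gt0//.
  apply: (@le_trans _ _ n%:R); first exact/ltW/truncnS_gt.
  by case: (k) k0 => // k' _; rewrite exprS ler_peMr ?ler0n// exprn_ege1// ler1n.
have [P PE] := power_diff_factor n k.
have PE' : ('X - 1) ^+ k = c *: ('X^n - 1) ^+ k + (- c *: P) * ('X - 1) ^+ k.+1 :> {poly R}.
  rewrite PE scalerDr scalerA mulVf ?expf_neq0 ?gt_eqF// scale1r.
  by rewrite -scalerAl scaleNr addrK.
have [C2 C20 HC2] := gauge_act gB (- c *: P).
(* [n], hence [P] and [C2], are fixed before the induction hypothesis is used, so its precision can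
   absorb [C2]. *)
pose e2 := e1 / (C2 + 1).
have C2p : 0 < C2 + 1 by lra.
have e20 : 0 < e2 by rewrite divr_gt0.
(* The shifts in [P] move the base point past [T]; the midpoint of [T] and 1 leaves room for
   them. *)
have T'01 : 0 <= (1 + T) / 2 < 1 by lra.
have [a2 a20 [C3 C30 HC3]] := IHj _ _ e20 T'01.
set s := size (- c *: P) in HC2.
(* [b1] keeps the shifts in [P] left of that midpoint, and [b2] keeps [k] steps of length [n h]
   inside the interval. *)
pose b1 := (1 - T) / 2 / s.+1%:R; pose b2 := (1 - T) / k.+1%:R / n%:R.
exists (Num.min a2 (Num.min b1 b2)).
  by rewrite !lt_min a20 /= !divr_gt0 ?ltr0n//; lra.
exists (kappa * (C2 * C3)); first by rewrite !mulr_ge0 // ltW.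
move=> g m w m0 w0 gm gw h t /andP[h0]; rewrite !le_min => /and3P[ha hb1 hb2] /andP[t0 tT].
rewrite PE' actD actZ act_mul.
have -> : ('X^n - 1) ^+ k = (('X - 1) ^+ k) \Po 'X^n :> {poly R}.
  by rewrite rmorphXn /= comp_polyB comp_polyX -polyC1 comp_polyC.
rewrite act_comp_polyXn.
have B1 : B (act (('X - 1) ^+ k) (n%:R * h) g t) (C1 * m).
  apply: HC1 => // i; rewrite size_XsubC1_exp ltnS => ik; apply: gm.
  have nh0 : 0 <= n%:R * h by rewrite mulr_ge0 ?ler0n.
  have : n%:R * h * k.+1%:R <= 1 - T.
    by rewrite -ler_pdivlMr ?ltr0n// mulrC -ler_pdivlMr.
  by move=> /(ler_step ik nh0) /andP[? ?]; lra.
have B2 : B (act (- c *: P) h (act (('X - 1) ^+ k.+1) h g) t)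
    (C2 * (e2 * m + C3 * w)).
  apply: HC2; first by rewrite addr_ge0 // mulr_ge0 // ltW.
  move=> i /ltnW is_; apply: HC3 => //; first by rewrite h0.
  move: hb1; rewrite /b1 ler_pdivlMr ?ltr0n// => hb1.
  by have /andP[? ?] := ler_step is_ h0 hb1; lra.
have C1m : 0 <= C1 * m by rewrite mulr_ge0.
have := gaugeZ gB c C1m B1 => {}B1.
apply: (gauge_le gB) (gaugeD gB _ _ B1 B2); last 2 first.
- by rewrite mulr_ge0 // (gauge_sg_ge0 gB).
- by rewrite mulr_ge0 // addr_ge0 // mulr_ge0 // ltW.
have sgc : sg c * (C1 * m) <= e1 * m.
  rewrite mulrA ler_wpM2r //; have := Ha1 _ c_small.
  rewrite ler_pdivlMr // => H; apply: le_trans H.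
  by rewrite ler_wpM2l ?(gauge_sg_ge0 gB) // lerDl.
have C2e : C2 * (e2 * m) <= e1 * m.
  rewrite mulrA ler_wpM2r // /e2 mulrA ler_pdivrMr // mulrC.
  by rewrite ler_wpM2l ?(ltW e10) // lerDl.
apply: (@le_trans _ _ (kappa * (e1 * m + e1 * m + C2 * (C3 * w)))).
  by rewrite ler_wpM2l ?(ltW kappa_gt0) //; lra.
rewrite (_ : kappa * _ = e * m + kappa * (C2 * C3) * w) // /e1; field.
by rewrite gt_eqF.
Qed.

End marchaud.
Arguments bounded_on01 {R V} B g m.
Arguments diff_bounded_on01 {R V} B r g w.

Section lagrange_basis.
Context {R : realType} (r : nat) (y : nat -> R).
Hypothesis y_inj : injective y.

Definition lagr (j : 'I_r) : {poly R} :=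
  \prod_(i < r | i != j) ((y j - y i)^-1 *: ('X - (y i)%:P)).

Lemma size_lagr j : (size (lagr j) <= r)%N.
Proof.
rewrite /lagr; apply: leq_trans (size_poly_prod_leq _ _) _.
rewrite (eq_bigr (fun=> 2%N)); last first.
  move=> i ij; rewrite size_scale ?size_XsubC// invr_eq0 subr_eq0.
  by rewrite (inj_eq y_inj) eq_sym.
rewrite sum_nat_const muln2 -addnn subSn ?leq_addr// addnK.
rewrite -[leqRHS]card_ord; apply: proper_card; apply/properP; split.
  exact/subset_predT.
by exists j => //; rewrite unfold_in /= eqxx.
Qed.

Lemma lagr_node (j : 'I_r) i : (i < r)%N -> (lagr j).[y i] = (i == j)%:R.
Proof.
move=> ir; rewrite /lagr horner_prod; have [->|ij] := eqVneq i j.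
  rewrite big1 // => k kj; rewrite !hornerE mulVf // subr_eq0.
  by rewrite (inj_eq y_inj) eq_sym.
by rewrite (bigD1 (Ordinal ir)) //= !hornerE subrr mulr0 mul0r.
Qed.

End lagrange_basis.

Lemma horner_bound01 {R : realType} (p : {poly R}) t : 0 <= t <= 1 ->
  `|p.[t]| <= \sum_(i < size p) `|p`_i|.
Proof.
move=> /andP[t0 t1]; rewrite horner_coef; apply: le_trans (ler_norm_sum _ _ _) _.
apply: ler_sum => i _; rewrite normrM ler_piMr // normrX (ger0_norm t0).
exact: exprn_ile1.
Qed.

Section whitney1.
Context {R : realType} {V : lmodType R} {B : V -> R -> Prop}.
Context {kappa : R} {sg : R -> R} (gB : gauge B kappa sg).

Let kappa_gt0 : 0 < kappa.
Proof. exact: lt_le_trans ltr01 (gauge_kappa gB). Qed.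

(** Reflection carries differences near 1, where forward steps have no room, to differences near
    0. *)
Lemma act_diff_reflect r h (g : R -> V) t :
  act (('X - 1) ^+ r) h (fun s => g (1 - s)) t =
  (-1) ^+ r *: act (('X - 1) ^+ r) h g (1 - t - r%:R * h).
Proof.
elim: r t => [|r IHr] t.
  by rewrite !expr0 -polyC1 !actC scale1r mul0r subr0.
rewrite (exprS ('X - 1)) !act_mul !act_XsubC1 !IHr exprS mulN1r scaleNr -scalerBr -scalerN opprB.
rewrite -addn1 natrD; congr (_ *: (act _ _ _ _ - act _ _ _ _)); ring.
Qed.

(** [marchaud] with [k = 1] handles base points up to 1/2; the other half of the interval follows by
    reflecting [g]. *)
Lemma modulus_small r : (0 < r)%N -> forall e : R, 0 < e ->
  exists2 a, 0 < a & exists2 C, 0 <= C & forall g (m w : R), 0 <= m -> 0 <= w ->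
    bounded_on01 B g m -> diff_bounded_on01 B r g w ->
    forall h t, 0 <= h <= a -> 0 <= t -> t + h <= 1 ->
    B (g (t + h) - g t) (e * m + C * w).
Proof.
move=> r0 e e0; set Sr := sg ((-1) ^+ r).
(* [S] pays for the change of sign in the reflected case, and [S >= 1] lets one constant serve both
   halves. *)
have [S S1 sgS] : exists2 S, 1 <= S & sg (-1) <= S.
  by exists (sg (-1) + 1); [rewrite lerDr (gauge_sg_ge0 gB) | rewrite lerDl].
have Sr0 : 0 <= Sr by exact: gauge_sg_ge0 gB _.
have S0 : 0 < S by lra.
have e'0 : 0 < e / S by rewrite divr_gt0.
have T01 : 0 <= (2^-1 : R) < 1 by lra.
have r1 : (0 < 1 <= r)%N by [].
have [a a0 [C C0 HC]] := marchaud gB r1 e'0 T01.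
exists a => //; exists (S * (C * (1 + Sr))); first by rewrite !mulr_ge0 ?addr_ge0 // ltW.
move=> g m w m0 w0 gm gw h t /andP[h0 ha] t0 th.
have eSm : 0 <= e / S * m by rewrite mulr_ge0 // ltW.
have Cw : 0 <= C * ((1 + Sr) * w) by rewrite !mulr_ge0 // addr_ge0.
have -> : e * m + S * (C * (1 + Sr)) * w = S * (e / S * m + C * ((1 + Sr) * w)).
  by field; rewrite gt_eqF.
have [t12|t12] := leP t 2^-1.
  have h0a : 0 <= h <= a by rewrite h0.
  have t0T : 0 <= t <= 2^-1 by rewrite t0.
  have := HC g m w m0 w0 gm gw h t h0a t0T; rewrite expr1 act_XsubC1.
  apply: (gauge_le gB); rewrite -[leLHS]mul1r ler_pM//.
    by rewrite addr_ge0 // mulr_ge0.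
  by rewrite lerD2l ler_wpM2l // ler_peMl // lerDl.
have gm' : bounded_on01 B (fun s => g (1 - s)) m by move=> s s01; apply: gm; lra.
have gw' : diff_bounded_on01 B r (fun s => g (1 - s)) (Sr * w).
  move=> s k k0 s0 sk; rewrite act_diff_reflect; apply: (gaugeZ gB) => //.
  by apply: gw => //; lra.
have h0a : 0 <= h <= a by rewrite h0.
have t0T : 0 <= 1 - t - h <= 2^-1 by lra.
have := HC _ m (Sr * w) m0 (mulr_ge0 Sr0 w0) gm' gw' h _ h0a t0T.
rewrite expr1 act_XsubC1 (_ : 1 - (1 - t - h + h) = t); last by ring.
rewrite (_ : 1 - (1 - t - h) = t + h); last by ring.
move=> /(gaugeZ gB (-1)); rewrite scaleN1r opprB.
have e1 : 0 <= e / S * m + C * (Sr * w) by rewrite addr_ge0 // !mulr_ge0.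
move=> /(_ e1); apply: (gauge_le gB); rewrite ler_pM // ?(gauge_sg_ge0 gB) //.
by rewrite lerD2l ler_wpM2l // ler_wpM2r // lerDr.
Qed.

(** As [('X - 1) ^+ r] is monic, the r-th difference expresses the value at a grid point through the
    [r] preceding ones; starting from [r] zeros, the bound spreads along the grid. *)
Lemma grid_bound r d N : 0 <= d ->
  exists2 D, 0 <= D & forall (g : R -> V) w, 0 <= w ->
    (forall j, (j < r)%N -> g (j%:R * d) = 0) -> diff_bounded_on01 B r g w ->
    forall k, (k < N)%N -> k%:R * d <= 1 -> B (g (k%:R * d)) (D * w).
Proof.
move=> d0; elim: N => [|N [D D0 IHN]]; first by exists 0.
pose q := ('X - 1) ^+ r - 'X^r : {poly R}.
have sq : (size q <= r)%N.
  have sq1 : (size q <= r.+1)%N.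
    apply: leq_trans (size_polyD _ _) _.
    by rewrite size_polyN size_polyXn size_XsubC1_exp maxnn.
  apply/leq_sizeP => i; rewrite leq_eqVlt => /predU1P[<-|ri]; last first.
    exact: (leq_sizeP _ _ sq1).
  have := monic_exp r (monicXsubC (1 : R)); rewrite polyC1.
  move=> /monicP; rewrite /lead_coef size_XsubC1_exp /= => cr.
  by rewrite coefB coefXn eqxx cr subrr.
have [C C0 HC] := gauge_act gB ((-1) *: q).
exists (Num.max D (kappa * (1 + C * D))); first by rewrite le_max D0.
move=> g w w0 g0 gw k; rewrite ltnS leq_eqVlt => /predU1P[->|kN] kd; last first.
  by apply: (gauge_le gB) (IHN g w w0 g0 gw k kN kd); rewrite ler_wpM2r // le_max lexx.
have [Nr|rN] := ltnP N r.
  rewrite g0 //; apply: (gauge_le gB) (gauge0 gB).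
  by rewrite mulr_ge0 // le_max D0.
have tE : (N - r)%:R * d + r%:R * d = N%:R * d by rewrite -mulrDl -natrD subnK.
have gE : g (N%:R * d) = act (('X - 1) ^+ r) d g ((N - r)%:R * d) +
    act (-1 *: q) d g ((N - r)%:R * d).
  rewrite -actD scaleN1r opprB addrC subrK -[X in act X]mul1r act_mulXn.
  by rewrite -polyC1 actC scale1r tE.
rewrite gE; have : kappa * (w + C * (D * w)) <= Num.max D (kappa * (1 + C * D)) * w.
  rewrite -[X in kappa * (X + _)]mul1r !mulrA -mulrDl mulrA.
  by rewrite ler_wpM2r // le_max lexx orbT.
move/(gauge_le gB); apply; apply: (gaugeD gB) => //.
- by rewrite !mulr_ge0.
- by apply: gw => //; rewrite ?mulr_ge0 // tE.
- apply: HC; first by rewrite mulr_ge0.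
  move=> i; rewrite size_scale ?oppr_eq0 ?oner_eq0 // => iq.
  have ir : (i < r)%N by exact: leq_trans sq.
  rewrite -mulrDl -natrD; apply: IHN => //.
    by rewrite -[ltnRHS](subnK rN) ltn_add2l.
  apply: le_trans kd; rewrite ler_wpM2r // ler_nat.
  by rewrite -[leqRHS](subnK rN) leq_add2l ltnW.
Qed.

(** Each application halves the a priori bound [m], while the terms [C * w] add up to at most
    [2 * C * w]. After enough steps [m / 2 ^+ N] is below [w], so [m] disappears from the bound. *)
Lemma halving_bound (g : R -> V) m w C : 0 < w -> 0 <= C ->
  (forall m, 0 <= m -> bounded_on01 B g m -> bounded_on01 B g (m / 2 + C * w)) ->
  0 <= m -> bounded_on01 B g m -> bounded_on01 B g ((2 * C + 1) * w).
Proof.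
move=> w0 C0 H m0 gm.
have Cw0 : 0 <= C * w by rewrite mulr_ge0 // ltW.
have HN N : bounded_on01 B g (m / 2 ^+ N + 2 * C * w).
  elim: N => [|N IHN].
    by move=> t t01; apply: (gauge_le gB) (gm t t01); rewrite expr0 divr1 lerDl -mulrA mulr_ge0.
  have m'0 : 0 <= m / 2 ^+ N + 2 * C * w by rewrite addr_ge0 // ?mulr_ge0 // ?invr_ge0 ?exprn_ge0 // ltW.
  have := H _ m'0 IHN; congr bounded_on01.
  rewrite exprS; field; by rewrite expf_neq0 // pnatr_eq0.
move=> t t01; pose N := (Num.truncn (m / w)).+1.
apply: (gauge_le gB) (HN N t t01); suff : m / 2 ^+ N <= w by lra.
rewrite ler_pdivrMr ?exprn_gt0// mulrC -ler_pdivrMr//.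
apply: (le_trans (ltW (truncnS_gt _))); rewrite -natrX ler_nat.
by apply: ltnW; apply: ltn_expl.
Qed.

(** The remainder [g'] of the interpolation has the r-th differences of [g] and vanishes at the
    nodes. [grid_bound] controls it on a grid, and [modulus_small] between grid points, up to half
    of any bound already known; [halving_bound] removes that half. *)
Lemma whitney1 r : (0 < r)%N ->
  exists (y : 'I_r -> R) (l : 'I_r -> {poly R}) (C : R),
  [/\ forall j, 0 <= y j <= 1, forall j, (size (l j) <= r)%N, 0 <= C &
  forall g (m w : R), 0 <= m -> 0 < w ->
    bounded_on01 B g m -> diff_bounded_on01 B r g w ->
    forall t, 0 <= t <= 1 ->
    B (g t - \sum_j (l j).[t] *: g (y j)) (C * w)].
Proof.
move=> r0; have e0 : 0 < 1 / (2 * kappa) by rewrite divr_gt0 // mulr_gt0.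
have [a a0 [C C0 HC]] := modulus_small r0 e0.
(* The mesh [1 / n <= a] makes the step from the grid point left of [t] admissible; [n >= r] keeps
   the nodes [j / n] in the unit interval. *)
pose n := maxn r (Num.truncn a^-1).+1.
have n0 : (0 < n)%N by rewrite leq_max r0.
have n0R : 0 < n%:R :> R by rewrite ltr0n.
pose d := n%:R^-1 : R.
have d0 : 0 < d by rewrite invr_gt0.
have da : d <= a.
  rewrite /d invf_ple ?posrE//; apply: (le_trans (ltW (truncnS_gt _))).
  by rewrite ler_nat leq_maxr.
pose y (j : nat) : R := j%:R * d.
have y_inj : injective y.
  by move=> i j /(mulIf (lt0r_neq0 d0)) /eqP; rewrite eqr_nat => /eqP.
have y01 j : (j <= n)%N -> 0 <= y j <= 1.
  move=> jn; rewrite /y mulr_ge0 ?(ltW d0) //=.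
  by rewrite ler_pdivrMr // mul1r ler_nat.
have rn : (r <= n)%N by rewrite leq_maxl.
have [D D0 HD] := grid_bound r n.+1 (ltW d0).
pose l := lagr y (r := r).
exists (fun j => y j), l, (2 * (kappa * (D + C)) + 1); split.
- by move=> j; apply: y01; apply: leq_trans rn; exact: ltnW.
- by move=> j; exact: size_lagr.
- by rewrite addr_ge0 // !mulr_ge0 ?addr_ge0 // ltW.
move=> g m w m0 w0 gm gw.
set g' := fun t => g t - \sum_j (l j).[t] *: g (y j).
have gw' : diff_bounded_on01 B r g' w.
  move=> t h h0 t0 th; rewrite act_funB act_fun_sum big1 ?subr0; first exact: gw.
  by move=> j _; rewrite act_diff_poly // size_lagr.
have g'0 j : (j < r)%N -> g' (j%:R * d) = 0.
  move=> jr; rewrite /g' (bigD1 (Ordinal jr)) //= big1 ?addr0.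
    by rewrite (lagr_node y_inj _ jr) eqxx scale1r subrr.
  move=> i ij; rewrite (lagr_node y_inj _ jr) (_ : (j == i) = false) ?scale0r//.
  by apply/negbTE; rewrite eq_sym.
pose b := \sum_j \sum_(i < size (l j)) `|(l j)`_i|.
have b0 : 0 <= b by apply: sumr_ge0 => j _; apply: sumr_ge0.
have lb t j : 0 <= t <= 1 -> `| - (l j).[t] | <= `|b|.
  move=> t01; rewrite normrN (ger0_norm b0); apply: le_trans (horner_bound01 _ t01) _.
  by rewrite /b (bigD1 j) //= lerDl; apply: sumr_ge0 => i _; apply: sumr_ge0.
have [C' C'0 HC'] := gauge_comb gB r b.
(* This bound depends on [m], but only its existence matters for [halving_bound]. *)
have g'm : bounded_on01 B g' (kappa * (m + C' * m)).
  move=> t t01; apply: (gaugeD gB) => //; [by rewrite mulr_ge0 | exact: gm|].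
  rewrite -sumrN; under eq_bigr do rewrite -scaleNr.
  apply: HC' => //; first by rewrite size_index_enum card_ord.
    by move=> j; exact: lb.
  by move=> j; apply: gm; apply: y01; apply: leq_trans rn; exact: ltnW.
have m'0 : 0 <= kappa * (m + C' * m) by rewrite mulr_ge0 ?(ltW kappa_gt0) // addr_ge0 // mulr_ge0.
apply: (halving_bound w0) m'0 g'm; first by rewrite mulr_ge0 ?addr_ge0 // ltW.
move=> {C' C'0 HC' gm b b0 lb} {}m {}m0 gm t /andP[t0 t1].
pose k := Num.truncn (t * n%:R).
have tn0 : 0 <= t * n%:R by rewrite mulr_ge0.
have kt : y k <= t by rewrite ler_pdivrMr // truncn_le.
have tk : t <= y k + d.
  by rewrite -[X in _ + X]mul1r -mulrDl ler_pdivlMr // natr1 ltW // truncnS_gt.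
have kn : (k <= n)%N by rewrite -(ler_nat R) (le_trans (y := t * n%:R)) // ?truncn_le// ler_piMl// ltW.
have -> : g' t = g' (y k) + (g' (y k + (t - y k)) - g' (y k)).
  by rewrite addrC subrK; congr g'; ring.
have B1 := HD g' w (ltW w0) g'0 gw' k kn (proj2 (andP (y01 k kn))).
have h0a : 0 <= t - y k <= a by lra.
have yk0 : 0 <= y k by case/andP: (y01 k kn).
have th : y k + (t - y k) <= 1 by lra.
have B2 := HC g' m w m0 (ltW w0) gm gw' (t - y k) (y k) h0a yk0 th.
apply: (gauge_le gB) (gaugeD gB _ _ B1 B2).
- by rewrite le_eqVlt; apply/orP; left; apply/eqP; field; rewrite gt_eqF.
- by rewrite mulr_ge0 // ltW.
- by rewrite addr_ge0 // mulr_ge0 // ltW.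
Qed.

End whitney1.

(** * Whitney approximation on the cube *)

Section whitney_cube.
Context {R : realType} {d : nat} {V : lmodType R} {B : V -> R -> Prop}.
Context {kappa : R} {sg : R -> R} (gB : gauge B kappa sg).
Implicit Types (t x : 'rV[R]_d) (k : 'I_d) (s : R) (r n : nat).

Definition in_cube t := forall k, 0 <= t 0 k <= 1.

(** Written as a translation along an axis, so that a change of basis turns slices of the cube into
    lines parallel to a basis vector. *)
Definition set_coord x k s : 'rV[R]_d := x + (s - x 0 k) *: delta_mx 0 k.

Lemma set_coordE x k s (j : 'I_d) :
  set_coord x k s 0 j = if j == k then s else x 0 j.
Proof.
rewrite /set_coord !mxE eqxx /=; case: eqVneq => [->|_].
  by rewrite mulr1 addrC subrK.
by rewrite mulr0 addr0.
Qed.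

Lemma set_coord_id x k : set_coord x k (x 0 k) = x.
Proof. by rewrite /set_coord subrr scale0r addr0. Qed.

Lemma set_coord_in_cube x k s : in_cube x -> 0 <= s <= 1 ->
  in_cube (set_coord x k s).
Proof. by move=> x01 s01 j; rewrite set_coordE; case: eqP. Qed.

Definition coord_poly r (l : 'rV[R]_d -> R) := forall x k,
  exists2 q : {poly R}, (size q <= r)%N & forall s, l (x + s *: delta_mx 0 k) = q.[s].

(* [p i x] is [x] with its first [n] coordinates replaced by nodes. *)
Record partial_interp r n (I : finType) (l : I -> 'rV[R]_d -> R)
    (p : I -> 'rV[R]_d -> 'rV[R]_d) (C : R) : Prop := PartialInterp {
  pi_cube : forall i x, in_cube x -> in_cube (p i x) ;
  pi_lt : forall i x k, (k < n)%N -> p i x 0 k = p i 0 0 k ;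
  pi_ge : forall i x k, (n <= k)%N -> p i x 0 k = x 0 k ;
  pi_cont : forall i, continuous (l i) ;
  pi_poly : forall i, coord_poly r (l i) ;
  pi_indep : forall i x k s, (n <= k)%N -> l i (x + s *: delta_mx 0 k) = l i x ;
  pi_bounded : exists b : R, forall i x, in_cube x -> `|l i x| <= b ;
  pi_C : 0 <= C ;
  pi_approx : forall (F : 'rV[R]_d -> V) (m w : R), 0 <= m -> 0 < w ->
    (forall x, in_cube x -> B (F x) m) ->
    (forall x k, in_cube x -> diff_bounded_on01 B r (fun s => F (set_coord x k s)) w) ->
    forall x, in_cube x -> B (F x - \sum_i l i x *: F (p i x)) (C * w) }.

(** Each value [F (p i x)] is interpolated once more, in coordinate [n]. The index type becomes a
    product, and the new error is the old one plus a bounded combination of one-variable errors. *)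
Lemma partial_interp_step r n I l p C : (0 < r)%N -> (n < d)%N ->
  @partial_interp r n I l p C ->
  exists I' l' p' C', @partial_interp r n.+1 I' l' p' C'.
Proof.
move=> r0 nd H.
have [y [q [C1 [y01 sq C10 HC1]]]] := whitney1 gB r0.
pose k := Ordinal nd; have [b Hb] := pi_bounded H.
have [C2 C20 HC2] := gauge_comb gB #|I| b.
have kappa0 : 0 < kappa by apply: lt_le_trans ltr01 (gauge_kappa gB).
have C'0 : 0 <= kappa * (C + C2 * C1).
  by rewrite mulr_ge0 ?(ltW kappa0) // addr_ge0 ?(pi_C H)// mulr_ge0.
exists (I * 'I_r)%type, (fun i x => l i.1 x * (q i.2).[x 0 k]),
  (fun i x => set_coord (p i.1 x) k (y i.2)), (kappa * (C + C2 * C1)); split => //.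
- by move=> [i j] x x01 /=; apply: set_coord_in_cube => //; exact: pi_cube H _ _ x01.
- move=> [i j] x a; rewrite ltnS leq_eqVlt !set_coordE => /orP[/eqP an|an] /=.
    by rewrite (_ : a == k) //; apply/eqP/val_inj.
  by case: eqP => // _; exact: pi_lt H _ _ _ an.
- move=> [i j] x a na /=; rewrite set_coordE (_ : a == k = false).
    by apply: pi_ge H _ _ _ _; exact: ltnW.
  by apply/negbTE/eqP => ak; move: na; rewrite ak /= ltnn.
- move=> [i j] x /=; apply: (@continuousM _ _ (l i) (fun x => (q j).[x 0 k])).
    exact: (pi_cont H).
  apply: (@continuous_comp _ _ _ (fun x => x 0 k) (horner (q j))).
    exact: coord_continuous.
  exact: continuous_horner.
- move=> [i j] x a /=; have [Q sQ HQ] := pi_poly H i x a.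
  have [ak|ak] := eqVneq a k.
    exists (l i x *: (q j \Po ('X + (x 0 k)%:P))).
      apply: leq_trans (size_scale_leq _ _) _.
      by rewrite size_comp_poly2 ?sq// size_XaddC.
    move=> s; rewrite (pi_indep H) ?ak//.
    rewrite hornerZ horner_comp !hornerE; congr (_ * (q j).[_]).
    by rewrite !mxE !eqxx mulr1 addrC.
  exists ((q j).[x 0 k] *: Q); first exact: leq_trans (size_scale_leq _ _) _.
  move=> s; rewrite HQ hornerZ mulrC; congr ((q j).[_] * _).
  by rewrite !mxE eq_sym (negbTE ak) andbF mulr0 addr0.
- move=> [i j] x a s na /=; rewrite (pi_indep H) ?(ltnW na) //.
  congr (_ * (q j).[_]); rewrite !mxE (_ : k == a = false) ?andbF ?mulr0 ?addr0//.
  by apply/negbTE/eqP => ak; move: na; rewrite -ak /= ltnn.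
- exists (b * \sum_j \sum_(i < size (q j)) `|(q j)`_i|) => -[i j] x x01 /=.
  rewrite normrM ler_pM //; first exact: Hb.
  apply: le_trans (horner_bound01 _ (x01 k)) _.
  by rewrite (bigD1 j) //= lerDl; apply: sumr_ge0 => ? _; apply: sumr_ge0.
- move=> F m w m0 w0 Fm Fw x x01.
  rewrite -(pair_bigA _ (fun i j => (l i x * (q j).[x 0 k]) *: F (set_coord (p i x) k (y j)))) /=.
  have -> : F x - \sum_i \sum_j (l i x * (q j).[x 0 k]) *: F (set_coord (p i x) k (y j)) =
    (F x - \sum_i l i x *: F (p i x)) +
    \sum_i l i x *: (F (p i x) - \sum_j (q j).[x 0 k] *: F (set_coord (p i x) k (y j))).
    under [X in _ = _ + X]eq_bigr do rewrite scalerBr.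
    rewrite sumrB addrA subrK; congr (_ - _); apply: eq_bigr => i _.
    by rewrite scaler_sumr; apply: eq_bigr => j _; rewrite scalerA.
  have C1w : 0 <= C1 * w by rewrite mulr_ge0 // ltW.
  have B1 := pi_approx H m0 w0 Fm Fw x01.
  have -> : kappa * (C + C2 * C1) * w = kappa * (C * w + C2 * (C1 * w)) by ring.
  apply: (gaugeD gB) B1 _ => //.
  + by rewrite mulr_ge0 ?(pi_C H) // ltW.
  + by rewrite mulr_ge0.
  apply: HC2 => //; first by rewrite size_index_enum.
    by move=> i; apply: le_trans (Hb i x x01) _; exact: ler_norm.
  move=> i; have pi01 := pi_cube H i x01.
  have := HC1 (fun s => F (set_coord (p i x) k s)) m w m0 w0.
  (* Coordinate [k] has not been replaced yet, so [F (p i x)] is the value of the slice at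
     [x 0 k]. *)
  have xk : p i x 0 k = x 0 k by exact: pi_ge H _ _ _ _.
  move=> /(_ _ (Fw _ k pi01) _ (x01 k)); rewrite -{1}xk set_coord_id; apply.
  by move=> s s01; apply: Fm; exact: set_coord_in_cube.
Qed.

(** After [d] steps every coordinate of [p i x] is a node, so the sample points no longer depend on
    [x] and may be read off at [x = 0]. *)
Lemma whitney_cube r : (0 < r)%N ->
  exists (I : finType) (l : I -> 'rV[R]_d -> R) (u : I -> 'rV[R]_d) (C : R),
  [/\ forall i, in_cube (u i), forall i, continuous (l i),
      forall i, coord_poly r (l i), 0 <= C &
      forall (F : 'rV[R]_d -> V) (m w : R), 0 <= m -> 0 < w ->
      (forall x, in_cube x -> B (F x) m) ->
      (forall x k, in_cube x ->
        diff_bounded_on01 B r (fun s => F (set_coord x k s)) w) ->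
      forall x, in_cube x -> B (F x - \sum_i l i x *: F (u i)) (C * w)].
Proof.
move=> r0.
have : forall n, (n <= d)%N -> exists I l p C, @partial_interp r n I l p C.
  elim=> [_|n IHn nd]; last first.
    have [I [l [p [C H]]]] := IHn (ltnW nd).
    exact: partial_interp_step r0 nd H.
  exists unit, (fun _ _ => 1), (fun _ x => x), 0; split => //.
  - by move=> i x; exact: cst_continuous.
  - by move=> i x k; exists 1 => [|s]; [rewrite size_poly1 | rewrite hornerC].
  - by exists 1 => i x _; rewrite normr1.
  - move=> F m w m0 w0 _ _ x _; rewrite (big_pred1 tt) ?scale1r ?subrr ?mul0r; last by case.
    exact: gauge0 gB.
move=> /(_ d (leqnn d)) [I [l [p [C H]]]].
exists I, l, (p^~ 0), C; split; [|exact: pi_cont H|exact: pi_poly H|exact: pi_C H|].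
  by move=> i; apply: pi_cube H i _ _ => k; rewrite mxE lexx ler01.
move=> F m w m0 w0 Fm Fw x x01.
have := pi_approx H m0 w0 Fm Fw x01; congr (B (_ - _) _).
apply: eq_bigr => i _; congr (_ *: F _); apply/rowP => k.
exact: pi_lt H _ _ _ _.
Qed.

End whitney_cube.

(** * Lebesgue measure on row vectors *)

Section sup_norm.
Context {R : realType} {n : nat}.
Implicit Types x y : 'rV[R]_n.

Lemma normrV_le x (e : R) : 0 <= e -> (forall i, `|x 0 i| <= e) -> `|x| <= e.
Proof.
move=> e0 xe; rewrite [leLHS]mx_normrE.
by apply/bigmax_leP; split => // -[i j] _ /=; rewrite ord1.
Qed.

Lemma coord_le_normrV x i : `|x 0 i| <= `|x|.
Proof.
rewrite [leRHS]mx_normrE; exact: (le_bigmax _ (fun ij => `|x ij.1 ij.2|) (0, i)).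
Qed.

Lemma normrV_lt x (e : R) : 0 < e -> (forall i, `|x 0 i| < e) -> `|x| < e.
Proof.
move=> e0 xe; rewrite [ltLHS]mx_normrE.
by apply/bigmax_ltP; split => // -[i j] _ /=; rewrite ord1.
Qed.

Lemma ballrVE x (e : R) y : ball x e y = (`|x - y| < e) :> Prop.
Proof. by rewrite -ball_normE. Qed.

Lemma nbhs_rVP x (A : set 'rV[R]_n) :
  nbhs x A <-> exists2 e : R, 0 < e & forall y, `|x - y| < e -> A y.
Proof.
split=> [/nbhs_ballP[e e0 H]|[e e0 H]].
  by exists e => // y xy; apply: H; rewrite ballrVE.
by apply/nbhs_ballP; exists e => // y; rewrite ballrVE; exact: H.
Qed.

End sup_norm.

Section borel_rV.
Context {R : realType} {n : nat}.

Lemma measurable_box (c : 'I_n -> R) (e : R) :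
  measurable [set y : 'rV[R]_n | forall i, `|c i - y 0 i| < e].
Proof.
rewrite (_ : mkset _ = \bigcap_(i in setT) ((@coord_rV R n i) @^-1` (ball (c i) e))).
  apply: fin_bigcap_measurable => // i _; rewrite -[X in measurable X]setTI.
  by apply: measurable_coord_rV => //; exact: measurable_ball.
by apply/seteqP; split=> y /= H i => [_|]; exact: H.
Qed.

(** The measurable sets are generated by the coordinates, so an open set is written as the countable
    union of the rational boxes that it contains. *)
Lemma measurable_open_rV (O : set 'rV[R]_n) : open O -> measurable O.
Proof.
move=> oO.
pose box (qk : 'rV[rat]_n * nat) := [set y : 'rV[R]_n |
  forall i, `|ratr (qk.1 0 i) - y 0 i| < qk.2.+1%:R^-1].
rewrite (_ : O = \bigcup_qk (if `[< box qk `<=` O >] then box qk else set0)).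
  apply: countable_bigcupT_measurable => // qk; case: ifP => _ //.
  exact: measurable_box.
apply/seteqP; split=> [x Ox|x [qk _]]; last by case: ifPn => // /asboolP; exact.
have /nbhs_rVP[e e0 eO] : nbhs x O by exact: open_nbhs_nbhs.
pose k := Num.truncn (2 / e).
have ke : k.+1%:R^-1 < e / 2.
  rewrite -[ltRHS]invf_div invf_plt ?posrE ?ltr0n ?invr_gt0 ?divr_gt0//.
  rewrite invrK; exact: truncnS_gt.
have k0 : 0 < k.+1%:R^-1 :> R by rewrite invr_gt0.
have rat_near (i : 'I_n) : {q : rat | `|ratr q - x 0 i| < k.+1%:R^-1}.
  apply: cid; have [|q] := @rat_in_itvoo R (x 0 i) (x 0 i + k.+1%:R^-1).
    by rewrite ltrDl.
  by rewrite in_itv /= => /andP[q1 q2]; exists q; rewrite ltr_norml ltrBlDl q2 andbT (lt_trans (y := 0)) ?subr_gt0// oppr_lt0.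
have [q qx] : exists q : 'rV[rat]_n, forall i, `|ratr (q 0 i) - x 0 i| < k.+1%:R^-1.
  by exists (\row_i projT1 (rat_near i)) => i; rewrite mxE; case: (rat_near i).
exists (q, k) => //; rewrite ifT; first exact: qx.
apply/asboolP => y /= qy; apply: eO; apply: normrV_lt => // i; rewrite !mxE.
have -> : x 0 i - y 0 i = (ratr (q 0 i) - y 0 i) - (ratr (q 0 i) - x 0 i) by ring.
apply: le_lt_trans (ler_normB _ _) _; rewrite (splitr e) ltrD ?(lt_trans _ ke)//.
Qed.

Lemma measurable_closed_rV (A : set 'rV[R]_n) : closed A -> measurable A.
Proof.
move=> cA; rewrite -[A]setCK; apply: measurableC; apply: measurable_open_rV.
exact: closed_openC.
Qed.

Lemma continuous_measurable_rV (f : 'rV[R]_n -> R) :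
  continuous f -> measurable_fun setT f.
Proof.
move=> /continuousP cf; apply: (measurability _ (RGenOpens.measurableE R)).
move=> _ [_ [a [b -> <-]]]; rewrite setTI; apply: measurable_open_rV.
exact/cf/interval_open.
Qed.

Lemma measurable_translation (h : 'rV[R]_n) :
  measurable_fun setT (fun x : 'rV[R]_n => x + h).
Proof.
apply: measurable_fun_rVP => i.
rewrite (_ : _ \o _ = (fun x => x + h 0 i : measurableTypeR R) \o @coord_rV R n i).
  by apply: measurableT_comp; [exact: measurable_funD|exact: measurable_coord_rV].
by apply/funext => x; rewrite /= /coord_rV mxE.
Qed.

Lemma measurable_addrV :
  measurable_fun setT (fun z : 'rV[R]_n * 'rV[R]_n => z.1 + z.2).
Proof.
apply: measurable_fun_rVP => i.
rewrite (_ : _ \o _ = (fun z => (@coord_rV R n i z.1 + @coord_rV R n i z.2 : measurableTypeR R))).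
  by apply: measurable_funD; apply: measurableT_comp => //; exact: measurable_coord_rV.
by apply/funext => x; rewrite /= /coord_rV mxE.
Qed.

End borel_rV.

(** * Translation invariance and volumes of balls *)

Section translation_invariance.
Context {R : realType}.

Let measurable_shift (h : R) :
  measurable_fun setT ((fun x => x + h) : measurableTypeR R -> measurableTypeR R).
Proof. exact: measurable_funD. Qed.

(** The translated measure agrees with Lebesgue measure on half-open intervals, and these determine
    it. *)
Lemma lebesgue_measure_translation (h : R) (A : set (measurableTypeR R)) :
  measurable A ->
  lebesgue_measure ((fun x => x + h) @^-1` A) = lebesgue_measure A.
Proof.
move=> mA; pose m := @measure_function_pushforward__canonical__measure_function_Measure
  _ _ _ _ _ (@lebesgue_measure R) _ (measurable_shift h).
symmetry; apply: (@lebesgue_measure_unique R m) mA.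
move=> _ [[a b] _ <-]; rewrite /m /= /pushforward.
rewrite (_ : _ @^-1` _ = `](a - h), (b - h)]%classic); last first.
  by apply/seteqP; split=> x /=; rewrite !in_itv /= ltrBlDr lerBrDr.
by rewrite !lebesgue_measure_itv /= !lte_fin ltrD2r -!EFinD opprB addrA subrK.
Qed.

Lemma cons_rVD n (p q : measurableTypeR R * 'rV[R]_n) :
  cons_rV p + cons_rV q = cons_rV (p.1 + q.1, p.2 + q.2).
Proof.
apply/rowP => i; rewrite mxE /cons_rV; case: (@split_ordP 1 n i) => j ->.
  by rewrite !(@row_mxEl R 1 1 n) !mxE.
by rewrite !(@row_mxEr R 1 1 n) !mxE.
Qed.

Lemma uncons_rVK n : cancel (@uncons_rV R n) (@cons_rV R n).
Proof.
move=> v; apply/rowP => i; rewrite /cons_rV /uncons_rV /=.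
case: (@split_ordP 1 n i) => j ->; last by rewrite (@row_mxEr R 1 1 n) mxE.
by rewrite (@row_mxEl R 1 1 n) mxE ord1; congr (v _ _); apply/val_inj.
Qed.

(** By induction on the dimension: through [cons_rV] the translation is a product of two
    translations, and a product measure is determined by its values on rectangles. *)
Lemma lebesgue_rV_translation n (h : 'rV[R]_n) (A : set 'rV[R]_n) :
  measurable A -> lebesgue_rV n ((fun x => x + h) @^-1` A) = lebesgue_rV n A.
Proof.
elim: n h A => [|n IHn] h A mA.
  by congr (lebesgue_rV 0 _); apply/seteqP; split => x /=; rewrite [x + h]thinmx0 [x]thinmx0.
pose T : measurableTypeR R * 'rV[R]_n -> measurableTypeR R * 'rV[R]_n :=
  fun p => (p.1 + (uncons_rV h).1, p.2 + (uncons_rV h).2).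
have TE p : cons_rV (T p) = cons_rV p + h.
  by rewrite -[h in RHS]uncons_rVK cons_rVD.
have mT : measurable_fun setT T.
  apply/measurable_fun_pairP; split.
    rewrite (_ : _ \o _ = (fun x => x + (uncons_rV h).1) \o fst)//.
    by apply: measurableT_comp; [exact: measurable_shift|exact: measurable_fst].
  rewrite (_ : _ \o _ = (fun x => x + (uncons_rV h).2) \o snd)//.
  by apply: measurableT_comp; [exact: measurable_translation|exact: measurable_snd].
pose m := @measure_function_pushforward__canonical__measure_function_Measure
  _ _ _ _ _ (@lebesgue_measure R \x @lebesgue_rV R n)%E _ mT.
rewrite /= /pushforward.
have mcA : measurable (@cons_rV R n @^-1` A).
  by rewrite -[X in measurable X]setTI; exact: measurable_cons_rV.
have -> : @cons_rV R n @^-1` ((fun x => x + h) @^-1` A) = T @^-1` (@cons_rV R n @^-1` A).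
  by apply/seteqP; split=> p /=; rewrite TE.
symmetry; apply: (@product_measure_unique _ _ _ _ _ (@lebesgue_measure R)
  (@lebesgue_rV R n) m) => // X Y mX mY.
rewrite /m /= /pushforward.
rewrite (_ : T @^-1` _ = ((fun x => x + (uncons_rV h).1) @^-1` X) `*`
                        ((fun x => x + (uncons_rV h).2) @^-1` Y))//.
rewrite product_measure1E.
- by congr (_ * _)%E; [exact: lebesgue_measure_translation | exact: IHn].
- by rewrite -[X in measurable X]setTI; exact: measurable_shift.
- by rewrite -[X in measurable X]setTI; exact: measurable_translation.
Qed.

Lemma lebesgue_rV_box n (c : 'I_n -> R) (e : R) : 0 < e ->
  (0 < lebesgue_rV n [set y | forall i, `|c i - y 0 i| < e]%R < +oo)%E.
Proof.
move=> e0; elim: n c => [|n IHn] c.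
  by rewrite /= diracE mem_set ?lte01 ?ltry//= => -[].
pose c' (i : 'I_n) := c (rshift 1 i : 'I_(1 + n)).
rewrite /= /pushforward.
rewrite (_ : _ @^-1` _ = (ball (c 0) e : set (measurableTypeR R)) `*`
    [set y : 'rV_n | forall i, `|c' i - y 0 i| < e]); last first.
  apply/seteqP; split=> -[x v] /=.
    move=> H; split.
      have := H 0; rewrite (_ : cons_rV (x, v) 0 0 = x)//.
      by rewrite -[LHS]/((uncons_rV (cons_rV (x, v))).1) cons_rVK.
    by move=> i; have := H (rshift 1 i : 'I_(1 + n)); rewrite /cons_rV (@row_mxEr R 1 1 n).
  move=> [cx cv] i; case: (@split_ordP 1 n i) => j ->.
    by rewrite /cons_rV (@row_mxEl R 1 1 n) mxE ord1 /= (_ : lshift n 0 = 0)//; apply/val_inj.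
  by rewrite /cons_rV (@row_mxEr R 1 1 n); exact: cv.
have /andP[p0 pp] := IHn c'.
have mb : measurable (ball (c 0) e : set (measurableTypeR R)) by exact: measurable_ball.
have mbox : measurable [set y : 'rV_n | forall i, `|c' i - y 0 i| < e].
  exact: measurable_box.
rewrite product_measure1E //; set a := (X in (X * _)%E).
have -> : a = (e *+ 2)%:E by exact: (lebesgue_measure_ball (c 0) (ltW e0)).
by rewrite mule_gt0 ?lte_fin ?mulrn_wgt0//= lte_mul_pinfty // lee_fin mulrn_wge0 // ltW.
Qed.

Lemma lebesgue_rV_ball n (c : 'rV[R]_n) (e : R) : 0 < e ->
  (0 < lebesgue_rV n [set y | `|c - y| < e]%R < +oo)%E.
Proof.
move=> e0; rewrite (_ : [set y | `|c - y| < e] = [set y | forall i, `|c 0 i - y 0 i| < e]).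
  exact: lebesgue_rV_box.
apply/seteqP; split => y /= H; last by apply: normrV_lt => // i; rewrite !mxE.
by move=> i; apply: le_lt_trans H; have := coord_le_normrV (c - y) i; rewrite !mxE.
Qed.

Lemma measurable_ballrV n (c : 'rV[R]_n) (e : R) :
  measurable [set y | `|c - y|%R < e].
Proof.
apply: measurable_open_rV; have := @ball_open R 'rV[R]_n c e.
by congr open; apply/seteqP; split => y /=; rewrite ballrVE.
Qed.

Lemma integral_translation n (h : 'rV[R]_n) (A : set 'rV[R]_n) (f : 'rV[R]_n -> \bar R) :
  measurable A -> measurable_fun A f -> (forall x, A x -> 0 <= f x)%E ->
  (\int[lebesgue_rV n]_(x in A) f x =
   \int[lebesgue_rV n]_(x in (fun y => (y + h)%R) @^-1` A) f (x + h)%R)%E.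
Proof.
move=> mA mf f0.
pose m := @measure_function_pushforward__canonical__measure_function_Measure
  _ _ _ _ _ (@lebesgue_rV R n) _ (measurable_translation h).
transitivity (\int[m]_(x in A) f x)%E.
  apply: eq_measure_integral => X mX _.
  by rewrite /m /= /pushforward lebesgue_rV_translation.
rewrite /m /= ge0_integral_pushforward // => [|y]; first exact: measurable_translation.
by rewrite inE; exact: f0.
Qed.

End translation_invariance.

(** * Bounds in Lp *)

Section Lp_bound.
Context {R : realType} {d : nat}.
Implicit Types (A K U : set 'rV[R]_d) (f g : 'rV[R]_d -> R) (p : \bar R) (m : R).

(* For finite [p], [m] bounds the integral of |f|^p and not its p-th root. *)
Definition Lp_bound p A f m : Prop :=
  if p == +oo%E then forall x, A x -> `|f x| <= m
  else [/\ measurable A, measurable_fun A f &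
    (\int[lebesgue_rV d]_(x in A) (`|f x| `^ fine p)%:E <= m%:E)%E].

Lemma measurable_pow (q : R) d1 (T : measurableType d1) (A : set T) (f : T -> R) :
  measurable_fun A f -> measurable_fun A (fun x => (`|f x| `^ q)%:E).
Proof.
move=> mf; apply/measurable_EFinP.
apply: (measurableT_comp (measurable_powR q)).
exact: (measurableT_comp (@normr_measurable R setT)).
Qed.

Lemma pow_ge0 (q a : R) : (0 <= (`|a| `^ q)%:E)%E.
Proof. by rewrite lee_fin powR_ge0. Qed.

Lemma Lp_bound_le p A f m n : m <= n -> Lp_bound p A f m -> Lp_bound p A f n.
Proof.
rewrite /Lp_bound => mn; case: ifP => _; first by move=> H x /H /le_trans; exact.
by move=> [mA mf If]; split => //; apply: (le_trans If); rewrite lee_fin.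
Qed.

Lemma Lp_bound_sub p A A' f m : measurable A' -> A' `<=` A ->
  Lp_bound p A f m -> Lp_bound p A' f m.
Proof.
rewrite /Lp_bound => mA' A'A; case: ifP => _; first by move=> H x /A'A /H.
move=> [mA mf If]; split => //; first exact: measurable_funS mf.
apply: le_trans If; apply: ge0_subset_integral => //; exact: measurable_pow.
Qed.

Lemma Lp_bound_setU p A A' f m m' : 0 <= m -> 0 <= m' ->
  Lp_bound p A f m -> Lp_bound p A' f m' -> Lp_bound p (A `|` A') f (m + m').
Proof.
rewrite /Lp_bound => m0 m'0; case: ifP => _.
  move=> H H' x [/H|/H'] /le_trans; apply; lra.
move=> [mA mf If] [mA' mf' If'].
have mAA' : measurable_fun (A `|` A') f by apply/measurable_funU.
split => //; first exact: measurableU.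
have -> : A `|` A' = A `|` (A' `\` A) by rewrite setUDr setDv setD0 ?setUT.
rewrite ge0_integral_setU //.
- rewrite EFinD; apply: leeD => //; apply: le_trans If'.
  apply: ge0_subset_integral => //; [exact: measurableD|exact: measurable_pow].
- exact: measurableD.
- by apply: measurable_pow; apply: measurable_funS mAA' => //; [exact: measurableU|move=> x [|[]]; [left|right]].
- by rewrite disj_set2E; apply/eqP; rewrite setDIK.
Qed.

Lemma eq_Lp_bound p A f g m : (forall x, A x -> f x = g x) ->
  Lp_bound p A f m -> Lp_bound p A g m.
Proof.
rewrite /Lp_bound => fg; case: ifP => _; first by move=> H x Ax; rewrite -fg // H.
move=> [mA mf If]; split => //.
  by apply: eq_measurable_fun mf => x; rewrite inE; exact: fg.
by rewrite (eq_integral (fun x => (`|f x| `^ fine p)%:E)) // => x; rewrite inE => /fg ->.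
Qed.

Lemma Lp_bound_translation p A A' f m (h : 'rV[R]_d) : measurable A ->
  (forall x, A x -> A' (x + h)) -> Lp_bound p A' f m ->
  Lp_bound p A (fun x => f (x + h)) m.
Proof.
rewrite /Lp_bound => mA AA'; case: ifP => _; first by move=> H x /AA' /H.
move=> [mA' mf If]; split => //.
  apply: (@measurable_comp _ _ _ _ _ _ A' f A (fun x => x + h)) => //.
  - by move=> _ [x Ax <-]; exact: AA'.
  - by apply: measurable_funTS; exact: measurable_translation.
apply: le_trans If; set F := fun x => (`|f x| `^ fine p)%:E.
have mF : measurable_fun A' F by exact: measurable_pow.
rewrite [leRHS](integral_translation h) //.
apply: ge0_subset_integral => //.
- by rewrite -[X in measurable X]setTI; exact: measurable_translation.
- apply: measurable_pow; apply: (@measurable_comp _ _ _ _ _ _ A' f ((fun y : 'rV[R]_d => y + h) @^-1` A') (fun x => x + h)) => //.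
    by move=> _ [x Ax <-].
  by apply: measurable_funTS; exact: measurable_translation.
Qed.

(** For finite [p] additivity rests on [(a + b) ^ q <= (2 max(a, b)) ^ q <= 2 ^ q (a ^ q + b ^ q)],
    which holds for [q < 1] too. *)
Lemma Lp_bound_gauge p A : (0 < p)%E -> measurable A ->
  exists kappa sg, gauge (Lp_bound p A : ('rV[R]_d -> R) -> R -> Prop) kappa sg.
Proof.
move=> p0 mA; have [poo|pf] := eqVneq p +oo%E.
  exists 1, (fun c => `|c|); split.
  - by move=> f m n; exact: Lp_bound_le.
  - by rewrite /Lp_bound poo eqxx => x _; rewrite normr0.
  - rewrite /Lp_bound poo eqxx => f g m n m0 n0 fm gn x Ax.
    by rewrite mul1r; apply: le_trans (ler_normD _ _) _; rewrite lerD ?fm ?gn.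
  - rewrite /Lp_bound poo eqxx => c f m m0 fm x Ax.
    by rewrite normrM ler_wpM2l // fm.
  - by [].
  - by move=> c; exact: normr_ge0.
  - by [].
  - by move=> e e0; exists e.
case: p p0 pf => [q| |]//; rewrite lte_fin => q0 qoo.
exists (2 `^ q), (fun c => `|c| `^ q); split.
- by move=> f m n; exact: Lp_bound_le.
- rewrite /Lp_bound /=; split => //; first exact: measurable_cst.
  by rewrite integral0_eq // => x _; rewrite normr0 powR0 // gt_eqF.
- rewrite /Lp_bound /= => f g m n m0 n0 [_ mf If] [_ mg Ig]; split => //.
    exact: measurable_funD.
  apply: (@le_trans _ _ (\int[lebesgue_rV d]_(x in A)
     ((2 `^ q)%:E * ((`|f x| `^ q)%:E + (`|g x| `^ q)%:E)))%E).
    apply: ge0_le_integral => //.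
    + by apply: measurable_pow; exact: measurable_funD.
    + apply: emeasurable_funM => //; apply: emeasurable_funD; exact: measurable_pow.
    + move=> x _; rewrite -EFinD -EFinM lee_fin.
      wlog fg : f g {m n m0 n0 mf mg If Ig} / `|f x| <= `|g x|.
        move=> H; have [fg|/ltW fg] := leP `|f x| `|g x|; first exact: H.
        by rewrite addrC [X in _ * X]addrC; exact: H.
      apply: (@le_trans _ _ ((2 * `|g x|) `^ q)).
        rewrite ge0_ler_powR ?nnegrE// ?(ltW q0)// ?mulr_ge0//.
        by apply: le_trans (ler_normD _ _) _; lra.
      by rewrite powRM // ler_wpM2l ?powR_ge0// lerDr powR_ge0.
  rewrite ge0_integralZl_EFin ?powR_ge0 //; last first.
  + by apply: emeasurable_funD; exact: measurable_pow.
  + by move=> x _; rewrite adde_ge0 // pow_ge0.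
  rewrite ge0_integralD //; do ?by [move=> x _; exact: pow_ge0|exact: measurable_pow].
  by rewrite EFinM EFinD lee_wpmul2l ?lee_fin ?powR_ge0// leeD.
- rewrite /Lp_bound /= => c f m m0 [_ mf If]; split => //.
    by apply: measurable_funM => //; exact: measurable_cst.
  rewrite (eq_integral (fun x => (`|c| `^ q)%:E * (`|f x| `^ q)%:E)%E); last first.
    by move=> x _; rewrite -EFinM -powRM// -normrM.
  rewrite ge0_integralZl_EFin ?powR_ge0 //; last exact: measurable_pow.
  by rewrite EFinM lee_wpmul2l ?lee_fin ?powR_ge0.
- by rewrite -[leLHS](powRr0 2) ler_powR ?ler1n// ltW.
- by move=> c; exact: powR_ge0.
- by move=> c c' cc'; rewrite ge0_ler_powR ?nnegrE// ltW.
- move=> e e0; exists (e `^ q^-1); first exact: powR_gt0.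
  move=> c ce; apply: (@le_trans _ _ ((e `^ q^-1) `^ q)).
    by rewrite ge0_ler_powR ?nnegrE ?powR_ge0// ltW.
  by rewrite -powRrM mulVf ?gt_eqF// powRr1 // ltW.
Qed.

(** For finite [p], if every [x] in [K] failed, the double integral would be at least [C m |K|],
    while slicing the other way gives at most [m |U|]; [C = |U| / |K| + 1] makes this absurd. For
    [p = +oo] every point of [K] works. *)
Lemma Lp_bound_average p K U : (0 < p)%E -> measurable K -> measurable U ->
  (0 < lebesgue_rV d K < +oo)%E -> (lebesgue_rV d U < +oo)%E ->
  exists2 C, 0 <= C & forall (H : 'rV[R]_d * 'rV[R]_d -> R) m, 0 < m ->
    (p != +oo%E -> measurable_fun setT H) ->
    (forall u, U u -> Lp_bound p K (fun x => H (x, u)) m) ->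
    exists2 x, K x & Lp_bound p U (fun u => H (x, u)) (C * m).
Proof.
move=> p0 mK mU /andP[K0 Koo] Uoo.
have [x0 Kx0] : K !=set0.
  by apply/set0P/eqP => K00; move: K0; rewrite K00 measure0 ltxx.
case: p p0 => [q| |]//; rewrite ?lte_fin => q0; last first.
  exists 1 => // H m m0 mH HU; exists x0 => //.
  by rewrite /Lp_bound eqxx mul1r => u /HU; rewrite /Lp_bound eqxx; exact.
set mu := lebesgue_rV d in K0 Koo Uoo *.
have Kfin : mu K \is a fin_num by rewrite ge0_fin_numE.
have Ufin : mu U \is a fin_num by rewrite ge0_fin_numE.
pose k := fine (mu K); pose v := fine (mu U).
have k0 : 0 < k by rewrite fine_gt0 // K0.
have v0 : 0 <= v by rewrite fine_ge0.
have C0 : 0 <= v / k + 1 by rewrite addr_ge0 // divr_ge0 // ltW.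
exists (v / k + 1) => // H m m0 /(_ isT) mH HU; apply: contrapT => nx.
(* The indicators extend the integrand to the whole product, where Tonelli's theorem applies. *)
pose h (z : 'rV[R]_d * 'rV[R]_d) : \bar R :=
  ((\1_K z.1 * \1_U z.2) * (`|H z| `^ q))%:E.
have h0 z : (0 <= h z)%E by rewrite lee_fin !mulr_ge0 ?powR_ge0.
have mHx x : measurable_fun setT (fun u => H (x, u)).
  by apply: (measurableT_comp mH); exact: measurable_pair1.
have mHu u : measurable_fun setT (fun x => H (x, u)).
  by apply: (measurableT_comp mH); exact: measurable_pair2.
have mh : measurable_fun setT h.
  apply/measurable_EFinP; apply: measurable_funM.
    have mK1 : measurable_fun setT (\1_K : 'rV[R]_d -> R) by exact: measurable_indic.
    have mU1 : measurable_fun setT (\1_U : 'rV[R]_d -> R) by exact: measurable_indic.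
    apply: measurable_funM; first by apply: (measurableT_comp mK1); exact: measurable_fst.
    by apply: (measurableT_comp mU1); exact: measurable_snd.
  by apply/measurable_EFinP; exact: measurable_pow.
have hE1 x : (\int[mu]_u h (x, u) = (\1_K x)%:E * \int[mu]_(u in U) (`|H (x, u)| `^ q)%:E)%E.
  rewrite [in RHS]integral_mkcond -ge0_integralZl_EFin //.
  - by apply: eq_integral => u _; rewrite /h /= patchE !indicE; case: ifPn => _; rewrite -?EFinM ?mulr1 ?mulr0 ?mul0r ?mule0.
  - by move=> u _; rewrite patchE; case: ifPn => // _; exact: pow_ge0.
  - apply: ((measurable_restrictT _ mU).1 (measurable_funTS _)).
    exact: (measurable_pow q (mHx x)).
have hE2 u : (\int[mu]_x h (x, u) = (\1_U u)%:E * \int[mu]_(x in K) (`|H (x, u)| `^ q)%:E)%E.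
  rewrite [in RHS]integral_mkcond -ge0_integralZl_EFin //.
  - by apply: eq_integral => x _; rewrite /h /= patchE !indicE; case: ifPn => _; rewrite -?EFinM ?mulr0 ?mul1r ?mul0r ?mule0.
  - by move=> x _; rewrite patchE; case: ifPn => // _; exact: pow_ge0.
  - apply: ((measurable_restrictT _ mK).1 (measurable_funTS _)).
    exact: (measurable_pow q (mHu u)).
have lo : ((((v / k + 1) * m) * k)%:E <= \int[mu]_x \int[mu]_u h (x, u))%E.
  apply: (@le_trans _ _ (\int[mu]_x ((\1_K x)%:E * ((v / k + 1) * m)%:E))%E).
    rewrite ge0_integralZr //; last by rewrite lee_fin mulr_ge0 // ltW.
      by rewrite integral_indic // setIT EFinM muleC /k fineK.
    by apply/measurable_EFinP; exact: measurable_indic.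
  apply: ge0_le_integral => //.
  - by move=> x _; rewrite -EFinM lee_fin !mulr_ge0 // ltW.
  - apply: emeasurable_funM => //; apply/measurable_EFinP; exact: measurable_indic.
  - exact: measurable_fun_fubini_tonelli_F.
  move=> x _; rewrite hE1 indicE; case: (boolP (x \in K)) => Kx; last by rewrite !mul0e.
  rewrite !mul1e leNgt; apply/negP => lt_m; apply: nx; exists x; first exact: set_mem.
  rewrite /Lp_bound /=; split => //; first exact: measurable_funTS.
  exact: ltW.
have hi : (\int[mu]_u \int[mu]_x h (x, u) <= (m * v)%:E)%E.
  apply: (@le_trans _ _ (\int[mu]_u ((\1_U u)%:E * m%:E))%E); last first.
    rewrite ge0_integralZr //; last by rewrite lee_fin ltW.
      by rewrite integral_indic // setIT EFinM muleC /v fineK.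
    by apply/measurable_EFinP; exact: measurable_indic.
  apply: ge0_le_integral => //.
  - by move=> u _; exact: integral_ge0.
  - exact: measurable_fun_fubini_tonelli_G.
  - apply: emeasurable_funM => //; apply/measurable_EFinP; exact: measurable_indic.
  move=> u _; rewrite hE2 indicE; case: (boolP (u \in U)) => Uu; last by rewrite !mul0e.
  by rewrite !mul1e; have := HU u (set_mem Uu); rewrite /Lp_bound /= => -[].
have := le_trans lo (le_trans _ hi).
rewrite fubini_tonelli // => /(_ (lexx _)); rewrite lee_fin.
have -> : (v / k + 1) * m * k = m * v + m * k by field; rewrite gt_eqF.
by rewrite gerDl leNgt mulr_gt0.
Qed.

End Lp_bound.

Section Lpnorm.
Context {R : realType} {d : nat}.
Implicit Types (A : set 'rV[R]_d) (f g : 'rV[R]_d -> R) (p : \bar R) (m : R).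

Lemma Lpnorm_powE (q : R) A f : 0 < q ->
  (Lpnorm A q%:E f `^ q = \int[lebesgue_rV d]_(x in A) (`|f x| `^ q)%:E)%E.
Proof.
move=> q0; rewrite /Lpnorm /= powR_Lnorm ?gt_eqF// [RHS]integral_mkcond.
apply: eq_integral => x _; rewrite !patchE; case: ifPn => _ /=.
  by rewrite -[RHS]poweR_EFin.
by rewrite normr0 powR0 // gt_eqF.
Qed.

Lemma Lpnorm_ge0 p A f : (0 <= Lpnorm A p f)%E.
Proof.
by rewrite /Lpnorm; case: ifP => _; [rewrite le_max lexx|exact: Lnorm_ge0].
Qed.

Lemma Lpnorm_Lp_bound p A f (c : R) : (0 < p)%E -> 0 <= c -> measurable A ->
  (p != +oo%E -> measurable_fun A f) -> (Lpnorm A p f <= c%:E)%E ->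
  Lp_bound p A f (if p == +oo%E then c else c `^ fine p).
Proof.
move=> p0 c0 mA mf; rewrite /Lp_bound; have [->|pf] := eqVneq p +oo%E.
  rewrite /Lpnorm eqxx => H x Ax; rewrite -lee_fin; apply: le_trans H.
  by rewrite le_max; apply/orP; right; apply: ereal_sup_ubound; exists x.
case: p p0 pf mf => [q| |]// q0 qoo mf; rewrite lte_fin in q0.
move=> H; split => //; first exact: mf.
rewrite /= -Lpnorm_powE // -poweR_EFin gt0_ler_poweR ?(ltW q0) //.
  by rewrite in_itv /= Lpnorm_ge0 leey.
by rewrite in_itv /= lee_fin c0 leey.
Qed.

(** [n] is chosen before [f], since the Whitney constant is a supremum over functions. *)
Lemma Lp_bound_Lpnorm p A m : (0 < p)%E -> 0 <= m ->
  exists n : R, forall f, Lp_bound p A f m -> (Lpnorm A p f <= n%:E)%E.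
Proof.
move=> p0 m0; have [->|pf] := eqVneq p +oo%E.
  exists m => f; rewrite /Lp_bound /Lpnorm eqxx => H; rewrite ge_max lee_fin m0 /=.
  by apply: ge_ereal_sup => _ [x Ax <-]; rewrite lee_fin H.
case: p p0 pf => [q| |]// q0 qoo; rewrite lte_fin in q0.
exists (m `^ q^-1) => f; rewrite /Lp_bound /= => -[mA mf].
rewrite -Lpnorm_powE // => H.
have -> : Lpnorm A q%:E f = ((Lpnorm A q%:E f `^ q) `^ q^-1)%E.
  by rewrite -poweRrM divff ?gt_eqF// poweRe1 // Lpnorm_ge0.
rewrite -poweR_EFin gt0_ler_poweR ?invr_ge0 ?(ltW q0) //.
  by rewrite in_itv /= poweR_ge0 leey.
by rewrite in_itv /= lee_fin m0 leey.
Qed.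

End Lpnorm.

(** * Whitney approximation on X-rayed convex bodies *)

Section dot_product.
Context {R : realType} {d : nat}.
Implicit Types (x y z : 'rV[R]_d) (a : R).

Lemma dotrVC x y : dotrV x y = dotrV y x.
Proof. by apply: eq_bigr => i _; rewrite mulrC. Qed.

Lemma dotrVDl x y z : dotrV (x + y) z = dotrV x z + dotrV y z.
Proof. by rewrite -big_split; apply: eq_bigr => i _; rewrite mxE mulrDl. Qed.

Lemma dotrVZl a x z : dotrV (a *: x) z = a * dotrV x z.
Proof. by rewrite mulr_sumr; apply: eq_bigr => i _; rewrite mxE mulrA. Qed.

Lemma dotrVDr x y z : dotrV z (x + y) = dotrV z x + dotrV z y.
Proof. by rewrite dotrVC dotrVDl !(dotrVC z). Qed.

Lemma dotrVZr a x z : dotrV z (a *: x) = a * dotrV z x.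
Proof. by rewrite dotrVC dotrVZl dotrVC. Qed.

Lemma dotrVNl x z : dotrV (- x) z = - dotrV x z.
Proof. by rewrite -scaleN1r dotrVZl mulN1r. Qed.

Lemma dotrVNr x z : dotrV z (- x) = - dotrV z x.
Proof. by rewrite dotrVC dotrVNl dotrVC. Qed.

Lemma dotrVBl x y z : dotrV (x - y) z = dotrV x z - dotrV y z.
Proof. by rewrite dotrVDl dotrVNl. Qed.

Lemma dotrVBr x y z : dotrV z (x - y) = dotrV z x - dotrV z y.
Proof. by rewrite dotrVDr dotrVNr. Qed.

Lemma dotrV_mx x y : dotrV x y = (x *m y^T) 0 0.
Proof. by rewrite mxE; apply: eq_bigr => i _; rewrite mxE. Qed.

Lemma dotrV_ge0 x : 0 <= dotrV x x.
Proof. by apply: sumr_ge0 => i _; exact: sqr_ge0. Qed.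

Lemma dotrV_eq0 x : (dotrV x x == 0) = (x == 0).
Proof.
apply/idP/eqP => [|->]; last by rewrite /dotrV big1 // => i _; rewrite mxE mul0r.
rewrite psumr_eq0 => [/allP H|i _]; last exact: sqr_ge0.
apply/rowP => i; have := H i (mem_index_enum _); rewrite mxE -expr2 sqrf_eq0.
by move/eqP.
Qed.

Lemma coord_sqr_le_dotrV x i : x 0 i ^+ 2 <= dotrV x x.
Proof.
rewrite /dotrV (bigD1 i) //= -expr2 lerDl; apply: sumr_ge0 => j _.
exact: sqr_ge0.
Qed.

Lemma enorm_eq1 x : (enorm x = 1) <-> (dotrV x x = 1).
Proof.
rewrite /enorm; split=> [H|->]; last by rewrite sqrtr1.
by rewrite -[LHS]sqr_sqrtr ?dotrV_ge0 // H expr1n.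
Qed.

Lemma enormZ_unit a x : enorm x = 1 -> enorm (a *: x) = `|a|.
Proof.
move=> /enorm_eq1 x1; rewrite /enorm dotrVZl dotrVZr x1 mulr1 -expr2.
exact: sqrtr_sqr.
Qed.

Lemma enorm_le_normr x : enorm x <= Num.sqrt d%:R * `|x|.
Proof.
have -> : `|x| = Num.sqrt (`|x| ^+ 2) by rewrite sqrtr_sqr normr_id.
rewrite /enorm -sqrtrM ?ler0n // ler_wsqrtr //.
rewrite /dotrV -[d in d%:R]card_ord mulr_natl -sumr_const; apply: ler_sum => i _.
rewrite -expr2 -[leLHS]real_normK ?num_real // ler_sqr ?nnegrE //.
exact: coord_le_normrV.
Qed.

End dot_product.

Section orthonormal_rows.
Context {R : realType} {d : nat} (M : 'M[R]_d).
Hypothesis MMt : M *m M^T = 1%:M.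

Lemma dotrV_rows i j : dotrV (row i M) (row j M) = (i == j)%:R.
Proof.
have := congr1 (fun A : 'M[R]_d => A i j) MMt; rewrite !mxE => <-.
by apply: eq_bigr => k _; rewrite !mxE.
Qed.

Lemma enorm_row i : enorm (row i M) = 1.
Proof. by apply/enorm_eq1; rewrite dotrV_rows eqxx. Qed.

Lemma orth_entry_le1 i j : `|M i j| <= 1.
Proof.
have := coord_sqr_le_dotrV (row i M) j; rewrite dotrV_rows eqxx mxE => H.
by rewrite -(ler_sqr _ _) ?nnegrE // real_normK ?num_real // expr1n.
Qed.

Lemma normr_mul_orth (t : 'rV[R]_d) a : 0 <= a -> (forall i, `|t 0 i| <= a) ->
  `|t *m M| <= d%:R * a.
Proof.
move=> a0 ta; apply: normrV_le => [|i]; first by rewrite mulr_ge0.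
rewrite mxE; apply: le_trans (ler_norm_sum _ _ _) _.
rewrite -[d in d%:R]card_ord mulr_natl -sumr_const; apply: ler_sum => j _.
by rewrite normrM -[leRHS]mulr1 ler_pM ?orth_entry_le1.
Qed.

Lemma normr_mul_orthT (v : 'rV[R]_d) i : `|(v *m M^T) 0 i| <= d%:R * `|v|.
Proof.
rewrite mxE; apply: le_trans (ler_norm_sum _ _ _) _.
rewrite -[d in d%:R]card_ord mulr_natl -sumr_const; apply: ler_sum => j _.
by rewrite normrM -[leRHS]mulr1 mxE ler_pM ?orth_entry_le1 // coord_le_normrV.
Qed.

Lemma mul_orthK (v : 'rV[R]_d) : v *m M^T *m M = v.
Proof. by rewrite -mulmxA (mulmx1C MMt) mulmx1. Qed.

Lemma mul_orthTE (v : 'rV[R]_d) k : (v *m M^T) 0 k = dotrV v (row k M).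
Proof. by rewrite mxE; apply: eq_bigr => i _; rewrite !mxE. Qed.

Lemma orth_expand (v : 'rV[R]_d) : v = \sum_k dotrV v (row k M) *: row k M.
Proof.
rewrite -[LHS]mul_orthK mulmx_sum_row; apply: eq_bigr => k _.
by rewrite mul_orthTE.
Qed.

Lemma parseval (u v : 'rV[R]_d) :
  dotrV u v = \sum_k dotrV u (row k M) * dotrV v (row k M).
Proof.
rewrite -{1}[u]mul_orthK -{1}[v]mul_orthK dotrV_mx trmx_mul mulmxA.
rewrite -[_ *m M *m M^T]mulmxA MMt mulmx1 mxE; apply: eq_bigr => k _.
by rewrite mul_orthTE mxE mul_orthTE.
Qed.

Lemma continuous_mul_orthT : continuous (fun v : 'rV[R]_d => v *m M^T).
Proof.
have := @linear_bounded_continuous R 'rV[R]_d 'rV[R]_d (mulmxr M^T).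
move=> [H _]; apply: H; apply/linear_boundedP; near=> r => x.
apply: (@le_trans _ _ (d%:R * `|x|)).
  by apply: normrV_le => [|i]; [rewrite mulr_ge0|exact: normr_mul_orthT].
by rewrite ler_wpM2r.
Unshelve. all: by end_near. Qed.

End orthonormal_rows.

Section diameter.
Context {R : realType} {d : nat}.
Implicit Types (G : set 'rV[R]_d).

Lemma bounded_rV G : compact G -> exists2 b : R, 0 <= b & forall x, G x -> `|x| <= b.
Proof.
move=> /compact_bounded [b [_ Hb]]; exists (`|b| + 1); first by rewrite addr_ge0.
by move=> x Gx; apply: (Hb (`|b| + 1)) => //; rewrite (le_lt_trans (ler_norm b)) // ltrDl.
Qed.

Lemma enorm_le_diam G x y : compact G -> G x -> G y -> enorm (x - y) <= diam G.
Proof.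
move=> /bounded_rV[b b0 Hb] Gx Gy; apply: ub_le_sup; last first.
  by exists x => //; exists y.
exists (Num.sqrt d%:R * (b + b)) => _ [z Gz] [t Gt <-].
apply: le_trans (enorm_le_normr _) _; rewrite ler_wpM2l ?sqrtr_ge0 //.
by apply: le_trans (ler_normB _ _) _; rewrite lerD // Hb.
Qed.

(** Steps that stay in [G] are thus among those over which the modulus takes its supremum. *)
Lemma step_le_diam G x (u : R) v : compact G -> enorm v = 1 -> G x -> G (x + u *: v) ->
  `|u| <= diam G.
Proof.
move=> cG v1 Gx Gxu; rewrite -(enormZ_unit u v1).
have := enorm_le_diam cG Gxu Gx; congr (enorm _ <= _).
by rewrite addrC addKr.
Qed.

End diameter.

Section finite_differences.
Context {R : realType} {d : nat}.
Implicit Types (f : 'rV[R]_d -> R) (x v : 'rV[R]_d).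

Lemma coef_XsubC1_exp r j : (j <= r)%N ->
  (('X - 1 : {poly R}) ^+ r)`_j = (-1) ^+ (r + j) * 'C(r, j)%:R.
Proof.
move=> jr; rewrite addrC exprDn.
rewrite coef_sum (bigD1 (inord j : 'I_r.+1)) //= inordK ?ltnS // big1.
  rewrite addr0 coefMn -polyC1 -polyCN -polyC_exp mul_polyC coefZ coefXn eqxx mulr1.
  rewrite -[LHS]mulr_natr; congr (_ * _); rewrite -[LHS]signr_odd -[RHS]signr_odd.
  by rewrite oddB // oddD.
move=> i ij; rewrite coefMn -polyC1 -polyCN -polyC_exp mul_polyC coefZ coefXn.
rewrite (_ : j == i = false) ?mulr0 ?mul0rn //; apply: contra_neqF ij => /eqP ->.
by rewrite inord_val.
Qed.

(** Bridge between the two kinds of differences: those of the function-valued [F], taken pointwise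
    at [x], are directional differences of [f]. *)
Lemma act_fdiff r (h : R) (F : R -> ('rV[R]_d -> R)) f x (p v : 'rV[R]_d) t :
  (forall s y, F s y = f (y + (p + s *: v))) ->
  act (('X - 1) ^+ r) h F t x = fdiff r (h *: v) f (x + (p + t *: v)).
Proof.
move=> FE; rewrite /act size_XsubC1_exp /fdiff fct_sumE; apply: eq_bigr => j _.
rewrite coef_XsubC1_exp; last by rewrite -ltnS.
have <- : F (t + j%:R * h) x = f (x + (p + t *: v) + j%:R *: (h *: v)).
  by rewrite FE scalerDl scalerA !addrA.
by [].
Qed.

Lemma fdiffB r h f g x :
  fdiff r h (fun y => f y - g y) x = fdiff r h f x - fdiff r h g x.
Proof. by rewrite /fdiff -sumrB; apply: eq_bigr => j _; rewrite mulrBr. Qed.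

Lemma fdiff_dir_poly r (E : set 'rV[R]_d) Q xi u x : dir_poly r E Q -> E xi ->
  fdiff r (u *: xi) Q x = 0.
Proof.
move=> [_ QP] Exi; have [q sq Hq] := QP x xi Exi.
transitivity (act (('X - 1) ^+ r) u (fun s => q.[s] *: (1 : R^o)) 0); last exact: act_diff_poly.
rewrite /act size_XsubC1_exp /fdiff; apply: eq_bigr => j _.
rewrite coef_XsubC1_exp; last by rewrite -ltnS.
rewrite scalerA Hq -[RHS]/(_ * (_ * 1)).
by rewrite mulr1 add0r.
Qed.

End finite_differences.

(** * Approximation on a small ball *)

Section base_whitney.
Context {R : realType} {d : nat} (M : 'M[R]_d) (G : set 'rV[R]_d) (r : nat) (p : \bar R).
Hypothesis d0 : (0 < d)%N.
Hypothesis r0 : (0 < r)%N.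
Hypothesis p0 : (0 < p)%E.
Hypothesis MMt : M *m M^T = 1%:M.
Hypothesis cG : compact G.

Definition directions : set 'rV[R]_d := range (fun i => row i M).

(** The modulus condition in the sense of [Lp_bound], hence with p-th powers for finite [p], so that
    gauge estimates apply to it. *)
Definition diff_bounded (f : 'rV[R]_d -> R) (w : R) := forall i u A,
  `|u| <= diam G -> measurable A -> A `<=` diff_dom G r (u *: row i M) ->
  Lp_bound p A (fdiff r (u *: row i M) f) w.

(** Moving [y] along row [k] changes only coordinate [k] of [(y - x) *m M^T], and [l i] is a
    polynomial in each coordinate. *)
Lemma dir_poly_interp (I : finType) (l : I -> 'rV[R]_d -> R) (c : I -> R) (a : R) x :
  (forall i, continuous (l i)) -> (forall i, coord_poly r (l i)) ->
  dir_poly r directions (fun y => \sum_i l i (a *: ((y - x) *m M^T)) * c i).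
Proof.
move=> lc lp.
have ctau : continuous (fun y : 'rV[R]_d => a *: ((y - x) *m M^T)).
  have cB : continuous (fun y : 'rV[R]_d => y - x).
    by move=> y; apply: continuousB; [exact: cvg_id|exact: cst_continuous].
  have cM : continuous (fun y : 'rV[R]_d => (y - x) *m M^T).
    by move=> y; exact: (continuous_comp (cB y) (@continuous_mul_orthT _ _ _ MMt _)).
  by move=> y; exact: (continuous_comp (cM y) (@scaler_continuous _ _ a _)).
split.
  apply: continuous_big => [|i _ y].
    exact: add_continuous.
  apply: continuousM; last exact: cst_continuous.
  exact: (continuous_comp (ctau y) (lc i _)).
move=> y _ [k _ <-].
have qP i : exists q : {poly R}, (size q <= r)%N /\
    forall t, l i (a *: ((y + t *: row k M - x) *m M^T)) = q.[t].
  have [q sq Hq] := lp i (a *: ((y - x) *m M^T)) k.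
  exists (q \Po (a *: 'X)); split=> [|t].
    have [->|a0] := eqVneq a 0.
      rewrite scale0r comp_poly0r; apply: leq_trans (size_polyC_leq1 _) r0.
    by rewrite size_comp_poly2 // size_scale // size_polyX.
  rewrite horner_comp hornerZ hornerX -Hq; congr l.
  rewrite addrAC mulmxDl scalerDr; congr (_ + _); rewrite -scalemxAl scalerA; congr (_ *: _).
  apply/rowP => j; have := dotrV_rows MMt k j; rewrite dotrV_mx !mxE eqxx /= [j == k]eq_sym => <-.
  by apply: eq_bigr => m _; rewrite !mxE.
have [q Hq] := choice qP.
exists (\sum_i (q i * (c i)%:P)).
  apply: leq_trans (size_sum _ _ _) _; apply/bigmax_leqP => i _.
  by rewrite mulrC mul_polyC; apply: leq_trans (size_scale_leq _ _) (Hq i).1.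
move=> t; rewrite horner_sum; apply: eq_bigr => i _.
by rewrite hornerM hornerC (Hq i).2.
Qed.

Lemma set_coord_mul (t : 'rV[R]_d) k (s : R) :
  set_coord t k s *m M = set_coord t k 0 *m M + s *: row k M.
Proof.
rewrite /set_coord !mulmxDl -!scalemxAl -rowE -addrA -scalerDl sub0r.
by rewrite [_ + s]addrC.
Qed.

Lemma fdiff_Lp_bound (f : 'rV[R]_d -> R) w K (c v : 'rV[R]_d) (k : 'I_d) (u : R) :
  diff_bounded f w -> measurable K -> K c ->
  (forall x j, K x -> (j <= r)%N -> G (x + v + j%:R *: (u *: row k M))) ->
  Lp_bound p K (fun x => fdiff r (u *: row k M) f (x + v)) w.
Proof.
move=> fw mK Kc KG.
(* The point [c] of [K] is used here: its translate by [v] and the next node both lie in [G]. *)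
have u_diam : `|u| <= diam G.
  apply: (@step_le_diam _ _ G (c + v) u (row k M)) => //; first exact: enorm_row.
    by have := KG c 0%N Kc (leq0n _); rewrite scale0r addr0.
  by have := KG c 1%N Kc r0; rewrite scale1r.
pose K' := (fun x => x - v) @^-1` K.
apply: (@Lp_bound_translation _ _ _ _ K') => //; first by move=> x Kx; rewrite /K' /= addrK.
apply: fw => //.
  by rewrite -[X in measurable X]setTI; exact: measurable_translation.
by move=> x /= Kx j jr; have := KG _ j Kx jr; rewrite subrK.
Qed.

Lemma base_whitney (c0 : 'rV[R]_d) (rho0 : R) : 0 < rho0 ->
  (forall x, `|c0 - x| < rho0 -> G x) ->
  exists s rho C, [/\ 0 < rho, 0 <= C, (forall x, `|s - x| < rho -> G x) &
    forall f m w, 0 <= m -> 0 < w -> Lp_bound p G f m -> diff_bounded f w ->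
    exists2 Q, dir_poly r directions Q &
      Lp_bound p [set x | `|s - x| < rho] (fun x => f x - Q x) (C * w)].
Proof.
move=> rho0_gt0 ballG; have dR : 0 < d%:R :> R by rewrite ltr0n.
(* The cube scaled by [a] has sup-norm size at most [d a = rho0 / 2]; with [rho <= a / 4], its
   translates by points of [K] stay in the given ball. *)
pose a := rho0 / (2 * d%:R); have a0 : 0 < a by rewrite divr_gt0 // mulr_gt0.
(* Since [d * 2 rho = a / 2], a ball of radius [2 rho] about the centre of the scaled cube lies
   inside that cube. *)
pose rho := a / (4 * d%:R); have rho_gt0 : 0 < rho by rewrite divr_gt0 // mulr_gt0.
have d1 : 1 <= d%:R :> R by rewrite ler1n.
have ad : d%:R * a = rho0 / 2 by rewrite /a; field; rewrite gt_eqF.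
have rho_le : rho <= a / 4.
  by rewrite /rho ler_pM2l // lef_pV2 ?posrE ?mulr_gt0 // ler_peMr.
have a_le : a <= rho0 / 2 by rewrite -ad ler_peMl // ltW.
pose K := [set x : 'rV[R]_d | `|c0 - x| < rho].
have mK : measurable K by exact: measurable_ballrV.
have Kc0 : K c0 by rewrite /K /= subrr normr0.
pose vec t : 'rV[R]_d := a *: (t *m M).
have vec_le t : in_cube t -> `|vec t| <= rho0 / 2.
  move=> t01; rewrite normrZ (gtr0_norm a0) -ad mulrC ler_wpM2r ?(ltW a0) //.
  rewrite -[leRHS]mulr1; apply: normr_mul_orth => // i.
  by have /andP[t0 t1] := t01 i; rewrite ger0_norm.
have KG x t : K x -> in_cube t -> G (x + vec t).
  move=> Kx /vec_le tl; apply: ballG; rewrite opprD addrA.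
  by apply: le_lt_trans (ler_normB _ _) _; move: Kx; rewrite /K /=; lra.
have [kappa [sg gB]] := Lp_bound_gauge p0 mK.
have [I [l [u [C1 [ucube lcont lpoly C10 HC1]]]]] := whitney_cube (d := d) gB r0.
pose half : 'rV[R]_d := const_mx 2^-1.
pose c1 := vec half.
pose U := [set v : 'rV[R]_d | `|c1 - v| < 2 * rho].
have mU : measurable U by exact: measurable_ballrV.
have rho2 : 0 < 2 * rho by rewrite mulr_gt0.
have /andP[_ Uoo] := lebesgue_rV_ball c1 rho2.
have [C2 C20 HC2] := Lp_bound_average p0 mK mU (lebesgue_rV_ball c0 rho_gt0) Uoo.
pose tau (v : 'rV[R]_d) := a^-1 *: (v *m M^T).
have vec_tau v : vec (tau v) = v.
  by rewrite /vec /tau -scalemxAl scalerA divff ?gt_eqF // scale1r mul_orthK.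
have tau_vec t : tau (vec t) = t.
  by rewrite /vec /tau -scalemxAl scalerA mulVf ?gt_eqF // scale1r -mulmxA MMt mulmx1.
have tau_cube v : U v -> in_cube (tau v).
  move=> Uv i; have := normr_mul_orthT MMt (c1 - v) i.
  have -> : ((c1 - v) *m M^T) 0 i = a * (2^-1 - tau v 0 i).
    have -> : (c1 - v) *m M^T = a *: (tau (c1 - v)).
      by rewrite /tau scalerA divff ?gt_eqF // scale1r.
    rewrite mxE; congr (_ * _).
    have -> : tau (c1 - v) = half - tau v by rewrite -(tau_vec half) /tau mulmxBl scalerBr.
    by rewrite !mxE.
  rewrite normrM (gtr0_norm a0) => H.
  have : a * `|2^-1 - tau v 0 i| <= a * 2^-1.
    apply: (le_trans H); apply: (@le_trans _ _ (d%:R * (2 * rho))).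
      by rewrite ler_wpM2l // ltW.
    by rewrite /rho le_eqVlt; apply/orP; left; apply/eqP; field; rewrite gt_eqF.
  by rewrite ler_pM2l // ler_norml => /andP[? ?]; apply/andP; split; lra.
exists (c0 + c1), rho, (C2 * (C1 + 1)); split => //.
- by rewrite mulr_ge0 // addr_ge0.
- move=> x xs; rewrite -[x](subrK c1); apply: KG.
    by rewrite /K /=; apply: le_lt_trans xs; rewrite opprB addrA.
  by move=> i; rewrite mxE; apply/andP; split; lra.
move=> f m w m0 w0 fm fw.
pose F t : 'rV[R]_d -> R := fun x => f (x + vec t).
have Fm t : in_cube t -> Lp_bound p K (F t) m.
  move=> t01; apply: Lp_bound_translation fm => // x Kx; exact: KG.
have Fw t k : in_cube t ->
    diff_bounded_on01 (Lp_bound p K) r (fun s => F (set_coord t k s)) w.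
  move=> t01 s h h0 s0 sh.
  have FE s' y : F (set_coord t k s') y = f (y + (vec (set_coord t k 0) + s' *: (a *: row k M))).
    by rewrite /F /vec set_coord_mul scalerDr !scalerA [s' * a]mulrC.
  apply: (@eq_Lp_bound _ _ _ _ (fun x => fdiff r ((h * a) *: row k M) f (x + vec (set_coord t k s)))).
    move=> x _; symmetry.
    rewrite (@act_fdiff _ _ r h (fun s => F (set_coord t k s)) f x _ _ s FE).
    by rewrite scalerA /vec (set_coord_mul t k s) [in RHS]scalerDr !scalerA [s * a]mulrC.
  apply: (@fdiff_Lp_bound f w K c0) => // x j Kx jr.
  have -> : x + vec (set_coord t k s) + j%:R *: ((h * a) *: row k M) =
      x + vec (set_coord t k (s + j%:R * h)).
    rewrite /vec !(set_coord_mul t k (_ + _)) (set_coord_mul t k s) !scalerDr.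
    rewrite scalerDl scalerDr !addrA !scalerA; congr (_ + _ *: _); ring.
  apply: KG => //; apply: set_coord_in_cube => //; rewrite addr_ge0 ?mulr_ge0 //=.
  by apply: le_trans sh; rewrite lerD2l ler_wpM2r // ler_nat.
have Fapp := HC1 F m w m0 w0 Fm Fw.
(* Extending [f] by 0 outside [G] makes [H] measurable on the whole product for finite [p]; the
   extension is not seen on [K] times [U]. *)
pose f0 := f \_ G.
pose H (z : 'rV[R]_d * 'rV[R]_d) := f0 (z.1 + z.2) - \sum_i l i (tau z.2) * f0 (z.1 + vec (u i)).
have f0E x t : K x -> in_cube t -> f0 (x + vec t) = f (x + vec t).
  by move=> Kx t01; rewrite /f0 patchE ifT // inE; exact: KG.
have mG : measurable G by apply: measurable_closed_rV; exact: compact_closed.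
have mH : p != +oo%E -> measurable_fun setT H.
  move=> poo; have mf0 : measurable_fun setT f0.
    apply/(measurable_restrictT _ mG); move: fm; rewrite /Lp_bound (negbTE poo).
    by case.
  apply: measurable_funB.
    by apply: (measurableT_comp mf0); exact: measurable_addrV.
  apply: measurable_sum => i; apply: measurable_funM.
    apply: (@measurableT_comp _ _ _ _ _ _ (fun v => l i (tau v)) _ snd) => //.
    apply: continuous_measurable_rV => v.
    apply: (@continuous_comp _ _ _ tau (l i)); last exact: lcont.
    exact: (continuous_comp (@continuous_mul_orthT _ _ _ MMt v) (@scaler_continuous _ _ a^-1 _)).
  apply: (measurableT_comp mf0).
  apply: (@measurableT_comp _ _ _ _ _ _ (fun x : 'rV[R]_d => x + vec (u i)) _ fst) => //.
  exact: measurable_translation.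
have C1w : 0 < (C1 + 1) * w by rewrite mulr_gt0 // ltr_wpDl.
have HU v : U v -> Lp_bound p K (fun x => H (x, v)) ((C1 + 1) * w).
  move=> Uv; apply: (@Lp_bound_le _ _ _ _ _ (C1 * w)).
    by rewrite ler_wpM2r ?(ltW w0) // lerDl.
  apply: eq_Lp_bound (Fapp (tau v) (tau_cube v Uv)) => x Kx.
  rewrite /H /= -[in f0 (x + v)](vec_tau v) f0E //; last exact: tau_cube.
  rewrite fctE fct_sumE; congr (_ - _); apply: eq_bigr => i _.
  by rewrite f0E.
have [x Kx Hx] := HC2 H _ C1w mH HU.
exists (fun y => \sum_i l i (a^-1 *: ((y - x) *m M^T)) * f (x + vec (u i))).
  exact: dir_poly_interp.
have S0G y : `|c0 + c1 - y| < rho -> G y.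
  move=> ys; rewrite -[y](subrK c1); apply: KG.
    by rewrite /K /=; apply: le_lt_trans ys; rewrite opprB addrA.
  by move=> i; rewrite mxE; apply/andP; split; lra.
apply: (@eq_Lp_bound _ _ _ _ (fun y => H (x, y - x))).
  move=> y ys; rewrite /H /= (_ : x + (y - x) = y); last by rewrite addrC subrK.
  congr (_ - _).
    by rewrite /f0 patchE ifT // inE; exact: S0G.
  by apply: eq_bigr => i _; rewrite f0E.
(* The ball of radius [rho] about [c0 + c1] lies in [x + U], because [x] is within [rho] of [c0]. *)
rewrite -mulrA; apply: (@Lp_bound_translation _ _ _ _ U) Hx; first exact: measurable_ballrV.
move=> y ys; rewrite /U /=.
have -> : c1 - (y - x) = (c0 + c1 - y) - (c0 - x).
  by rewrite !opprB !addrA; apply/rowP => i; rewrite !mxE; ring.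
apply: le_lt_trans (ler_normB _ _) _; move: ys Kx; rewrite /K /=; lra.
Qed.

End base_whitney.

(** * Propagation of bounds along the basis directions *)

Definition oball {R : realType} {d} (c : 'rV[R]_d) (e : R) : set 'rV[R]_d :=
  [set x | `|c - x| < e].

Lemma expr_unbounded {R : realType} (x q : R) : 1 < q -> exists n, x <= q ^+ n.
Proof.
move=> q1; have q10 : 0 < q - 1 by rewrite subr_gt0.
have bernoulli n : n%:R * (q - 1) <= q ^+ n.
  elim: n => [|n IHn]; first by rewrite mul0r expr0 ler01.
  have : 1 <= q ^+ n by rewrite exprn_ege1 // ltW.
  rewrite exprS -natr1; nra.
exists (Num.truncn (x / (q - 1))).+1; apply: le_trans (bernoulli _).
by rewrite -ler_pdivrMr // ltW // truncnS_gt.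
Qed.

Section controlled.
Context {R : realType} {d : nat} (M : 'M[R]_d) (G : set 'rV[R]_d) (r : nat) (p : \bar R).
Variable S0 : set 'rV[R]_d.
Hypothesis r0 : (0 < r)%N.
Hypothesis p0 : (0 < p)%E.
Hypothesis MMt : M *m M^T = 1%:M.
Hypothesis cG : compact G.
Hypothesis convG : forall x y a, G x -> G y -> 0 <= a <= 1 -> G (x + a *: (y - x)).
Hypothesis mS0 : measurable S0.
Hypothesis S0G : S0 `<=` G.

(** In the application [g] is the error [f - Q], known to be small on [S0] and to have the
    differences of [f]; [C] must not depend on it. *)
Definition controlled (A : set 'rV[R]_d) := [/\ measurable A, A `<=` G &
  exists2 C : R, 0 <= C & forall g m w, 0 <= m -> 0 <= w ->
    diff_bounded M G r p g w -> Lp_bound p S0 g m ->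
    Lp_bound p A g (C * (m + w))].

Let mG : measurable G.
Proof. by apply: measurable_closed_rV; exact: compact_closed. Qed.

Lemma controlled_base : controlled S0.
Proof.
split=> //; exists 1 => // g m w m0 w0 _.
by apply: Lp_bound_le; rewrite mul1r lerDl.
Qed.

Lemma controlled_sub A A' : measurable A' -> A' `<=` A -> controlled A -> controlled A'.
Proof.
move=> mA' A'A [mA AG [C C0 HC]]; split=> //; first exact: subset_trans AG.
exists C => // g m w m0 w0 gw gm.
by apply: Lp_bound_sub (HC g m w m0 w0 gw gm).
Qed.

Lemma controlled_setU A A' : controlled A -> controlled A' -> controlled (A `|` A').
Proof.
move=> [mA AG [C C0 HC]] [mA' AG' [C' C'0 HC']]; split.
- exact: measurableU.
- by move=> x [/AG|/AG'].
exists (C + C'); first exact: addr_ge0.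
move=> g m w m0 w0 gw gm; rewrite mulrDl.
have mw : 0 <= m + w by exact: addr_ge0.
apply: Lp_bound_setU; [exact: mulr_ge0|exact: mulr_ge0| |].
  exact: HC gw gm.
exact: HC' gw gm.
Qed.

Lemma controlled_bigsetU (I : Type) (s : seq I) (F : I -> set 'rV[R]_d) :
  (forall i, controlled (F i)) -> controlled (\big[setU/set0]_(i <- s) F i).
Proof.
move=> HF; elim: s => [|i s IHs].
  by rewrite big_nil; apply: controlled_sub controlled_base.
by rewrite big_cons; exact: controlled_setU.
Qed.

(* [g] at [x] is recovered from its r-th difference and its values at the
   r other nodes, which all lie in the controlled set [A]. *)
Lemma controlled_step A A' (u : R) i : controlled A -> measurable A' -> A' `<=` G ->
  (forall x j, A' x -> (0 < j <= r)%N -> A (x + j%:R *: (u *: row i M))) ->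
  controlled A'.
Proof.
move=> cA mA' A'G A'A.
have [->|/set0P[y A'y]] := eqVneq A' set0.
  by apply: controlled_sub controlled_base.
have [mA AG [C C0 HC]] := cA.
have udiam : `|u| <= diam G.
  apply: (@step_le_diam _ _ G y u (row i M)) => //; [exact: enorm_row|exact: A'G|].
  by apply: AG; rewrite -[u *: _]scale1r; apply: (A'A y 1%N).
have A'dom : A' `<=` diff_dom G r (u *: row i M).
  move=> x A'x j jr; have [->|j0] := posnP j; first by rewrite scale0r addr0; exact: A'G.
  by apply: AG; apply: A'A => //; rewrite j0.
have [kappa [sg gB]] := Lp_bound_gauge p0 mA'.
pose c0 (j : nat) : R := (-1) ^+ (r + j) * 'C(r, j)%:R.
(* The node [j = 0] enters the difference with coefficient [(-1) ^+ r], and multiplying by this sign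
   solves for [g x]. Slot 0 of the sum holds the difference itself. *)
pose c (j : 'I_r.+1) : R := if j == ord0 then (-1) ^+ r else - (-1) ^+ r * c0 j.
pose a : R := \sum_j `|c j|.
have [C' C'0 HC'] := gauge_comb gB r.+1 a.
split=> //; exists (C' * (C + 1)); first by rewrite mulr_ge0 // addr_ge0.
move=> g m w m0 w0 gw gm.
pose v (j : 'I_r.+1) : 'rV[R]_d -> R := if j == ord0 then fdiff r (u *: row i M) g
  else fun x => g (x + (j : nat)%:R *: (u *: row i M)).
have gE x : g x = (\sum_j c j *: v j) x.
  have lift0 (k : 'I_r) : (lift ord0 k == ord0) = false by rewrite eq_sym; apply/negbTE/neq_lift.
  have cv0 : (c ord0 *: v ord0) x = (-1) ^+ r * fdiff r (u *: row i M) g x.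
    by rewrite /c /v eqxx.
  have cvS (k : 'I_r) : (c (lift ord0 k) *: v (lift ord0 k)) x =
      - (-1) ^+ r * (c0 k.+1 * g (x + k.+1%:R *: (u *: row i M))).
    by rewrite /c /v lift0 [RHS]mulrA scalrfctE.
  rewrite fct_sumE big_ord_recl cv0 (eq_bigr _ (fun k _ => cvS k)) -mulr_sumr.
  rewrite /fdiff big_ord_recl /= scale0r addr0 addn0 bin0 mulr1 mulrDr mulNr addrK.
  by rewrite mulrA -expr2 sqrr_sign mul1r.
apply: (@eq_Lp_bound _ _ _ _ (\sum_j c j *: v j)); first by move=> x _; rewrite gE.
have mw : 0 <= m + w by exact: addr_ge0.
rewrite -mulrA; apply: HC' => [||j|j].
- by rewrite size_index_enum card_ord.
- by rewrite mulr_ge0 // addr_ge0.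
- rewrite [leRHS]ger0_norm; first by rewrite /a (bigD1 j) //= lerDl sumr_ge0.
  exact: sumr_ge0.
rewrite /v; case: eqP => [_|/eqP j0].
  by apply: Lp_bound_le (gw i u A' udiam mA' A'dom); nra.
apply: (@Lp_bound_le _ _ _ _ _ (C * (m + w))); first by rewrite ler_wpM2r // lerDl.
apply: (@Lp_bound_translation _ _ _ _ A) => //; last exact: HC gw gm.
by move=> x A'x; apply: A'A => //; apply/andP; split; [rewrite lt0n|rewrite -ltnS].
Qed.

(** The ball is intersected with [G] so that boundary points can be reached as well. *)
Definition reached z := exists2 e : R, 0 < e & controlled (oball z e `&` G).

Definition inner z := exists2 e : R, 0 < e & oball z e `<=` G.

Lemma measurable_oballI z e : measurable (oball z e `&` G).
Proof. by apply: measurableI => //; exact: measurable_ballrV. Qed.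

(** A small enough ball about [y] translates into controlled balls about all nodes. Interiority of
    the nodes keeps these translates in [G], where the control holds. *)
Lemma reached_step y (u : R) i : 
  (forall j, (0 < j <= r)%N -> inner (y + j%:R *: (u *: row i M)) /\
     reached (y + j%:R *: (u *: row i M))) ->
  reached y.
Proof.
move=> H.
have H' (j : 'I_r) : exists e : R, [/\ 0 < e, oball (y + j.+1%:R *: (u *: row i M)) e `<=` G &
    controlled (oball (y + j.+1%:R *: (u *: row i M)) e `&` G)].
  have [[e1 e10 He1] [e2 e20 He2]] := H j.+1 (ltn_ord j).
  exists (Num.min e1 e2); split; first by rewrite lt_min e10.
    by move=> x; rewrite /oball /= lt_min => /andP[? _]; exact: He1.
  apply: controlled_sub He2; first exact: measurable_oballI.
  by move=> x [xe Gx]; split=> //; move: xe; rewrite /oball /= lt_min => /andP[].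
have [e He] := choice H'.
pose e0 := \big[Num.min/1]_(j < r) e j.
have e0_gt0 : 0 < e0 by apply/bigmin_gtP; split=> // j _; case: (He j).
have e0_le j : e0 <= e j by exact: bigmin_le.
exists e0 => //.
pose A := \big[setU/set0]_(j <- index_enum 'I_r)
  (oball (y + j.+1%:R *: (u *: row i M)) (e j) `&` G).
apply: (@controlled_step A _ u i).
- by apply: controlled_bigsetU => j; case: (He j).
- exact: measurable_oballI.
- exact: subIsetr.
move=> x [|j] [xe Gx] // jr; rewrite /A -bigcup_seq; exists (Ordinal jr) => /=.
  exact: mem_index_enum.
have : oball (y + j.+1%:R *: (u *: row i M)) (e (Ordinal jr)) (x + j.+1%:R *: (u *: row i M)).
  rewrite /oball /= opprD addrACA subrr addr0.
  exact: lt_le_trans xe (e0_le _).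
by move=> ? ; split=> //; case: (He (Ordinal jr)) => _ + _; apply.
Qed.

Lemma inner_ball z e x : oball z e `<=` G -> `|z - x| < e -> inner x.
Proof.
move=> ze zx; exists (e - `|z - x|); first by rewrite subr_gt0.
move=> y; rewrite /oball /= => xy; apply: ze; rewrite /oball /=.
have -> : z - y = (z - x) + (x - y) by rewrite addrA subrK.
by apply: le_lt_trans (ler_normD _ _) _; rewrite -ltrBrDl.
Qed.

(** The homothety of centre [y] and ratio [1 - a] maps a ball about [z] to a ball inside [G]; [x']
    below is the preimage of [x]. *)
Lemma inner_segment z y (a : R) : inner z -> G y -> 0 <= a < 1 ->
  inner (z + a *: (y - z)).
Proof.
move=> [e e0 ze] Gy /andP[a0 a1]; have a1' : 0 < 1 - a by rewrite subr_gt0.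
exists ((1 - a) * e); first exact: mulr_gt0.
move=> x; rewrite /oball /= => xe.
pose x' := z + (1 - a)^-1 *: (x - (z + a *: (y - z))).
have -> : x = x' + a *: (y - x').
  apply/rowP => k; rewrite /x' !mxE; field; exact: lt0r_neq0.
apply: convG => //; last by rewrite a0 ltW.
apply: ze; rewrite /oball /= /x' opprD addrA subrr sub0r normrN normrZ.
rewrite ger0_norm ?invr_ge0 ?(ltW a1') // mulrC ltr_pdivrMr // mulrC.
by rewrite distrC.
Qed.

Lemma reached_near z : inner z -> reached z ->
  exists2 e : R, 0 < e & forall x, `|z - x| < e -> inner x /\ reached x.
Proof.
move=> [e1 e10 ze1] [e2 e20 ze2]; exists (Num.min e1 e2); first by rewrite lt_min e10.
move=> x; rewrite lt_min => /andP[xe1 xe2]; split; first exact: inner_ball ze1 xe1.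
exists (e2 - `|z - x|); first by rewrite subr_gt0.
apply: controlled_sub ze2; first exact: measurable_oballI.
move=> y [xy Gy]; split=> //; move: xy; rewrite /oball /= => xy.
have -> : z - y = (z - x) + (x - y) by rewrite addrA subrK.
by apply: le_lt_trans (ler_normD _ _) _; rewrite -ltrBrDl.
Qed.

(** The nodes used for parameter [l] are [l (1 - j / (r + 1))] with [1 <= j <= r], all at most
    [l / q] for [q = (r + 1) / r]. So the reached part of the segment grows by the factor [q] at
    each round, starting from a neighbourhood of [z], and exhausts the interior parameters
    [l < 1]. *)
Lemma reached_line z (t : R) i : inner z -> reached z -> G (z + t *: row i M) ->
  reached (z + t *: row i M).
Proof.
move=> inz rz Gt; have [e e0 He] := reached_near inz rz.
pose pt (l : R) := z + (l * t) *: row i M.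
have ptE l : pt l = z + l *: (z + t *: row i M - z).
  by rewrite /pt addrAC subrr add0r scalerA.
have inner_pt l : 0 <= l < 1 -> inner (pt l) by move=> l01; rewrite ptE; exact: inner_segment.
pose b := `|t *: row i M| + 1; have b0 : 0 < b by rewrite ltr_wpDl.
pose q : R := r.+1%:R / r%:R.
have r0R : 0 < r%:R :> R by rewrite ltr0n.
have q1 : 1 < q by rewrite /q ltr_pdivlMr // mul1r ltr_nat.
have q0 : 0 < q by exact: lt_trans q1.
have step l : (forall j, (0 < j <= r)%N -> inner (pt (l * (1 - j%:R / r.+1%:R))) /\
    reached (pt (l * (1 - j%:R / r.+1%:R)))) -> reached (pt l).
  move=> H; apply: (@reached_step _ (- (l * t) / r.+1%:R) i) => j jr.
  suff -> : pt l + j%:R *: ((- (l * t) / r.+1%:R) *: row i M) =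
      pt (l * (1 - j%:R / r.+1%:R)) by exact: H.
  rewrite /pt -addrA scalerA -scalerDl; congr (_ + _ *: _).
  have : r.+1%:R != 0 :> R by rewrite pnatr_eq0.
  by move: (r.+1%:R : R) => D D0; field.
have ratio j : (0 < j <= r)%N -> 0 < (1 - j%:R / r.+1%:R : R) <= q^-1.
  move=> /andP[j0 jr]; rewrite subr_gt0 ltr_pdivrMr ?ltr0n// mul1r ltr_nat ltnS jr /=.
  rewrite /q invf_div lerBlDr -mulrDl ler_pdivlMr ?ltr0n// mul1r -natrD ler_nat.
  by rewrite -addn1 leq_add2l.
have Hn n : forall l, 0 <= l < 1 -> l <= e / b * q ^+ n -> reached (pt l).
  elim: n => [|n IHn] l l01 ln.
    suff: `|z - pt l| < e by move=> /He[].
    rewrite /pt opprD addrA subrr sub0r normrN -scalerA normrZ.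
    case/andP: l01 => l0 l1; rewrite ger0_norm //.
    have [->|lp] := eqVneq l 0; first by rewrite mul0r.
    rewrite expr0 mulr1 ler_pdivlMr // in ln; apply: lt_le_trans ln.
    by rewrite ltr_pM2l ?ltrDl // lt_neqAle eq_sym lp.
  apply: step => j jr; have /andP[c0 cq] := ratio j jr; case/andP: l01 => l0 l1.
  have lc : 0 <= l * (1 - j%:R / r.+1%:R) < 1.
    rewrite mulr_ge0 ?(ltW c0) //=; apply: le_lt_trans l1.
    by rewrite ler_piMr // gerBl divr_ge0.
  split; first exact: inner_pt.
  apply: IHn => //; apply: (@le_trans _ _ (l * q^-1)); first by rewrite ler_wpM2l.
  by rewrite ler_pdivrMr // -(mulrA (e / b)) -exprSr.
have -> : z + t *: row i M = pt 1 by rewrite /pt mul1r.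
(* The end point may lie on the boundary, so it takes one more step, whose nodes all have parameter
   below 1. *)
apply: step => j jr; rewrite mul1r; have /andP[c0 cq] := ratio j jr.
have lc : 0 <= (1 - j%:R / r.+1%:R : R) < 1.
  by rewrite (ltW c0) /= (le_lt_trans cq) // invf_lt1.
split; first exact: inner_pt.
have eb : 0 < e / b by exact: divr_gt0.
have [n Hqn] : exists n, 1 <= e / b * q ^+ n.
  have [n Hn'] := expr_unbounded (e / b)^-1 q1; exists n.
  by rewrite mulrC -ler_pdivrMr // mul1r.
apply: (Hn n) => //; apply: le_trans Hqn; exact/ltW/(proj2 (andP lc)).
Qed.

(** The coordinates in the basis are changed one at a time; the intermediate points stay in the
    ball, hence are interior. *)
Lemma reached_local z (e : R) : 0 < e -> oball z e `<=` G -> reached z ->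
  forall (t : 'rV[R]_d) a, (forall k, `|t 0 k| <= a) -> d%:R * a < e ->
  reached (z + t *m M).
Proof.
move=> e0 ze rz t a ta ae.
pose tn n : 'rV[R]_d := \row_(k < d) (if (k < n)%N then t 0 k else 0).
have inn n : inner (z + tn n *m M).
  apply: inner_ball ze _; rewrite opprD addrA subrr sub0r normrN.
  (* In dimension 0 there is no coordinate from which to read off [0 <= a]. *)
  have [d00|/prednK dE] := posnP d.
    have no_ord (k : 'I_d) : False by case: k => k kd; move: (kd); rewrite d00.
    rewrite (_ : _ *m M = 0) ?normr0 //; apply/rowP => k; case: (no_ord k).
  have a0 : 0 <= a by apply: le_trans (ta (cast_ord dE ord0)).
  apply: le_lt_trans ae; apply: normr_mul_orth => // k; rewrite mxE.
  by case: ifP; rewrite ?normr0.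
suff H n : (n <= d)%N -> reached (z + tn n *m M).
  have <- : tn d = t by apply/rowP => k; rewrite mxE ltn_ord.
  exact: H.
elim: n => [|n IHn] nd.
  by rewrite (_ : tn 0%N = 0) ?mul0mx ?addr0 //; apply/rowP => k; rewrite !mxE.
have tnS : z + tn n.+1 *m M = (z + tn n *m M) + t 0 (Ordinal nd) *: row (Ordinal nd) M.
  rewrite -addrA rowE scalemxAl -mulmxDl; congr (_ + _ *m _); apply/rowP => k.
  rewrite !mxE eqxx /= -val_eqE /= ltnS leq_eqVlt.
  have [kn|] := eqVneq (k : nat) n; rewrite ?mulr0 ?addr0 //=.
  by rewrite kn ltnn add0r mulr1; congr (t _ _); apply: val_inj.
have := inn n.+1; rewrite tnS => -[e' e'0 He'].
apply: (reached_line (inn n) (IHn (ltnW nd))).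
by apply: He'; rewrite /oball /= subrr normr0.
Qed.

(** By convexity, balls of one radius [e] about all points of the segment from [s] to [y] lie in
    [G]. Cut into [n] short pieces, the segment is travelled with [reached_local]. *)
Lemma reached_inner s y : inner s -> reached s -> inner y -> reached y.
Proof.
move=> [e1 e10 He1] rs [e2 e20 He2]; pose e := Num.min e1 e2.
have e0 : 0 < e by rewrite lt_min e10.
have Hs : oball s e `<=` G by move=> x; rewrite /oball /= lt_min => /andP[/He1].
have Hy : oball y e `<=` G by move=> x; rewrite /oball /= lt_min => /andP[_ /He2].
have Hb (l : R) : 0 <= l <= 1 -> oball (s + l *: (y - s)) e `<=` G.
  move=> l01 x; rewrite /oball /= => xe.
  have -> : x = (x - l *: (y - s)) + l *: ((x + (1 - l) *: (y - s)) - (x - l *: (y - s))).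
    by apply/rowP => k; rewrite !mxE; ring.
  apply: convG => //.
    apply: Hs; rewrite /oball /=; congr (`|_| < _) : xe.
    by rewrite opprB addrA addrAC.
  apply: Hy; rewrite /oball /=; congr (`|_| < _) : xe.
  by apply/rowP => k; rewrite !mxE; ring.
pose t := (y - s) *m M^T; pose a := \big[Num.max/0]_k `|t 0 k|.
have ta k : `|t 0 k| <= a by exact: le_bigmax.
have a0 : 0 <= a by exact: bigmax_ge_id.
have [n n0 an] : exists2 n, 0 < n%:R :> R & d%:R * (a / n%:R) < e.
  exists (Num.truncn (d%:R * a / e)).+1; first by rewrite ltr0n.
  by rewrite mulrA ltr_pdivrMr // -ltr_pdivrMl // [e^-1 * _]mulrC truncnS_gt.
suff H j : (j <= n)%N -> reached (s + (j%:R / n%:R) *: (y - s)).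
  have yE : y = s + (n%:R / n%:R) *: (y - s).
    by rewrite divff ?lt0r_neq0 // scale1r addrC subrK.
  by rewrite [X in reached X]yE; exact: H.
elim: j => [|j IHj] jn; first by rewrite mul0r scale0r addr0.
have jn01 : 0 <= (j%:R / n%:R : R) <= 1.
  by rewrite divr_ge0 //= ler_pdivrMr // mul1r ler_nat ltnW.
have := reached_local e0 (Hb _ jn01) (IHj (ltnW jn)) (t := n%:R^-1 *: t) _ an.
rewrite -scalemxAl (mul_orthK MMt) -addrA -scalerDl.
rewrite (_ : j%:R / n%:R + n%:R^-1 = j.+1%:R / n%:R); last by rewrite -natr1 mulrDl mul1r.
by apply => k; rewrite mxE normrM gtr0_norm ?invr_gt0 // mulrC ler_wpM2r // invr_ge0 ltW.
Qed.

Lemma reached_xray s : inner s -> reached s ->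
  (forall y, G y -> exists i (t : R), inner (y + t *: row i M)) ->
  forall y, G y -> reached y.
Proof.
move=> ins rs xray y Gy; have [i [t int]] := xray y Gy.
have yE : y = (y + t *: row i M) + (- t) *: row i M by rewrite scaleNr addrK.
rewrite yE; apply: (reached_line int (reached_inner ins rs int)).
by rewrite -yE.
Qed.

Lemma controlled_compact : (forall y, G y -> reached y) -> controlled G.
Proof.
move=> rG; have H y : exists e : R, G y -> 0 < e /\ controlled (oball y e `&` G).
  (* Points outside [G] get the dummy radius 0. *)
  have [Gy|nGy] := pselect (G y); last by exists 0.
  by have [e e0 He] := rG y Gy; exists e.
have [e He] := choice H.
have := cG; rewrite compact_cover => /(_ _ G (fun y => oball y (e y))).
case=> [y Gy|y Gy|D DG GD].
- have := @ball_open R 'rV[R]_d y (e y); congr open.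
  by apply/seteqP; split => x; rewrite /= ballrVE.
- by exists y => //; rewrite /oball /= subrr normr0; case: (He y Gy).
pose A := \big[setU/set0]_(y <- D) (if `[< G y >] then oball y (e y) `&` G else set0).
have cA : controlled A.
  apply: controlled_bigsetU => y; case: asboolP => [/He[]//|_].
  by apply: controlled_sub controlled_base.
apply: controlled_sub cA => // x Gx; have [y /= Dy yx] := GD x Gx.
rewrite /A -bigcup_seq; exists y => //=; rewrite ifT //.
by apply/asboolP; have := DG y Dy; rewrite inE.
Qed.

End controlled.

(** * Finiteness of the Whitney constant *)

Section whitney_xray.
Context {R : realType} {d : nat} (M : 'M[R]_d) (G : set 'rV[R]_d).
Hypothesis d0 : (0 < d)%N.
Hypothesis MMt : M *m M^T = 1%:M.
Hypothesis cG : compact G.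
Hypothesis convG : forall x y (a : R), G x -> G y -> 0 <= a <= 1 -> G (x + a *: (y - x)).

Let mG : measurable G.
Proof. by apply: measurable_closed_rV; exact: compact_closed. Qed.

(** Supplies the a priori bound required by the interpolation estimate; its size does not enter the
    final constant. For [p = +oo] it comes from continuity on the compact set [G]. *)
Lemma Lp_space_bound p f : (0 < p)%E -> Lp_space G p f ->
  exists2 m : R, 0 <= m & Lp_bound p G f m.
Proof.
move=> p0; rewrite /Lp_space /=; have [->|pf] := eqVneq p +oo%E.
  have <- : G = closure G by apply/closure_id; exact: compact_closed.
  move=> cf; have /compact_bounded [b [_ Hb]] := continuous_compact cf cG.
  exists (`|b| + 1); first by rewrite addr_ge0.
  rewrite /Lp_bound eqxx => x Gx; apply: (Hb (`|b| + 1)); last by exists x.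
  by rewrite (le_lt_trans (ler_norm b)) // ltrDl.
move=> [mf fin]; set c := fine (Lpnorm G p f).
have c0 : 0 <= c by apply: fine_ge0; exact: Lpnorm_ge0.
exists (c `^ fine p); first exact: powR_ge0.
have := @Lpnorm_Lp_bound _ _ p G f c p0 c0 mG; rewrite (negbTE pf); apply => //.
by rewrite /c fineK // ge0_fin_numE // Lpnorm_ge0.
Qed.

Lemma measurable_diff_dom r (h : 'rV[R]_d) : measurable (diff_dom G r h).
Proof.
rewrite (_ : diff_dom G r h = \bigcap_(j in setT : set 'I_r.+1)
    ((fun x => x + (j : nat)%:R *: h) @^-1` G)).
  apply: fin_bigcap_measurable => // j _; rewrite -[X in measurable X]setTI.
  by apply: measurable_translation.
apply/seteqP; split=> x /= H => [j _|j jr]; first by apply: H; rewrite -ltnS.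
by have := H (Ordinal (jr : (j < r.+1)%N)) I.
Qed.

Lemma measurable_fdiff r (h : 'rV[R]_d) f : measurable_fun G f ->
  measurable_fun (diff_dom G r h) (fdiff r h f).
Proof.
move=> mf; rewrite /fdiff; apply: measurable_sum => j.
apply: measurable_funM; first exact: measurable_cst.
apply: (@measurable_comp _ _ _ _ _ _ G f (diff_dom G r h)
  (fun x : 'rV[R]_d => x + (j : nat)%:R *: h)) => //.
  by move=> _ [x Hx <-]; apply: Hx; rewrite -ltnS.
by apply: measurable_funTS; exact: measurable_translation.
Qed.

Lemma modulus_diff_bounded r p f : (0 < p)%E -> Lp_space G p f ->
  (modulus r (directions M) f G p <= 1)%E -> diff_bounded M G r p f 1.
Proof.
move=> p0 Lf fm i u A udiam mA Adom; apply: (Lp_bound_sub mA Adom).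
(* With the modulus normalised to 1, passing to p-th powers changes nothing. *)
have c1 : (if p == +oo%E then 1 else 1 `^ fine p) = 1 :> R.
  by case: ifP => //; rewrite powR1.
rewrite -c1; apply: Lpnorm_Lp_bound => //; first exact: measurable_diff_dom.
  move=> poo; apply: measurable_fdiff; move: Lf; rewrite /Lp_space /= (negbTE poo).
  by case.
apply: le_trans fm; apply: (@le_trans _ _ (dir_modulus r (row i M) f (diam G) G p)).
  by apply: ereal_sup_ubound; exists u.
by apply: ereal_sup_ubound; exists (row i M) => //; exists i.
Qed.

Lemma whitney_const_finite r p : (0 < r)%N -> (0 < p)%E -> G^° !=set0 ->
  (forall y, G y -> exists i (t : R), inner G (y + t *: row i M)) ->
  (whitney_const r G (directions M) p < +oo)%E.
Proof.
move=> r0 p0 [c0 /nbhs_rVP[rho0 rho0_gt0 ballG]] xray.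
have [s [rho [C [rho_gt0 C0 S0G HC]]]] := base_whitney d0 r0 p0 MMt cG rho0_gt0 ballG.
set S0 := [set x | `|s - x| < rho] in HC.
have mS0 : measurable S0 by exact: measurable_ballrV.
have ins : inner G s by exists rho.
have rs : reached M G r p S0 s.
  exists rho => //; apply: controlled_sub; last exact: controlled_base.
    exact: measurable_oballI.
  exact: subIsetl.
have rG := reached_xray r0 p0 MMt cG convG mS0 S0G ins rs xray.
have [_ _ [C' C'0 HC']] := controlled_compact cG mS0 S0G rG.
have CC0 : 0 <= C' * (C * 1 + 1) by rewrite mulr_ge0 // addr_ge0 // mulr1.
have [n Hn] := Lp_bound_Lpnorm G p0 CC0.
apply: (@le_lt_trans _ _ n%:E); last exact: ltry.
apply: ge_ereal_sup => _ [f [Lf fmod] <-].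
have [m m0 fm] := Lp_space_bound p0 Lf.
have fw := modulus_diff_bounded p0 Lf fmod.
have [Q QP fQ] := HC f m 1 m0 ltr01 fm fw.
apply: (@le_trans _ _ (Lpnorm G p (f \- Q))).
  by apply: ereal_inf_lbound; exists Q.
apply: Hn; apply: HC' => //; first by rewrite mulr1.
(* Directional differences of [Q] vanish, so [f - Q] inherits the difference bound of [f]. *)
move=> i u A udiam mA Adom.
apply: eq_Lp_bound (fw i u A udiam mA Adom) => x _.
by rewrite fdiffB (fdiff_dir_poly _ _ QP) ?subr0 //; exists i.
Qed.

End whitney_xray.

(** * Almost smooth bodies are X-rayed by an orthonormal basis *)

Section supporting_normal.
Context {R : realType} {d : nat}.
Implicit Types (x y u v xi : 'rV[R]_d).

Lemma dotrV_add_scale u v (l : R) : dotrV (u + l *: v) (u + l *: v) =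
  dotrV u u + 2 * l * dotrV u v + l ^+ 2 * dotrV v v.
Proof.
rewrite dotrVDl !dotrVDr !dotrVZl !dotrVZr [dotrV v u]dotrVC; ring.
Qed.

Lemma continuous_dotrV (T : topologicalType) (f g : T -> 'rV[R]_d) :
  continuous f -> continuous g -> continuous (fun s : T => dotrV (f s) (g s)).
Proof.
move=> cf cg; apply: continuous_big => [|i _ x]; first exact: add_continuous.
apply: continuousM.
  exact: (continuous_comp (cf x) (@coord_continuous _ _ _ 0 i _)).
exact: (continuous_comp (cg x) (@coord_continuous _ _ _ 0 i _)).
Qed.

Variables (G : set 'rV[R]_d) (c : 'rV[R]_d).
Hypothesis cG : compact G.
Hypothesis convG : forall x y (a : R), G x -> G y -> 0 <= a <= 1 -> G (x + a *: (y - x)).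
Hypothesis innc : inner G c.

Let Gc : G c.
Proof. by case: innc => e e0; apply; rewrite /oball /= subrr normr0. Qed.

(** Shrunk towards [c] by a factor [t < 1], the body lies in the interior of [G], so the line
    through [y] misses it. After projection along [xi], the shrunk point nearest to [y] gives a
    separating vector orthogonal to [xi]. *)
Lemma separate_shrunk y xi (t : R) : dotrV xi xi = 1 ->
  (forall s : R, ~ inner G (y + s *: xi)) -> 0 <= t < 1 ->
  exists u, [/\ dotrV u u = 1, dotrV u xi = 0 &
    forall g, G g -> dotrV u (c + t *: (g - c) - y) <= 0].
Proof.
move=> xi1 out t01.
pose pr v := v - dotrV v xi *: xi.
have prB u v : pr (u - v) = pr u - pr v.
  by rewrite /pr dotrVBl scalerBl !opprB addrACA [in RHS]addrACA; congr (_ + _); rewrite addrC.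
have prZ a v : pr (a *: v) = a *: pr v by rewrite /pr dotrVZl scalerBr scalerA.
have pr_orth v : dotrV (pr v) xi = 0 by rewrite /pr dotrVBl dotrVZl xi1 mulr1 subrr.
have dot_pr w v : dotrV w xi = 0 -> dotrV w (pr v) = dotrV w v.
  by move=> w0; rewrite /pr dotrVBr dotrVZr w0 mulr0 subr0.
pose h g := c + t *: (g - c) - y.
pose phi g := dotrV (pr (h g)) (pr (h g)).
have cB a : continuous (fun v : 'rV[R]_d => v - a).
  by move=> x; apply: continuousB; [exact: cvg_id|exact: cst_continuous].
have ch : continuous h.
  have ctB : continuous (fun g : 'rV[R]_d => t *: (g - c)).
    by move=> g; exact: (continuous_comp (cB c g) (@scaler_continuous _ _ t _)).
  rewrite (_ : h = fun g => t *: (g - c) - (y - c)).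
    by move=> g; exact: (continuous_comp (ctB g) (cB (y - c) _)).
  by apply/funext => g; rewrite /h opprB addrA [t *: _ + c]addrC.
have cpr : continuous (fun g => pr (h g)).
  have cd : continuous (fun g => dotrV (h g) xi).
    by apply: continuous_dotrV => // x; exact: cst_continuous.
  move=> g; apply: (cvgB (ch g)).
  exact: (continuous_comp (cd g) (@scalel_continuous _ _ xi _)).
have cphi : {within G, continuous phi}.
  by apply: continuous_subspaceT; exact: continuous_dotrV.
have [|g0 Gg0 g0min] := EVT_min_rV _ cG cphi; first by exists c.
rewrite inE in Gg0; set w := pr (h g0).
have w_neq0 : w != 0.
  apply/eqP => w0; apply: (out (dotrV (h g0) xi)).
  have <- : c + t *: (g0 - c) = y + dotrV (h g0) xi *: xi.
    have := w0; rewrite /w /pr /h => /eqP; rewrite subr_eq0 subr_eq => /eqP wE.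
    by rewrite [LHS]wE addrC.
  exact: inner_segment.
have w_gt0 : 0 < dotrV w w by rewrite lt_neqAle eq_sym dotrV_eq0 w_neq0 dotrV_ge0.
have wxi : dotrV w xi = 0 by exact: pr_orth.
have main g : G g -> 0 <= dotrV w (t *: (g - g0)).
  move=> Gg; set v := t *: (g - g0).
  (* First variation of the squared distance at its minimiser [g0], in the direction of [g]. *)
  have key (l : R) : 0 < l <= 1 -> 0 <= 2 * dotrV w v + l * dotrV (pr v) (pr v).
    move=> /andP[l0 l1]; have Gl : G (g0 + l *: (g - g0)) by apply: convG; rewrite ?(ltW l0).
    have := g0min (g0 + l *: (g - g0)); rewrite inE => /(_ Gl); rewrite /phi -/w.
    have -> : pr (h (g0 + l *: (g - g0))) = w + l *: pr v.
      have -> : h (g0 + l *: (g - g0)) = h g0 - (- l) *: v.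
        by apply/rowP => i; rewrite /h /v !mxE; ring.
      by rewrite prB prZ scaleNr opprK.
    rewrite dotrV_add_scale (dot_pr w v wxi) -subr_ge0.
    have -> : dotrV w w + 2 * l * dotrV w v + l ^+ 2 * dotrV (pr v) (pr v) - dotrV w w =
      l * (2 * dotrV w v + l * dotrV (pr v) (pr v)) by ring.
    by rewrite pmulr_rge0.
  rewrite leNgt; apply/negP => neg; set b := dotrV w v in neg key.
  set q := dotrV (pr v) (pr v) in key.
  have q0 : 0 <= q by exact: dotrV_ge0.
  have qb : 0 < q - b by lra.
  (* For this [l] one has [l q <= - b], so [2 b + l q <= b < 0] contradicts [key]. *)
  have l01 : 0 < - b / (q - b) <= 1.
    by rewrite divr_gt0 ?oppr_gt0 //= ler_pdivrMr // mul1r lerDr.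
  have := key _ l01; have : - b / (q - b) * q <= - b.
    by rewrite mulrAC ler_pdivrMr // mulrDr; nra.
  by lra.
pose n := Num.sqrt (dotrV w w); have n0 : 0 < n by rewrite sqrtr_gt0.
exists (- n^-1 *: w); split.
- rewrite dotrVZl dotrVZr mulrA mulrNN -expr2 exprVn sqr_sqrtr ?(ltW w_gt0) //.
  by rewrite mulVf // gt_eqF.
- by rewrite dotrVZl wxi mulr0.
move=> g Gg; rewrite dotrVZl mulNr oppr_le0 mulr_ge0 ?invr_ge0 ?(ltW n0) //.
have -> : c + t *: (g - c) - y = h g0 + t *: (g - g0).
  by apply/rowP => i; rewrite /h !mxE; ring.
rewrite dotrVDr addr_ge0 ?main // -(dot_pr w) // -/w; exact: dotrV_ge0.
Qed.

Lemma compact_sphere : compact [set u : 'rV[R]_d | dotrV u u = 1].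
Proof.
apply: bounded_closed_compact.
  exists 1; split=> // b b1 u /= u1; apply: normrV_le => [|i]; first by rewrite ltW // (lt_trans ltr01).
  apply: le_trans (ltW b1); have := coord_sqr_le_dotrV u i; rewrite u1 => ui.
  by rewrite -(ler_sqr _ _) ?nnegrE // real_normK ?num_real // expr1n.
apply: (@preimage_closed _ _ (fun u : 'rV[R]_d => dotrV u u) [set 1]); last exact: closed_eq.
by move=> u _; apply: continuous_dotrV => x; exact: cvg_id.
Qed.

Lemma normr_dotrV_le u x : dotrV u u = 1 -> dotrV u x <= d%:R * `|x|.
Proof.
move=> u1; apply: le_trans (ler_norm _) _; apply: le_trans (ler_norm_sum _ _ _) _.
rewrite -[d in d%:R]card_ord mulr_natl -sumr_const; apply: ler_sum => i _.
rewrite normrM -[leRHS]mul1r ler_pM ?coord_le_normrV //.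
have := coord_sqr_le_dotrV u i; rewrite u1 => ui.
by rewrite -(ler_sqr _ _) ?nnegrE // real_normK ?num_real // expr1n.
Qed.

(** The unit vectors separating [y] from the copies shrunk by [1 - 1 / (n + 1)] have a cluster point
    on the compact sphere, and the inequalities pass to it. *)
Lemma supporting_orth y xi : dotrV xi xi = 1 ->
  (forall s : R, ~ inner G (y + s *: xi)) ->
  exists2 u, outer_unit_normal G y u & dotrV u xi = 0.
Proof.
move=> xi1 out.
have tn01 n : 0 <= (1 - n.+1%:R^-1 : R) < 1.
  by rewrite subr_ge0 invf_le1 ?ltr0n // ler1n /= gtrBl invr_gt0.
have /choice[u_ Hu] n := separate_shrunk xi1 out (tn01 n).
have [|u [u1 ucl]] := compact_sphere (F := u_ @ \oo).
  by exists 0%N => // n _; case: (Hu n).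
have limit_le (psi : 'rV[R]_d -> R) (b : R) N : continuous psi ->
    (forall n, (N <= n)%N -> psi (u_ n) <= b) -> psi u <= b.
  move=> cpsi psib; rewrite leNgt; apply/negP => bu.
  have nB : nbhs u [set v | b < psi v].
    apply: (cpsi u [set s | b < s]); apply: open_nbhs_nbhs; split=> //.
  have FA : (u_ @ \oo) [set v | exists2 n, (N <= n)%N & v = u_ n].
    by exists N => // n /= Nn; exists n.
  have [v [[n Nn ->] /=]] := ucl _ _ FA nB.
  by rewrite ltNge psib.
have cdot x : continuous (fun v : 'rV[R]_d => dotrV v x).
  by apply: continuous_dotrV => v; [exact: cvg_id|exact: cst_continuous].
exists u.
  split; first exact/enorm_eq1.
  move=> g Gg; rewrite -subr_le0 -dotrVBr; apply/ler_addgt0Pr => e e0; rewrite add0r.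
  (* The point [g] differs from its shrunk copy by [(g - c) / (n + 1)], which contributes at most
     [K / (n + 1)]. *)
  pose K := d%:R * `|g - c|.
  have K0 : 0 <= K by rewrite mulr_ge0.
  apply: (limit_le (fun v => dotrV v (g - y)) e (Num.truncn (K / e))) => // n nK.
  have [un1 _ un] := Hu n.
  have gE : g - y = (c + (1 - n.+1%:R^-1) *: (g - c) - y) + n.+1%:R^-1 *: (g - c).
    by apply/rowP => i; rewrite !mxE; ring.
  rewrite gE dotrVDr -[leRHS]add0r lerD ?un // dotrVZr.
  apply: (@le_trans _ _ (n.+1%:R^-1 * K)).
    by rewrite ler_wpM2l ?invr_ge0 // normr_dotrV_le.
  rewrite mulrC ler_pdivrMr ?ltr0n // mulrC -ler_pdivrMr // ltW //.
  by apply: lt_le_trans (truncnS_gt _) _; rewrite ler_nat ltnS.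
apply/eqP; rewrite eq_le; apply/andP; split.
  by apply: (limit_le (fun v => dotrV v xi) 0 0%N) => // n _; case: (Hu n) => _ ->.
rewrite -oppr_le0 -dotrVNr; apply: (limit_le (fun v => dotrV v (- xi)) 0 0%N) => // n _.
by case: (Hu n) => _ uxi _; rewrite dotrVNr uxi oppr0.
Qed.

End supporting_normal.

(** * Rigidity of normals orthogonal to the basis vectors *)

Section rigidity.
Context {R : realType} {d : nat}.
Hypothesis d3 : (3 <= d)%N.

Let d1_gt0 : 0 < d%:R - 1 :> R.
Proof. by rewrite subr_gt0 ltr1n ltnW. Qed.

(** The modulus of the nonzero coordinates of a unit vector with one zero and [d - 1] coordinates of
    equal modulus. *)
Definition simplex_coord : R := Num.sqrt (d%:R - 1)^-1.

Lemma sqr_simplex_coord : simplex_coord ^+ 2 = (d%:R - 1)^-1.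
Proof. by rewrite sqr_sqrtr // invr_ge0 ltW. Qed.

Lemma simplex_coord_gt0 : 0 < simplex_coord.
Proof. by rewrite sqrtr_gt0 invr_gt0. Qed.

Definition axis0 : 'I_d := Ordinal (leq_trans (isT : (0 < 3)%N) d3).
Definition axis1 : 'I_d := Ordinal (leq_trans (isT : (1 < 3)%N) d3).

(* Half the sum over [k] of the spread [T k] of column [k] is
   [d (d - 1) - |sum_i a_i|^2 <= 0], so every column is constant off the
   diagonal. *)
Lemma columns_constant (a : 'I_d -> 'I_d -> R) :
  (forall i, a i i = 0) -> (forall i, \sum_k a i k * a i k = 1) ->
  (forall i j, (d%:R - 2) / (d%:R - 1) <= \sum_k a i k * a j k) ->
  forall i j k, i != k -> j != k -> a i k = a j k.
Proof.
move=> adiag anorm adot.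
pose T k := \sum_(i | i != k) \sum_(j | j != k) (a i k - a j k) ^+ 2.
have sum_off k (F : 'I_d -> R) : F k = 0 -> \sum_(i | i != k) F i = \sum_i F i.
  by move=> Fk; rewrite [RHS](bigD1 k) //= Fk add0r.
have card_off k (x : R) : \sum_(j < d | j != k) x = (d%:R - 1) * x.
  rewrite sumr_const (_ : #|_| = d.-1); last by rewrite cardC1 card_ord.
  by rewrite -subn1 -[x in LHS]mul1r -mulrnAl natrB // ltnW // ltnW.
have TE k : T k = 2 * (d%:R - 1) * (\sum_i a i k * a i k) - 2 * ((\sum_i a i k) * (\sum_j a j k)).
  have -> : T k = \sum_(i | i != k) ((d%:R - 1) * (a i k * a i k) + (\sum_j a j k * a j k)
      - 2 * (a i k * \sum_j a j k)).
    apply: eq_bigr => i _.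
    rewrite (eq_bigr (fun j => a i k * a i k + a j k * a j k - 2 * (a i k * a j k))); last first.
      by move=> j _; ring.
    rewrite sumrB big_split /= -!mulr_sumr card_off.
    rewrite (sum_off k (fun j => a j k * a j k)) ?adiag ?mul0r//.
    rewrite (sum_off k (fun j => a j k)) ?adiag//.
    by ring.
  rewrite sumrB big_split /= -!mulr_sumr -mulr_suml.
  rewrite (sum_off k (fun j => a j k * a j k)) ?adiag ?mul0r//.
  rewrite (sum_off k (fun j => a j k)) ?adiag//.
  by rewrite (card_off k (\sum_j a j k * a j k)); ring.
have dot_sum : d%:R * (d%:R - 1) <= \sum_i \sum_j \sum_k a i k * a j k.
  (* The term [j = i] is 1 and each of the other [d - 1] is at least [(d - 2) / (d - 1)]. *)
  have row_ge i : d%:R - 1 <= \sum_j \sum_k a i k * a j k.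
    rewrite (bigD1 i) //= anorm.
    have : \sum_(j | j != i) ((d%:R - 2) / (d%:R - 1)) <= \sum_(j | j != i) \sum_k a i k * a j k.
      by apply: ler_sum.
    rewrite card_off mulrC divfK ?gt_eqF //; lra.
  rewrite -[d in d%:R * _]card_ord mulr_natl -sumr_const; apply: ler_sum => i _.
  exact: row_ge.
have sumT : \sum_k T k <= 0.
  rewrite (eq_bigr _ (fun k _ => TE k)) sumrB -!mulr_sumr exchange_big /=.
  rewrite (eq_bigr _ (fun i _ => anorm i)) sumr_const card_ord.
  have -> : \sum_k (\sum_i a i k) * (\sum_j a j k) = \sum_i \sum_j \sum_k a i k * a j k.
    rewrite (eq_bigr (fun k => \sum_i \sum_j a i k * a j k)); last first.
      by move=> k _; rewrite mulr_suml; apply: eq_bigr => i _; rewrite mulr_sumr.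
    rewrite exchange_big; apply: eq_bigr => i _; exact: exchange_big.
  by move: dot_sum; rewrite -(mulrC (d%:R)); nra.
have T0 k : T k = 0.
  apply/eqP; have : \sum_k T k == 0.
    rewrite eq_le sumT; apply: sumr_ge0 => ? _; apply: sumr_ge0 => ? _.
    by apply: sumr_ge0 => ? _; exact: sqr_ge0.
  rewrite psumr_eq0 => [/allP/(_ k (mem_index_enum _))//|? _].
  by apply: sumr_ge0 => ? _; apply: sumr_ge0 => ? _; exact: sqr_ge0.
move=> i j k ik jk; apply/eqP; rewrite -subr_eq0 -sqrf_eq0.
have := T0 k; rewrite /T => /eqP; rewrite psumr_eq0; last first.
  by move=> ? _; apply: sumr_ge0 => ? _; exact: sqr_ge0.
move=> /allP/(_ i (mem_index_enum _)); rewrite ik /= psumr_eq0 => [|? _]; last exact: sqr_ge0.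
by move=> /allP/(_ j (mem_index_enum _)); rewrite jk.
Qed.

Definition sgn (e : {ffun 'I_d -> bool}) k : R := (-1) ^+ (e k) * simplex_coord.

Lemma sqr_sgn e k : sgn e k * sgn e k = (d%:R - 1)^-1.
Proof. by rewrite -expr2 exprMn sqrr_sign mul1r sqr_simplex_coord. Qed.

(** Column [k] has a constant value [c k] off the diagonal. With [S] the sum of the squares of all
    [c k], normalisation of row [i] gives [c i ^+ 2 = S - 1]; summing, [S = d (S - 1)], which leaves
    only the signs free. *)
Lemma rigid (a : 'I_d -> 'I_d -> R) :
  (forall i, a i i = 0) -> (forall i, \sum_k a i k * a i k = 1) ->
  (forall i j, (d%:R - 2) / (d%:R - 1) <= \sum_k a i k * a j k) ->
  exists e, forall i k, i != k -> a i k = sgn e k.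
Proof.
move=> adiag anorm adot; have acst := columns_constant adiag anorm adot.
(* Any row other than [k] may represent column [k]. *)
pose c k := a (if k == axis0 then axis1 else axis0) k.
have aE i k : i != k -> a i k = c k.
  by move=> ik; apply: acst => //; case: (eqVneq k axis0) => [->|] //; rewrite eq_sym.
have cE i : \sum_k c k * c k - c i * c i = 1.
  rewrite (bigD1 i) //= addrAC subrr add0r -(anorm i) [RHS](bigD1 i) //= adiag mul0r add0r.
  by apply: eq_bigr => k ki; rewrite aE // eq_sym.
have csq i : c i * c i = \sum_k c k * c k - 1 by have := cE i; lra.
have c2 i : c i * c i = (d%:R - 1)^-1.
  have : \sum_k c k * c k = d%:R * (\sum_k c k * c k - 1).
    by rewrite {1}(eq_bigr _ (fun k _ => csq k)) sumr_const card_ord mulr_natl.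
  rewrite csq; move: (\sum_k c k * c k) => S HS.
  apply: (mulIf (lt0r_neq0 d1_gt0)); rewrite mulVf ?lt0r_neq0 //; lra.
exists [ffun k => c k < 0] => i k /aE ->; rewrite /sgn ffunE.
have : c k ^+ 2 == simplex_coord ^+ 2 by rewrite expr2 c2 sqr_simplex_coord.
have kgt0 := simplex_coord_gt0.
rewrite eqf_sqr => /orP[] /eqP ->; first by rewrite ltNge (ltW kgt0) mul1r.
by rewrite oppr_lt0 kgt0 mulN1r.
Qed.

End rigidity.

Lemma dotrV_suml {R : realType} {d : nat} (I : Type) (s : seq I) (P : pred I)
    (F : I -> 'rV[R]_d) z :
  dotrV (\sum_(i <- s | P i) F i) z = \sum_(i <- s | P i) dotrV (F i) z.
Proof.
apply: (big_morph (fun x => dotrV x z)) => [x y|]; first exact: dotrVDl.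
by rewrite /dotrV big1 // => i _; rewrite mxE mul0r.
Qed.

(** * Comparison of rotated bases *)

Section rotations.
Context {R : realType} {d : nat}.
Hypothesis d3 : (3 <= d)%N.
Variable G : set 'rV[R]_d.
Hypothesis smooth : almost_smooth G.

Let i0 : 'I_d := axis0 d3.
Let i1 : 'I_d := axis1 d3.

Let d1_gt0 : 0 < d%:R - 1 :> R.
Proof. by rewrite subr_gt0 ltr1n ltnW. Qed.

(** By [rigid], the shape forced on a normal orthogonal to row [i] at a point where [M] fails to
    X-ray [G]. *)
Definition simplex (M : 'M[R]_d) e i := \sum_(k | k != i) sgn e k *: row k M.

Definition bad_at (M : 'M[R]_d) e y := [/\ G y, ~ G^° y &
  forall i, outer_unit_normal G y (simplex M e i)].

Definition rotated (M M' : 'M[R]_d) (C D : R) :=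
  [/\ row i0 M' = C *: row i0 M + D *: row i1 M,
      row i1 M' = - D *: row i0 M + C *: row i1 M &
      forall k, k != i0 -> k != i1 -> row k M' = row k M].

Lemma dotrV_simplex M e i z :
  dotrV (simplex M e i) z = \sum_k sgn e k * dotrV (row k M) z - sgn e i * dotrV (row i M) z.
Proof.
rewrite /simplex dotrV_suml [X in X - _](bigD1 i) //= addrAC subrr add0r.
by apply: eq_bigr => k _; rewrite dotrVZl.
Qed.

Lemma sgn_neq0 (e : {ffun 'I_d -> bool}) k : sgn e k != 0 :> R.
Proof.
apply/eqP => s0; have := @sqr_sgn R d d3 e k; rewrite s0 mul0r => /esym/eqP.
by rewrite invr_eq0 gt_eqF.
Qed.

(** In the weighted coordinates [b] of [z = y - y'], the normals at [y] give [b i <= S] and those at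
    [y'] give [S' <= b' i]. Summing yields [S' <= 0 <= S], and every [b i] is of order [S]. As
    [S - S'] involves only the two rotated coordinates, it is a small multiple of [S], which forces
    [S = 0] and then [z = 0]. *)
Lemma bad_point_unique M M' C D e y y' : M *m M^T = 1%:M -> rotated M M' C D ->
  2 * (d%:R - 1) * (`|1 - C| + `|D|) < 1 ->
  bad_at M e y -> bad_at M' e y' -> y = y'.
Proof.
move=> MMt [r0 r1 rk] small [Gy _ ny] [Gy' _ ny'].
pose z := y - y'.
pose b k := sgn e k * dotrV (row k M) z; pose b' k := sgn e k * dotrV (row k M') z.
pose S := \sum_k b k; pose S' := \sum_k b' k.
have Sb i : b i <= S.
  have [_ /(_ y' Gy')] := ny i; rewrite -subr_ge0 -dotrVBr dotrV_simplex.
  by rewrite subr_ge0.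
have Sb' i : S' <= b' i.
  have [_ /(_ y Gy)] := ny' i; rewrite -subr_le0 -dotrVBr dotrV_simplex.
  by rewrite subr_le0.
have sumconst (x : R) : \sum_(i < d) x = d%:R * x.
  by rewrite sumr_const card_ord mulr_natl.
have S0 : 0 <= S.
  have : S <= \sum_(i < d) S by apply: ler_sum.
  by rewrite sumconst -subr_ge0 -[X in _ - X]mul1r -mulrBl pmulr_rge0.
have S'0 : S' <= 0.
  have : \sum_(i < d) S' <= S' by apply: ler_sum.
  by rewrite sumconst -subr_le0 -[X in _ - X]mul1r -mulrBl pmulr_rle0.
have d1 : 1 <= d%:R - 1 :> R by rewrite lerBrDr -(natrD _ 1 1) ler_nat ltnW.
have b_le i : `|b i| <= (d%:R - 1) * S.
  rewrite ler_norml; apply/andP; split; last by apply: le_trans (Sb i) _; rewrite ler_peMl.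
  have : \sum_(k | k != i) b k <= \sum_(k < d | k != i) S by apply: ler_sum.
  have -> : \sum_(k | k != i) b k = S - b i by rewrite /S [in RHS](bigD1 i) //= addrAC subrr add0r.
  have -> : \sum_(k < d | k != i) S = d%:R * S - S.
    by rewrite -sumconst [in RHS](bigD1 i) //= addrAC subrr add0r.
  by move=> ?; lra.
have sE : sgn e i0 * sgn e i1 * (d%:R - 1) * sgn e i1 = sgn e i0 :> R.
  by rewrite mulrAC -[_ * sgn e i1 * sgn e i1]mulrA sqr_sgn // divfK ?gt_eqF.
have sE' : sgn e i0 * sgn e i1 * (d%:R - 1) * sgn e i0 = sgn e i1 :> R.
  by rewrite mulrAC [sgn e i0 * sgn e i1]mulrC -[_ * sgn e i0 * sgn e i0]mulrA sqr_sgn // divfK ?gt_eqF.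
(* [s] is the product of the two signs; it expresses the rotation in the weighted coordinates. *)
set s := sgn e i0 * sgn e i1 * (d%:R - 1) : R in sE sE'.
have s1 : `|s| = 1.
  have : s ^+ 2 == 1.
    have -> : s ^+ 2 = (sgn e i0 * sgn e i0) * (sgn e i1 * sgn e i1) * (d%:R - 1) ^+ 2.
      by rewrite /s; ring.
    by rewrite !sqr_sgn //; apply/eqP; field; exact: lt0r_neq0.
  by rewrite sqrf_eq1 => /orP[] /eqP ->; rewrite ?normrN normr1.
have b0E : b' i0 = C * b i0 + D * s * b i1.
  rewrite /b' r0 dotrVDl !dotrVZl /b.
  have -> : D * s * (sgn e i1 * dotrV (row i1 M) z) = D * (s * sgn e i1) * dotrV (row i1 M) z.
    by ring.
  by rewrite sE; ring.
have b1E : b' i1 = - D * s * b i0 + C * b i1.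
  rewrite /b' r1 dotrVDl !dotrVZl /b.
  have -> : - D * s * (sgn e i0 * dotrV (row i0 M) z) = - D * (s * sgn e i0) * dotrV (row i0 M) z.
    by ring.
  by rewrite sE'; ring.
have SS' : S - S' = b i0 + b i1 - (b' i0 + b' i1).
  rewrite /S /S' !(bigD1 i0 (P := predT)) //= !(bigD1 i1 (P := fun k => k != i0)) //=.
  have -> : \sum_(k | (k != i0) && (k != i1)) b' k = \sum_(k | (k != i0) && (k != i1)) b k.
    by apply: eq_bigr => k /andP[k0 k1]; rewrite /b' rk.
  by ring.
have S_eq0 : S = 0.
  apply/eqP; rewrite eq_le S0 andbT leNgt; apply/negP => Sgt0.
  have : S - S' <= (`|1 - C| + `|D|) * (2 * ((d%:R - 1) * S)).
    have -> : S - S' = (1 - C) * (b i0 + b i1) + D * (s * (b i0 - b i1)).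
      by rewrite SS' b0E b1E; ring.
    rewrite [leRHS]mulrDl; apply: lerD; apply: le_trans (ler_norm _) _; rewrite normrM ler_wpM2l //.
      by apply: le_trans (ler_normD _ _) _; rewrite mulrDl !mul1r lerD.
    rewrite normrM s1 mul1r; apply: le_trans (ler_normB _ _) _.
    by rewrite mulrDl !mul1r lerD.
  have -> : (`|1 - C| + `|D|) * (2 * ((d%:R - 1) * S)) = 2 * (d%:R - 1) * (`|1 - C| + `|D|) * S by ring.
  move=> h; have : S - S' < S by apply: le_lt_trans h _; rewrite -[ltRHS]mul1r ltr_pM2r.
  by rewrite gtrDl oppr_lt0 ltNge S'0.
suff z0 : z = 0 by apply/eqP; rewrite -subr_eq0; apply/eqP.
rewrite -(mul_orthK MMt z) (_ : z *m M^T = 0) ?mul0mx //; apply/rowP => k.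
rewrite [RHS]mxE; have := b_le k; rewrite S_eq0 mulr0 normr_le0 mulf_eq0 (negbTE (sgn_neq0 e k)) /=.
move=> /eqP <-; rewrite dotrVC dotrV_mx !mxE; by apply: eq_bigr => j _; rewrite !mxE.
Qed.

(** Normal [i0] of one basis against normal [i1] of the other has inner product [dotrV U U] plus or
    minus [sgn e i0 * sgn e i1 * D], with opposite signs for the two pairings. As [dotrV U U] equals
    the angle bound, one pairing violates it unless [D = 0]. *)
Lemma rotated_not_bad M M' C D e y : M *m M^T = 1%:M -> rotated M M' C D -> D != 0 ->
  bad_at M e y -> bad_at M' e y -> False.
Proof.
move=> MMt [r0 r1 rk] D0 [Gy nGy ny] [_ _ ny'].
have by_ : (closure G `\` G^°) y by split => //; exact: subset_closure.
have angle := smooth.2 y by_.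
pose U := \sum_(k | (k != i0) && (k != i1)) sgn e k *: row k M.
have s0E : simplex M e i0 = sgn e i1 *: row i1 M + U.
  by rewrite /simplex (bigD1 i1) //=.
have s1E : simplex M e i1 = sgn e i0 *: row i0 M + U.
  rewrite /simplex (bigD1 i0) //=; congr (_ + _); apply: eq_bigl => k; exact: andbC.
have UE : \sum_(k | (k != i0) && (k != i1)) sgn e k *: row k M' = U.
  by apply: eq_bigr => k /andP[k0 k1]; rewrite rk.
have s0E' : simplex M' e i0 = sgn e i1 *: row i1 M' + U.
  by rewrite -UE /simplex (bigD1 i1) //=.
have s1E' : simplex M' e i1 = sgn e i0 *: row i0 M' + U.
  rewrite -UE /simplex (bigD1 i0) //=; congr (_ + _); apply: eq_bigl => k; exact: andbC.
have U0 : dotrV U (row i0 M) = 0.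
  rewrite /U dotrV_suml big1 // => k /andP[k0 k1].
  by rewrite dotrVZl dotrV_rows // (negbTE k0) mulr0.
have U1 : dotrV U (row i1 M) = 0.
  rewrite /U dotrV_suml big1 // => k /andP[k0 k1].
  by rewrite dotrVZl dotrV_rows // (negbTE k1) mulr0.
have [b00 b11 b01 b10] : [/\ dotrV (row i0 M) (row i0 M) = 1, dotrV (row i1 M) (row i1 M) = 1,
    dotrV (row i0 M) (row i1 M) = 0 & dotrV (row i1 M) (row i0 M) = 0].
  by rewrite !dotrV_rows.
have UU : dotrV U U = (d%:R - 2) / (d%:R - 1).
  have [/enorm_eq1 + _] := ny i0.
  rewrite s0E dotrVDl !dotrVDr !dotrVZl !dotrVZr b11 (dotrVC _ U) U1 !mulr0 mulr1 addr0 add0r.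
  rewrite sqr_sgn // => /eqP; rewrite addrC eq_sym -subr_eq => /eqP <-.
  by field; exact: lt0r_neq0.
have := angle _ _ (ny i0) (ny' i1).
rewrite s0E s1E' r0 -UU dotrVDl !dotrVDr !(dotrVZl, dotrVZr) !dotrVDr !(dotrVZl, dotrVZr).
rewrite b10 b11 (dotrVC _ U) U0 U1 !(mulr0, mulr1, add0r, addr0) lerDr => h1.
have := angle _ _ (ny i1) (ny' i0).
rewrite s1E s0E' r1 -UU dotrVDl !dotrVDr !(dotrVZl, dotrVZr) !dotrVDr !(dotrVZl, dotrVZr).
rewrite b00 b01 (dotrVC _ U) U0 U1 !(mulr0, mulr1, add0r, addr0) lerDr => h2.
have : sgn e i0 * sgn e i1 * D = 0 by apply/eqP; rewrite eq_le; apply/andP; split; lra.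
move=> /eqP; apply/negP.
exact: mulf_neq0 (mulf_neq0 (sgn_neq0 e i0) (sgn_neq0 e i1)) D0.
Qed.

(* The rotation by [2 atan t] in the plane of the first two axes. *)
Definition rot (t : R) : 'M[R]_d :=
  let c := (1 - t ^+ 2) / (1 + t ^+ 2) in let s := 2 * t / (1 + t ^+ 2) in
  \matrix_(i < d) (if i == i0 then c *: delta_mx 0 i0 + s *: delta_mx 0 i1
    else if i == i1 then - s *: delta_mx 0 i0 + c *: delta_mx 0 i1
    else delta_mx 0 i : 'rV[R]_d).

Let den_neq0 (t : R) : 1 + t ^+ 2 != 0.
Proof. by rewrite gt_eqF // ltr_pwDl // sqr_ge0. Qed.

Lemma dotrV_delta (i j : 'I_d) : dotrV (delta_mx 0 i) (delta_mx 0 j) = (i == j)%:R :> R.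
Proof.
rewrite /dotrV (bigD1 i) //= !mxE !eqxx mul1r big1 ?addr0 //.
by move=> k ki; rewrite !mxE eqxx (negbTE ki) mul0r.
Qed.

Lemma rot_orth t : rot t *m (rot t)^T = 1%:M.
Proof.
apply/matrixP => i j; rewrite [RHS]mxE.
have -> : (rot t *m (rot t)^T) i j = dotrV (row i (rot t)) (row j (rot t)).
  by rewrite dotrV_mx !mxE; apply: eq_bigr => k _; rewrite !mxE.
rewrite !rowK; have t0 := den_neq0 t.
set c := (1 - t ^+ 2) / (1 + t ^+ 2); set s := 2 * t / (1 + t ^+ 2).
have cs1 : c * c + s * s = 1 by rewrite /c /s; field.
rewrite -[RHS]dotrV_delta /=; clearbody c s.
have [->|ni0] := eqVneq i i0; have [->|nj0] := eqVneq j i0 => //=.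
- rewrite dotrVDl !dotrVDr !(dotrVZl, dotrVZr) !dotrV_delta ?eqxx /=.
  by rewrite !(mulr0, mulr1, add0r, addr0).
- have [->|nj1] := eqVneq j i1;
    rewrite !(dotrVDl, dotrVDr) !(dotrVZl, dotrVZr) !dotrV_delta /=.
    by rewrite ?eqxx /= !(mulr0, mulr1, add0r, addr0); ring.
  by rewrite ![_ == j]eq_sym (negbTE nj0) (negbTE nj1) !(mulr0, addr0).
- have [->|ni1] := eqVneq i i1;
    rewrite !(dotrVDl, dotrVDr) !(dotrVZl, dotrVZr) !dotrV_delta /=.
    by rewrite ?eqxx /= !(mulr0, mulr1, add0r, addr0); ring.
  by rewrite (negbTE ni0) (negbTE ni1) !(mulr0, addr0).
have [->|ni1] := eqVneq i i1; have [->|nj1] := eqVneq j i1 => //=;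
  rewrite !(dotrVDl, dotrVDr, dotrVZl, dotrVZr, dotrV_delta) /=.
- by rewrite ?eqxx !(mulr0, mulr1, add0r, addr0) mulrNN addrC.
- by rewrite ![_ == j]eq_sym (negbTE nj0) (negbTE nj1) !(mulr0, addr0).
- by rewrite (negbTE ni0) (negbTE ni1) !(mulr0, addr0).
Qed.

(** The two coefficients are the cosine and the sine of the difference of the angles, in terms of
    tangents of half-angles. *)
Lemma rot_rotated t u :
  rotated (rot t) (rot u)
    (((1 - t ^+ 2) * (1 - u ^+ 2) + 4 * (t * u)) / ((1 + t ^+ 2) * (1 + u ^+ 2)))
    (2 * (u - t) * (1 + t * u) / ((1 + t ^+ 2) * (1 + u ^+ 2))).
Proof.
have t0 := den_neq0 t; have u0 := den_neq0 u.
split.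
- rewrite !rowK /= !scalerDr !scalerA addrACA -!scalerDl.
  by congr (_ *: _ + _ *: _); field; apply/andP.
- rewrite !rowK /= !scalerDr !scalerA addrACA -!scalerDl.
  by congr (_ *: _ + _ *: _); field; apply/andP.
- by move=> k k0 k1; rewrite !rowK (negbTE k0) (negbTE k1).
Qed.

(** One minus the cosine is [2 (t - u) ^ 2 / q], and [1 + t u <= q] bounds the sine by
    [2 |u - t|]. *)
Lemma rot_small t u (h : R) : h <= 1 -> 0 <= t <= h -> 0 <= u <= h ->
  `|1 - ((1 - t ^+ 2) * (1 - u ^+ 2) + 4 * (t * u)) / ((1 + t ^+ 2) * (1 + u ^+ 2))| +
  `|2 * (u - t) * (1 + t * u) / ((1 + t ^+ 2) * (1 + u ^+ 2))| <= 4 * h.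
Proof.
move=> h1 /andP[t0 th] /andP[u0 uh]; set q := (1 + t ^+ 2) * (1 + u ^+ 2).
have q0 : 0 < q by rewrite mulr_gt0 // ltr_pwDl // sqr_ge0.
have q1 : 1 + t * u <= q by rewrite /q; have := sqr_ge0 (t - u); nra.
have tu0 : 0 <= t * u by exact: mulr_ge0.
have -> : 1 - ((1 - t ^+ 2) * (1 - u ^+ 2) + 4 * (t * u)) / q = 2 * (t - u) ^+ 2 / q.
  by rewrite /q; field; apply/andP; split; exact: den_neq0.
clearbody q; have tuh : `|u - t| <= h by rewrite ler_norml; apply/andP; split; lra.
have -> : `|2 * (t - u) ^+ 2 / q| = 2 * `|u - t| ^+ 2 / q.
  have e0 : 0 <= 2 * (t - u) ^+ 2 / q by exact: divr_ge0 (mulr_ge0 (ler0n _ 2) (sqr_ge0 _)) (ltW q0).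
  by rewrite (ger0_norm e0) real_normK ?num_real //; congr (_ / _); ring.
have -> : `|2 * (u - t) * (1 + t * u) / q| = 2 * `|u - t| * (1 + t * u) / q.
  rewrite !normrM normfV (gtr0_norm q0) (ger0_norm (ler0n _ 2)).
  by rewrite (ger0_norm (addr_ge0 ler01 tu0)).
rewrite -mulrDl ler_pdivrMr //; have := normr_ge0 (u - t).
move: (`|u - t|) tuh => x xh x0; nra.
Qed.

Lemma convex_segment x y (a : R) : convex_set (G : set (convex_lmodType 'rV[R]_d)) ->
  G x -> G y -> 0 <= a <= 1 -> G (x + a *: (y - x)).
Proof.
move=> cvG Gx Gy /andP[a0 a1].
have := cvG y x (Itv01 a0 a1) (mem_set Gy) (mem_set Gx); rewrite inE.
congr G; rewrite -[LHS]/(a *: y + (1 - a) *: x).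
by rewrite scalerBl scale1r scalerBr addrCA.
Qed.

(* If every line through [y] along the basis misses the interior, each basis
   vector has an orthogonal unit normal at [y], and rigidity identifies them. *)
Lemma bad_at_of_misses M y : M *m M^T = 1%:M -> G y ->
  (forall i (s : R), ~ inner G (y + s *: row i M)) -> exists e, bad_at M e y.
Proof.
move=> MMt Gy out; have [[cG cvG [c inc]] smoothG] := smooth.
have convG x x' (a : R) : G x -> G x' -> 0 <= a <= 1 -> G (x + a *: (x' - x)).
  exact: convex_segment.
have innc : inner G c by move: inc => /nbhs_rVP[e e0 H]; exists e.
have nGy : ~ G^° y.
  move=> /nbhs_rVP[e e0 H]; apply: (out i0 0); rewrite scale0r addr0.
  by exists e.
have by_ : (closure G `\` G^°) y by split => //; exact: subset_closure.
have normal i : exists u, outer_unit_normal G y u /\ dotrV u (row i M) = 0.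
  have rowi : dotrV (row i M) (row i M) = 1 by rewrite dotrV_rows // eqxx.
  by have [u nu uo] := supporting_orth cG convG innc rowi (out i); exists u.
have [w Hw] := choice normal.
have [e He] : exists e, forall i k, i != k -> dotrV (w i) (row k M) = sgn e k.
  apply: (rigid d3) => [i|i|i j]; first by case: (Hw i).
    by rewrite -parseval //; apply/enorm_eq1; case: (Hw i) => -[].
  rewrite -parseval //; apply: (smoothG _ by_); first by case: (Hw i).
  by case: (Hw j).
exists e; split=> // i; have [nw wi] := Hw i.
suff -> : simplex M e i = w i by [].
rewrite [RHS](orth_expand MMt) (bigD1 i) //= wi scale0r add0r.
by apply: eq_bigr => k ki; rewrite He // eq_sym.
Qed.

Lemma xray_basis : exists2 M : 'M[R]_d, M *m M^T = 1%:M &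
  forall y, G y -> exists i (t : R), inner G (y + t *: row i M).
Proof.
apply: contrapT => nx.
(* Chosen so that the bound [4 eta] of [rot_small], times [2 (d - 1)], is below 1 as
   [bad_point_unique] demands. *)
pose eta : R := (16 * d%:R)^-1.
have d0 : 0 < d%:R :> R by rewrite ltr0n (leq_trans _ d3).
have eta0 : 0 < eta by rewrite invr_gt0 mulr_gt0.
have eta1 : eta <= 1.
  by rewrite invf_le1 ?mulr_gt0 // -natrM ler1n muln_gt0 /= (leq_trans _ d3).
pose t_ (n : nat) : R := eta / n.+1%:R.
have t_bnd n : 0 <= t_ n <= eta.
  rewrite divr_ge0 ?(ltW eta0) //= ler_pdivrMr ?ltr0n // ler_peMr ?(ltW eta0) //.
  by rewrite ler1n.
have t_inj m n : t_ m = t_ n -> m = n.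
  move=> /(mulfI (lt0r_neq0 eta0)) /invr_inj /eqP.
  by rewrite eqr_nat eqSS => /eqP.
have bad n : exists e, exists y, bad_at (rot (t_ n)) e y.
  have [y [Gy ny]] : exists y, G y /\ forall i (s : R), ~ inner G (y + s *: row i (rot (t_ n))).
    apply: contrapT => ny; apply: nx; exists (rot (t_ n)); first exact: rot_orth.
    move=> y Gy; apply: contrapT => nyG; apply: ny; exists y; split=> // i s inn.
    by apply: nyG; exists i, s.
  by have [e be] := bad_at_of_misses (rot_orth _) Gy ny; exists e, y.
have [e He] := choice bad.
have [y Hy] := choice He.
pose F : finType := {ffun 'I_d -> bool}.
(* Pigeonhole: one more angle than there are sign patterns. *)
have /injectivePn[m [n mn emn]] : ~~ injectiveb (fun n : 'I_(#|F|.+1) => e n : F).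
  apply/negP => /injectiveP /leq_card.
  by rewrite card_ord ltnn.
have bm := Hy m; have := Hy n; rewrite -emn => bn.
have rmn := rot_rotated (t_ m) (t_ n).
have small := rot_small eta1 (t_bnd m) (t_bnd n).
set C := (X in rotated _ _ X _) in rmn; set D := (X in rotated _ _ _ X) in rmn.
have ymn : y m = y n.
  apply: (bad_point_unique (rot_orth _) rmn _ bm bn).
  apply: (@le_lt_trans _ _ (2 * (d%:R - 1) * (4 * eta))).
    by rewrite ler_wpM2l // mulr_ge0 // ltW.
  have : d%:R * eta = 16^-1 by rewrite /eta; field; exact: lt0r_neq0.
  by move=> ?; lra.
apply: (rotated_not_bad (rot_orth _) rmn _ bm); last by rewrite ymn; exact: bn.
have tmn : t_ n - t_ m != 0.
  by rewrite subr_eq0; apply: contra_neq mn => /t_inj nm; apply: val_inj.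
have /andP[tm0 _] := t_bnd m; have /andP[tn0 _] := t_bnd n.
have tt0 : 1 + t_ m * t_ n != 0 by rewrite gt_eqF // ltr_pwDl // mulr_ge0.
by rewrite /D !mulf_neq0 ?invr_eq0 ?pnatr_eq0 ?mulf_neq0 ?den_neq0.
Qed.

End rotations.

(** * Counting directions *)

Section direction_count.
Context {R : realType} {d : nat}.
Implicit Types (G : set 'rV[R]_d).

Lemma direction_counts_ge G m : whitney_direction_counts G m -> (d <= m)%N.
Proof.
move=> [_ [E [_ spanE _] <-]]; have := dim_span (enum_fset E).
by rewrite spanE dimvf dim_matrix mul1r.
Qed.

Lemma direction_counts_orth G (M : 'M[R]_d) : (0 < d)%N -> M *m M^T = 1%:M ->
  (forall r p, (0 < r)%N -> (0 < p)%E ->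
     (whitney_const r G (directions M) p < +oo)%E) ->
  whitney_direction_counts G d.
Proof.
move=> d0 MMt finw; split=> //.
pose E := [fset row i M | i in 'I_d]%fset.
have row_inj : injective (fun i : 'I_d => row i M).
  move=> i j rij; apply/eqP; have := dotrV_rows MMt i j.
  by rewrite rij dotrV_rows // eqxx; case: eqP => // _ /eqP; rewrite oner_eq0.
have EM : [set` E] = directions M.
  apply/seteqP; split=> x /=.
    by move=> /imfsetP[i _ ->]; exists i.
  by move=> [i _ <-]; apply/imfsetP; exists i.
exists E; last by rewrite card_imfset //= -cardE card_ord.
split=> [xi /imfsetP[i _ ->]||r p r0 p0]; first exact: enorm_row.
  apply/eqP; rewrite eqEsubv subvf /=; apply/subvP => v _; rewrite (orth_expand MMt v).
  apply: memv_suml => i _; apply: memvZ; apply: memv_span.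
  by apply/imfsetP; exists i.
by rewrite EM; exact: finw.
Qed.

End direction_count.

Theorem corollary6p4 (R : realType) (d : nat) (G : set 'rV[R]_d) :
  (3 <= d)%N -> almost_smooth G -> min_directions G = d.
Proof.
move=> d3 smooth; have [[cG cvG intG] _] := smooth.
have d0 : (0 < d)%N by exact: leq_trans d3.
have [M MMt xray] := xray_basis d3 smooth.
have convG x y (a : R) : G x -> G y -> 0 <= a <= 1 -> G (x + a *: (y - x)).
  exact: convex_segment.
have countd : whitney_direction_counts G d.
  apply: (direction_counts_orth d0 MMt) => r p r0 p0.
  exact: whitney_const_finite.
(* [xget] falls back on its default 0 only for an empty set, so exhibiting [d] as a minimum is
   enough. *)
have [countn minn] : [set n | whitney_direction_counts G n /\
    forall m, whitney_direction_counts G m -> (n <= m)%N] (min_directions G).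
  apply: xgetPex; exists d; split=> // m; exact: direction_counts_ge.
by apply/eqP; rewrite eqn_leq minn // (direction_counts_ge countn).
Qed.
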